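(* Let $F \in C^1(\overline{Q})$, $f \in C^1(\overline{Q}\times\mathbb{R}^3)$, $\varphi_1 \in C^2((-\infty,x_0])$, $\varphi_2\in C^2([x_0,+\infty))$, $\psi_1\in C^1((-\infty,x_0])$, $\psi_2\in C^1([x_0,+\infty))$ be real-valued, and let $f$ satisfy the Lipschitz condition with a constant $L$ with respect to its three last variables, i.e. for all $(t,x)\in\overline{Q}$ and all real $z_1,z_2,z_3,w_1,w_2,w_3$, $$|f(t,x,z_1,z_2,z_3)-f(t,x,w_1,w_2,w_3)|\le L\left(|z_1-w_1|+|z_2-w_2|+|z_3-w_3|\right).$$ Then the initial-value problem $$\partial_t^2u(t,x)-a^2\partial_x^2u(t,x)+f(t,x,u(t,x),\partial_tu(t,x),\partial_xu(t,x))=F(t,x),\quad (t,x)\in Q,$$ $$u(0,x)=\varphi(x),\quad \partial_tu(0,x)=\psi(x),\quad x\in\mathbb{R},$$ has a unique classical solution $u$ in the extended sense defined in the context. This solution is determined by $u(t,x)=u^{(j)}(t,x)$ for $(t,x)\in Q_*^{(j)}$, $j\in\{1,2,3\}$, where the functions $u^{(j)}\in C^2(\overline{Q_*^{(j)}})$ are determined as solutions of the following integro-differential equations. For $j\in\{1,2\}$ and $(t,x)\in\overline{Q_*^{(j)}}$, $$u^{(j)}(t,x)=\frac{\varphi_j(x-at)+\varphi_j(x+at)}{2}+\frac1{2a}\int_{x-at}^{x+at}\psi_j(\xi)\,d\xi+\frac1{2a}\int_0^t d\tau\int_{x-a(t-\tau)}^{x+a(t-\tau)}\Big(F(\tau,\xi)-f\big(\tau,\xi,u^{(j)}(\tau,\xi),\partial_tu^{(j)}(\tau,\xi),\partial_xu^{(j)}(\tau,\xi)\big)\Big)d\xi,$$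 and for $(t,x)\in Q_*^{(3)}$, $$u^{(3)}(t,x)=u^{(1)}\left(\frac{x_0+at-x}{2a},\frac{x_0-at+x}{2}\right)+u^{(2)}\left(\frac{at+x-x_0}{2a},\frac{at+x+x_0}{2}\right)+A-\varphi_1(x_0)-\varphi_2(x_0)$$ $$-\frac1{4a^2}\int_{x_0}^{x-at}dy\int_{x_0}^{x+at}\Big(F(P(y,z))-f\big(P(y,z),u^{(3)}(P(y,z)),\partial_tu^{(3)}(P(y,z)),\partial_xu^{(3)}(P(y,z))\big)\Big)dz,$$ where $P(y,z)=\left(\frac{z-y}{2a},\frac{z+y}{2}\right)$.
   Context: Setting: $a>0$, $x_0\in\mathbb{R}$ and $A\in\mathbb{R}$ are fixed; $Q=(0,\infty)\times\mathbb{R}$ with points $(t,x)$, and $\overline{Q}$ is its closure. The function $F$ is given on $\overline{Q}$, $f$ on $\overline{Q}\times\mathbb{R}^3$, $\varphi_1,\psi_1$ on $(-\infty,x_0]$, and $\varphi_2,\psi_2$ on $[x_0,+\infty)$. The initial data are $$\varphi(x)=\begin{cases}\varphi_1(x),&x<x_0,\\ A,&x=x_0,\\ \varphi_2(x),&x>x_0,\end{cases}\qquad \psi(x)=\begin{cases}\psi_1(x),&x<x_0,\\ \psi_2(x),&x>x_0.\end{cases}$$ Subdomains: $Q^{(1)}=\{(t,x)\in Q: x+at<x_0\}$, $Q^{(2)}=\{(t,x)\in Q: x-at>x_0\}$, $Q^{(3)}=\{(t,x)\in Q: x+at>x_0,\ x-at<x_0\}$; and $Q_*^{(1)}=\overline{Q^{(1)}}\setminus\overline{Q^{(3)}}$,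 $Q_*^{(2)}=\overline{Q^{(2)}}\setminus\overline{Q^{(3)}}$, $Q_*^{(3)}=\overline{Q^{(3)}}$. These three sets $Q_*^{(j)}$ partition $\overline{Q}$. Definition (classical solution in the extended sense). A function $u$ on $\overline{Q}$, with $u(t,x)=u^{(j)}(t,x)$ for $(t,x)\in Q_*^{(j)}$, $j\in\{1,2,3\}$, is called a classical solution of the initial-value problem if: 1) $u^{(j)}\in C^2(\overline{Q_*^{(j)}})$ for each $j\in\{1,2,3\}$ (so $u^{(j)}$ is understood as defined, with its derivatives, up to the boundary of $Q_*^{(j)}$); 2) for each $j\in\{1,2,3\}$, $u^{(j)}$ satisfies $\partial_t^2u^{(j)}-a^2\partial_x^2u^{(j)}+f(t,x,u^{(j)},\partial_tu^{(j)},\partial_xu^{(j)})=F(t,x)$ in $Q_*^{(j)}$; 3) $u(0,x)=\varphi(x)$ for all $x\in\mathbb{R}$; 4) $\partial_tu(0,x)=\psi(x)$ for all $x\in\mathbb{R}\setminus\{x_0\}$; 5) the following Goursat (matching) conditions hold for all $t\ge0$: $$u^{(3)}(t,x_0-at)=u^{(1)}(t,x_0-at)+A-\varphi_1(x_0),\qquad u^{(3)}(t,x_0+at)=u^{(2)}(t,x_0+at)+A-\varphi_2(x_0).$$ *)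

(* Defs.v *)
From Stdlib Require Import Reals List Lra.
From Coquelicot Require Import Coquelicot.
Import ListNotations.
Open Scope R_scope.

Definition closure_of {T : UniformSpace} (D : T -> Prop) (p : T) : Prop :=
  forall eps : posreal, exists q, ball p eps q /\ D q.

Definition interior_of {T : UniformSpace} (D : T -> Prop) (p : T) : Prop :=
  locally p D.

(* A point of R^2 is a pair, a point of R^2 x R^3 is a pair (p, (z1, z2, z3)).
   Partial derivatives are derivatives along the vectors of these bases. *)
Definition e_t : R * R := (1, 0).
Definition e_x : R * R := (0, 1).
Definition basis1 : list R := [1].
Definition basis2 : list (R * R) := [e_t; e_x].
Definition basis5 : list ((R * R) * (R * R * R)) :=
  [ (e_t, (0, 0, 0)); (e_x, (0, 0, 0));
    ((0, 0), (1, 0, 0)); ((0, 0), (0, 1, 0)); ((0, 0), (0, 0, 1)) ].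

Definition along {V : NormedModule R_AbsRing} (g : V -> R) (p e : V) (h : R) : R :=
  g (plus p (scal h e)).

(* C^k up to the boundary of D: g is continuous on D, and its partial
   derivatives in the interior of D, up to order k, extend continuously to D. *)
Fixpoint CK {V : NormedModule R_AbsRing} (basis : list V) (k : nat)
    (D : V -> Prop) (g : V -> R) : Prop :=
  continuous_on D g /\
  match k with
  | O => True
  | S k' => forall e, In e basis ->
      exists g' : V -> R,
        (forall p, interior_of D p -> is_derive (along g p e) 0 (g' p)) /\
        CK basis k' D g'
  end.

(* The partial derivative of g along e as a function on D, boundary included:
   the value at p is the limit at p of the derivative taken inside D.  See
   [pderiv_eq] for the identification with the extensions used in [CK]. *)
Definition pderiv {V : NormedModule R_AbsRing} (D : V -> Prop) (e : V)
    (g : V -> R) (p : V) : R :=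
  lim (filtermap (fun q => Derive (along g q e) 0)
                 (within (interior_of D) (locally p))).

Lemma pderiv_eq {V : NormedModule R_AbsRing} (D : V -> Prop) (e : V)
    (g g' : V -> R) (p : V) :
  continuous_on D g' ->
  (forall q, interior_of D q -> is_derive (along g q e) 0 (g' q)) ->
  D p -> closure_of (interior_of D) p ->
  pderiv D e g p = g' p.
Proof.
intros Hc Hd Dp Cp.
assert (PF : ProperFilter (within (interior_of D) (locally p))).
{ split.
  - intros P [eps He].
    destruct (Cp eps) as [q [Hq Dq]]; exists q; exact (He q Hq Dq).
  - apply within_filter, locally_filter. }
assert (Hlim : filterlim (fun q => Derive (along g q e) 0)
    (within (interior_of D) (locally p)) (locally (g' p))).
{ apply filterlim_within_ext with (f := g').
  - intros q Hq; symmetry; apply is_derive_unique, Hd, Hq.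
  - intros P HP. generalize (Hc p Dp P HP). unfold filtermap, within.
    apply filter_imp; intros q Hq Iq; apply Hq.
    exact (locally_singleton q D Iq). }
set (G := filtermap (fun q => Derive (along g q e) 0)
                    (within (interior_of D) (locally p))) in *.
assert (PG : ProperFilter G) by (apply filtermap_proper_filter; exact PF).
assert (CG : cauchy G).
{ intros eps; exists (g' p); apply Hlim; exists eps; auto. }
apply eq_close; intros eps.
assert (H1 : G (ball (lim G) (pos_div_2 eps))) by exact (complete_cauchy G PG CG _).
assert (H2 : G (ball (g' p) (pos_div_2 eps))) by (apply Hlim; exists (pos_div_2 eps); auto).
destruct (filter_ex _ (filter_and _ _ H1 H2)) as [y [Hy1 Hy2]].
replace (pos eps) with (pos_div_2 eps + pos_div_2 eps) by (simpl; lra).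
exact (ball_triangle _ y _ _ _ Hy1 (ball_sym _ _ _ Hy2)).
Qed.

Definition Q (p : R * R) : Prop := 0 < fst p.
Definition Qbar : R * R -> Prop := closure_of Q.

Inductive idx : Set := j1 | j2 | j3.

Definition Qsub (a x0 : R) (j : idx) (p : R * R) : Prop :=
  let (t, x) := p in
  match j with
  | j1 => Q p /\ x + a * t < x0
  | j2 => Q p /\ x - a * t > x0
  | j3 => Q p /\ x + a * t > x0 /\ x - a * t < x0
  end.

Definition Qstar (a x0 : R) (j : idx) (p : R * R) : Prop :=
  match j with
  | j3 => closure_of (Qsub a x0 j3) p
  | _ => closure_of (Qsub a x0 j) p /\ ~ closure_of (Qsub a x0 j3) p
  end.

Definition Qsbar (a x0 : R) (j : idx) : R * R -> Prop := closure_of (Qstar a x0 j).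

Definition phi (x0 A : R) (phi1 phi2 : R -> R) (x : R) : R :=
  if Rlt_dec x x0 then phi1 x else if Rlt_dec x0 x then phi2 x else A.

(* The value at x0 is never used. *)
Definition psi (x0 : R) (psi1 psi2 : R -> R) (x : R) : R :=
  if Rlt_dec x x0 then psi1 x else psi2 x.

(* F - f(t, x, v, v_t, v_x) at p, the derivatives of v being taken on D. *)
Definition source (F : R * R -> R) (f : (R * R) * (R * R * R) -> R)
    (D : R * R -> Prop) (v : R * R -> R) (p : R * R) : R :=
  F p - f (p, (v p, pderiv D e_t v p, pderiv D e_x v p)).

(* u is a classical solution in the extended sense, with pieces uj.  In the
   condition on the initial velocity, the derivative of u in t at t = 0 is
   one-sided. *)
Definition classical_solution_with (a x0 A : R)
    (F : R * R -> R) (f : (R * R) * (R * R * R) -> R)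
    (phi1 phi2 psi1 psi2 : R -> R)
    (u : R * R -> R) (uj : idx -> R * R -> R) : Prop :=
  (forall j p, Qstar a x0 j p -> u p = uj j p) /\
  (forall j, CK basis2 2 (Qsbar a x0 j) (uj j)) /\
  (forall j p, Qstar a x0 j p ->
     let D := Qsbar a x0 j in
     let v := uj j in
     pderiv D e_t (pderiv D e_t v) p - a ^ 2 * pderiv D e_x (pderiv D e_x v) p
       + f (p, (v p, pderiv D e_t v p, pderiv D e_x v p)) = F p) /\
  (forall x, u (0, x) = phi x0 A phi1 phi2 x) /\
  (forall x, x <> x0 ->
     filterlim (fun h => (u (h, x) - u (0, x)) / h) (at_right 0)
               (locally (psi x0 psi1 psi2 x))) /\
  (forall t, 0 <= t ->
     uj j3 (t, x0 - a * t) = uj j1 (t, x0 - a * t) + A - phi1 x0 /\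
     uj j3 (t, x0 + a * t) = uj j2 (t, x0 + a * t) + A - phi2 x0).

Definition classical_solution (a x0 A : R)
    (F : R * R -> R) (f : (R * R) * (R * R * R) -> R)
    (phi1 phi2 psi1 psi2 : R -> R) (u : R * R -> R) : Prop :=
  exists uj, classical_solution_with a x0 A F f phi1 phi2 psi1 psi2 u uj.

Definition cauchy_equation (a : R)
    (F : R * R -> R) (f : (R * R) * (R * R * R) -> R) (phij psij : R -> R)
    (D : R * R -> Prop) (v : R * R -> R) : Prop :=
  forall t x, D (t, x) ->
    v (t, x) =
      (phij (x - a * t) + phij (x + a * t)) / 2
      + / (2 * a) * RInt psij (x - a * t) (x + a * t)
      + / (2 * a) *
        RInt (fun tau =>
                RInt (fun xi => source F f D v (tau, xi))
                     (x - a * (t - tau)) (x + a * (t - tau))) 0 t.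

Definition P (a y z : R) : R * R := ((z - y) / (2 * a), (z + y) / 2).

Definition goursat_equation (a x0 A : R)
    (F : R * R -> R) (f : (R * R) * (R * R * R) -> R) (phi1 phi2 : R -> R)
    (uj : idx -> R * R -> R) : Prop :=
  forall t x, Qstar a x0 j3 (t, x) ->
    uj j3 (t, x) =
      uj j1 ((x0 + a * t - x) / (2 * a), (x0 - a * t + x) / 2)
      + uj j2 ((a * t + x - x0) / (2 * a), (a * t + x + x0) / 2)
      + A - phi1 x0 - phi2 x0
      - / (4 * a ^ 2) *
        RInt (fun y =>
                RInt (fun z => source F f (Qsbar a x0 j3) (uj j3) (P a y z))
                     x0 (x + a * t)) x0 (x - a * t).

Definition integral_equations (a x0 A : R)
    (F : R * R -> R) (f : (R * R) * (R * R * R) -> R)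
    (phi1 phi2 psi1 psi2 : R -> R) (uj : idx -> R * R -> R) : Prop :=
  cauchy_equation a F f phi1 psi1 (Qsbar a x0 j1) (uj j1) /\
  cauchy_equation a F f phi2 psi2 (Qsbar a x0 j2) (uj j2) /\
  goursat_equation a x0 A F f phi1 phi2 uj.

(* Main.v *)
Require Import Defs.
From Stdlib Require Import Reals List Lra ClassicalEpsilon.
From Coquelicot Require Import Coquelicot.
Open Scope R_scope.

(** In the characteristic coordinates y = x - a t, z = x + a t the equation reads
    u_yz = G (y, z, u, u_y, u_z), where G is Lipschitz in its last three arguments.  The
    three pieces live on the sectors y <= z <= x0, x0 <= y <= z and y <= x0 <= z.  The outer
    ones solve Cauchy problems with data on the diagonal y = z; the middle one solves a
    Goursat problem whose data, on y = x0 and z = x0, are the traces of the outer pieces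
    shifted by the constants in the matching conditions.

    Both kinds of problem are one fixed point equation for g = u_yz.  Given g, the functions
    u_y, u_z and u are integrals of g along characteristics plus terms from the data ([Pop],
    [Qop], [Uop]), and g must equal G of them ([Top]).  With respect to the weight
    exp (lam rho), rho being the distance to the data curve along characteristics, an
    integration gains 1 / lam, so [Top] is a contraction on boxes of any size
    ([Top_contracts]).  This yields global existence ([fixed_point_exists]), and uniqueness
    on any set that is closed under going back to the data ([fixed_point_unique]).

    To keep boundaries out of the analysis, the data and the nonlinearity are first extended
    to the whole plane: the nonlinearity by reflection in t = 0 ([reflect]), which preserves
    class C^1 and the Lipschitz condition, and functions on a sector by retraction.

    A fixed point gives u, u_y, u_z and u_yz only as continuous functions; the solution must
    be of class C^2.  For fixed y, z -> u_y (y, z) solves an ordinary differential equation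
    with parameter y, and its differentiability in y is the dependence of solutions on
    parameters.  That becomes algebra when derivatives are replaced by continuous slopes K,
    phi (y') - phi (y) = (y' - y) K (y, y'): the difference of two solutions solves a linear
    equation exactly, and the integrating factor exhibits its slope ([ode_param],
    [fixed_point_C2]).

    Finally all descriptions of a piece are compared with one equation, v = [Uop] of the
    source of v ([represented]).  Each integro-differential equation is equivalent to it, by
    a change of variables or of the order of integration ([cauchy_represented],
    [goursat_represented]).  The differential equation with its side conditions implies it,
    by integration along characteristics inside the sector and passage to its boundary
    ([increment_along], [pde_represented]).  Differentiating it once shows that the source is
    a fixed point, so uniqueness in all its forms is that of the fixed point
    ([rep_unique]). *)

(** * Continuity on whole spaces *)

Definition cont {U V : UniformSpace} (f : U -> V) : Prop := forall x, continuous f x.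

Lemma cont_const {U V : UniformSpace} (c : V) : cont (fun _ : U => c).
Proof. intros x; apply continuous_const. Qed.

Lemma cont_id {U : UniformSpace} : cont (fun x : U => x).
Proof. intros x; apply continuous_id. Qed.

Lemma cont_comp {U V W : UniformSpace} (g : V -> W) (f : U -> V) :
  cont g -> cont f -> cont (fun u => g (f u)).
Proof. intros Hg Hf x; apply continuous_comp; auto. Qed.

Lemma cont_pair {U V W : UniformSpace} (f : U -> V) (g : U -> W) :
  cont f -> cont g -> cont (fun u => (f u, g u) : prod_UniformSpace V W).
Proof.
intros Hf Hg x; refine (continuous_comp_2 f g (fun a b => (a, b) : prod_UniformSpace V W) x (Hf x) (Hg x) _).
apply continuous_ext with (fun u : V * W => u).
- intros []; reflexivity.
- apply continuous_id.
Qed.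

Lemma cont_fst {U V W : UniformSpace} (f : U -> prod_UniformSpace V W) :
  cont f -> cont (fun u => fst (f u)).
Proof.
intros Hf x; apply continuous_comp; [apply Hf |].
destruct (f x); apply continuous_fst.
Qed.

Lemma cont_snd {U V W : UniformSpace} (f : U -> prod_UniformSpace V W) :
  cont f -> cont (fun u => snd (f u)).
Proof.
intros Hf x; apply continuous_comp; [apply Hf |].
destruct (f x); apply continuous_snd.
Qed.

Lemma cont_plus {U : UniformSpace} (f g : U -> R) :
  cont f -> cont g -> cont (fun u => f u + g u).
Proof. intros Hf Hg x. exact (continuous_plus f g x (Hf x) (Hg x)). Qed.

Lemma cont_opp {U : UniformSpace} (f : U -> R) : cont f -> cont (fun u => - f u).
Proof. intros Hf x. exact (continuous_opp f x (Hf x)). Qed.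

Lemma cont_minus {U : UniformSpace} (f g : U -> R) :
  cont f -> cont g -> cont (fun u => f u - g u).
Proof. intros Hf Hg x. exact (continuous_minus f g x (Hf x) (Hg x)). Qed.

Lemma cont_mult {U : UniformSpace} (f g : U -> R) :
  cont f -> cont g -> cont (fun u => f u * g u).
Proof. intros Hf Hg x. exact (continuous_mult f g x (Hf x) (Hg x)). Qed.

Lemma cont_div {U : UniformSpace} (f : U -> R) (c : R) :
  cont f -> cont (fun u => f u / c).
Proof. intros Hf. apply cont_mult; [exact Hf | apply cont_const]. Qed.

Lemma cont_Rabs {U : UniformSpace} (f : U -> R) :
  cont f -> cont (fun u => Rabs (f u)).
Proof. intros Hf x. apply (continuous_comp f Rabs); [apply Hf | apply continuous_Rabs]. Qed.

Lemma cont_exp {U : UniformSpace} (f : U -> R) :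
  cont f -> cont (fun u => exp (f u)).
Proof. intros Hf x. apply (continuous_comp f exp); [apply Hf | apply continuous_exp]. Qed.

Lemma cont_ext {U V : UniformSpace} (f g : U -> V) :
  (forall u, f u = g u) -> cont f -> cont g.
Proof. intros H Hf x; apply continuous_ext with f; auto. Qed.

Lemma cont_Rmax {U : UniformSpace} (f g : U -> R) :
  cont f -> cont g -> cont (fun u => Rmax (f u) (g u)).
Proof.
intros Hf Hg; apply cont_ext with (fun u => (f u + g u + Rabs (f u - g u)) / 2).
- intros u; unfold Rmax; destruct Rle_dec; unfold Rabs; destruct Rcase_abs; lra.
- apply cont_div, cont_plus; [apply cont_plus | apply cont_Rabs, cont_minus]; assumption.
Qed.

Lemma cont_Rmin {U : UniformSpace} (f g : U -> R) :
  cont f -> cont g -> cont (fun u => Rmin (f u) (g u)).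
Proof.
intros Hf Hg; apply cont_ext with (fun u => (f u + g u - Rabs (f u - g u)) / 2).
- intros u; unfold Rmin; destruct Rle_dec; unfold Rabs; destruct Rcase_abs; lra.
- apply cont_div, cont_minus; [apply cont_plus | apply cont_Rabs, cont_minus]; assumption.
Qed.

Lemma continuous_R_eps {U : UniformSpace} (f : U -> R) (x : U) :
  continuous f x -> forall eps : R, 0 < eps -> locally x (fun y => Rabs (f y - f x) < eps).
Proof. intros H eps He. exact (proj1 (filterlim_locally f (f x)) H (mkposreal eps He)). Qed.

Lemma continuous_R_intro {U : UniformSpace} (f : U -> R) (x : U) :
  (forall eps : R, 0 < eps -> locally x (fun y => Rabs (f y - f x) < eps)) -> continuous f x.
Proof. intros H. apply filterlim_locally. intros eps. exact (H eps (cond_pos eps)). Qed.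

(** Compactness of [0,1] turns pointwise continuity into continuity uniform in the
    second variable, which is what a parametric integral needs. *)
Lemma uniform_on_segment {U : UniformSpace} (f : U * R -> R) (u : U) (eps : R) :
  cont (U := prod_UniformSpace U R_UniformSpace) f -> 0 < eps ->
  locally u (fun v => forall s, 0 <= s <= 1 -> Rabs (f (v, s) - f (u, s)) < eps).
Proof.
intros Hf He.
assert (H : forall s : R, {d : posreal | forall v r, ball u d v -> Rabs (r - s) < d ->
            Rabs (f (v, r) - f (u, s)) < eps / 2}).
{ intros s.
  assert (He2 : 0 < eps / 2) by lra.
  destruct (constructive_indefinite_description _
              (continuous_R_eps f (u, s) (Hf (u, s)) _ He2)) as [d Hd].
  exists d; intros v r Hv Hr. apply Hd. split; assumption. }
destruct (compactness_value_1d 0 1 (fun s => proj1_sig (H s))) as [d Hd].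
exists d; intros v Hv s Hs.
destruct (Rlt_dec (Rabs (f (v, s) - f (u, s))) eps) as [|Hn]; [assumption | exfalso].
apply (Hd s Hs); intros [t [Ht [Hst Hdt]]]; apply Hn; clear Hn.
destruct (H t) as [dt Hdt']; simpl in *.
assert (B1 := Hdt' v s (ball_le _ _ _ Hdt _ Hv) Hst).
assert (B2 := Hdt' u s (ball_center u dt) Hst).
replace (f (v, s) - f (u, s)) with ((f (v, s) - f (u, t)) - (f (u, s) - f (u, t))) by ring.
apply Rle_lt_trans with (1 := Rabs_triang _ _). rewrite Rabs_Ropp. lra.
Qed.

Lemma ex_RInt_cont (f : R -> R) (a b : R) : cont f -> ex_RInt f a b.
Proof. intros H; apply (ex_RInt_continuous (V := R_CompleteNormedModule)); intros; apply H. Qed.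

Lemma cont_slice {U : UniformSpace} (f : U * R -> R) (u : U) :
  cont (U := prod_UniformSpace U R_UniformSpace) f -> cont (fun s : R => f (u, s)).
Proof. intros H; apply (cont_comp f (fun s : R => (u, s))); auto.
apply cont_pair; [apply cont_const | apply cont_id]. Qed.

Lemma cont_RInt_unit {U : UniformSpace} (f : U * R -> R) :
  cont (U := prod_UniformSpace U R_UniformSpace) f -> cont (fun u => RInt (fun s => f (u, s)) 0 1).
Proof.
intros Hf u; apply continuous_R_intro; intros eps He.
assert (He2 : 0 < eps / 2) by lra.
generalize (uniform_on_segment f u _ Hf He2); apply filter_imp; intros v Hv.
rewrite <- (RInt_minus (V := R_CompleteNormedModule)) by (apply ex_RInt_cont; now apply cont_slice).
apply Rle_lt_trans with ((1 - 0) * (eps / 2)); [| lra].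
apply abs_RInt_le_const; [lra | |].
- apply ex_RInt_cont. apply cont_minus; now apply cont_slice.
- intros t Ht; apply Rlt_le, Hv; lra.
Qed.

(** Rescaling to [0,1] moves the bounds of an integral into its integrand, so that
    [cont_RInt_unit] also covers integrals whose bounds depend on the parameter. *)
Lemma RInt_unit (f : R -> R) (a b : R) : cont f ->
  RInt f a b = (b - a) * RInt (fun s => f (a + s * (b - a))) 0 1.
Proof.
intros Hf.
assert (H := RInt_comp_lin (V := R_CompleteNormedModule) f (b - a) a 0 1).
replace ((b - a) * 0 + a) with a in H by ring.
replace ((b - a) * 1 + a) with b in H by ring.
rewrite <- H by now apply ex_RInt_cont.
rewrite (RInt_scal (V := R_CompleteNormedModule) (fun y => f ((b - a) * y + a))).
- unfold scal; simpl; unfold mult; simpl. f_equal. apply RInt_ext. intros; f_equal; ring.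
- apply ex_RInt_cont. apply (cont_comp f); [assumption |].
  apply cont_plus; [apply cont_mult; [apply cont_const | apply cont_id] | apply cont_const].
Qed.

Lemma cont_RInt {U : UniformSpace} (f : U -> R -> R) (a b : U -> R) :
  cont (U := prod_UniformSpace U R_UniformSpace) (fun q => f (fst q) (snd q)) ->
  cont a -> cont b -> cont (fun u => RInt (f u) (a u) (b u)).
Proof.
intros Hf Ha Hb.
apply cont_ext with (fun u => (b u - a u) * RInt (fun s => f u (a u + s * (b u - a u))) 0 1).
- intros u. symmetry. apply RInt_unit. exact (cont_slice _ u Hf).
- apply cont_mult; [now apply cont_minus |].
  apply (cont_RInt_unit (fun q => f (fst q) (a (fst q) + snd q * (b (fst q) - a (fst q))))).
  apply (cont_comp _ (fun q : U * R => (fst q, a (fst q) + snd q * (b (fst q) - a (fst q)))) Hf).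
  assert (F : cont (U := prod_UniformSpace U R_UniformSpace) (fun q => fst q)) by (apply cont_fst, cont_id).
  assert (S : cont (U := prod_UniformSpace U R_UniformSpace) (fun q => snd q)) by (apply cont_snd, cont_id).
  apply cont_pair; [exact F |].
  apply cont_plus; [apply (cont_comp a); assumption |].
  apply cont_mult; [exact S |].
  apply cont_minus; [apply (cont_comp b) | apply (cont_comp a)]; assumption.
Qed.

(** Continuity of an explicit expression, by recursion on its syntax: global
    continuity hypotheses of the context are used for the functions that occur in
    it. *)
Ltac cont_step :=
  match goal with
  | |- cont (fun _ => ?c) => apply cont_const
  | |- cont (fun u => u) => apply cont_id
  | H : cont ?k |- cont ?k => exact H
  | H : cont ?k |- cont (fun u => ?k (@?f u)) => apply (cont_comp k f H)
  | |- cont (fun u => fst (@?f u)) => apply (cont_fst f)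
  | |- cont (fun u => snd (@?f u)) => apply (cont_snd f)
  | |- cont (fun u => (@?f u, @?g u)) => apply (cont_pair f g)
  | |- cont fst => exact (cont_fst (fun u => u) cont_id)
  | |- cont snd => exact (cont_snd (fun u => u) cont_id)
  | |- cont Rabs => exact (cont_Rabs (fun u => u) cont_id)
  | |- cont (fun u => @?f u + @?g u) => apply (cont_plus f g)
  | |- cont (fun u => @?f u - @?g u) => apply (cont_minus f g)
  | |- cont (fun u => @?f u * @?g u) => apply (cont_mult f g)
  | |- cont (fun u => @?f u / ?c) => apply (cont_div f c)
  | |- cont (fun u => - @?f u) => apply (cont_opp f)
  | |- cont (fun u => Rabs (@?f u)) => apply (cont_Rabs f)
  | |- cont (fun u => Rmax (@?f u) (@?g u)) => apply (cont_Rmax f g)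
  | |- cont (fun u => Rmin (@?f u) (@?g u)) => apply (cont_Rmin f g)
  | |- cont (fun u => exp (@?f u)) => apply (cont_exp f)
  | |- cont (fun u => RInt (@?f u) (@?a u) (@?b u)) => apply (cont_RInt f a b)
  end.
Ltac cont_tac := repeat (cbv beta; cont_step).

(** * Derivatives as continuous slopes *)

(** Caratheodory's form of the derivative.  Slopes are used instead of limits of
    difference quotients because they compose and integrate by algebra alone, and
    because continuity in both end points carries the continuity of the derivative. *)
Lemma derive_of_slope (h k : R -> R) (y : R) :
  (forall y', h y' - h y = (y' - y) * k y') -> continuous k y -> is_derive h y (k y).
Proof.
intros H Hk. apply is_derive_Reals. intros eps He.
destruct (continuous_R_eps k y Hk eps He) as [d Hd].
exists d; intros r Hr Hrd.
rewrite H. replace ((y + r - y) * k (y + r) / r) with (k (y + r)) by (field; assumption).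
apply Hd. unfold ball; simpl; unfold AbsRing_ball, abs, minus, plus, opp; simpl.
replace (y + r + - y) with r by ring. exact Hrd.
Qed.

Lemma RInt_of_derivative (f df : R -> R) (a b : R) :
  (forall x : R, is_derive f x (df x)) -> cont df -> RInt df a b = f b - f a.
Proof.
intros H1 H2. apply is_RInt_unique. apply (is_RInt_derive (V := R_CompleteNormedModule) f df); auto.
Qed.

Lemma RInt_split (f : R -> R) (a b c : R) : cont f -> RInt f a b + RInt f b c = RInt f a c.
Proof. intros H. apply (RInt_Chasles (V := R_CompleteNormedModule)); now apply ex_RInt_cont. Qed.

Lemma RInt_flip (f : R -> R) (a b : R) : cont f -> RInt f a b = - RInt f b a.
Proof. intros H. assert (E := RInt_split f a b a H). rewrite (RInt_point (V := R_CompleteNormedModule)) in E.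
change (@zero R_CompleteNormedModule) with 0 in E. lra. Qed.

Lemma RInt_same (f : R -> R) (a : R) : RInt f a a = 0.
Proof. exact (RInt_point (V := R_CompleteNormedModule) a f). Qed.

Lemma RInt_add (f g : R -> R) (a b : R) : cont f -> cont g ->
  RInt (fun s => f s + g s) a b = RInt f a b + RInt g a b.
Proof. intros; apply (RInt_plus (V := R_CompleteNormedModule)); now apply ex_RInt_cont. Qed.

Lemma RInt_sub (f g : R -> R) (a b : R) : cont f -> cont g ->
  RInt (fun s => f s - g s) a b = RInt f a b - RInt g a b.
Proof. intros; apply (RInt_minus (V := R_CompleteNormedModule)); now apply ex_RInt_cont. Qed.

Lemma RInt_mult_const (f : R -> R) (l a b : R) : cont f ->
  RInt (fun s => l * f s) a b = l * RInt f a b.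
Proof. intros; apply (RInt_scal (V := R_CompleteNormedModule)); now apply ex_RInt_cont. Qed.

Lemma is_derive_RInt_cont (f : R -> R) (a b : R) : cont f -> is_derive (fun x => RInt f a x) b (f b).
Proof.
intros H. apply (is_derive_RInt (V := R_NormedModule)) with a; [| apply H].
apply filter_forall; intros x. apply (RInt_correct (V := R_CompleteNormedModule)). now apply ex_RInt_cont.
Qed.

(** The mean of the derivative over the segment is a slope. *)
Lemma mean_slope (h h' : R -> R) (y y' : R) :
  (forall x : R, is_derive h x (h' x)) -> cont h' ->
  h y' - h y = (y' - y) * RInt (fun s => h' (y + s * (y' - y))) 0 1.
Proof. intros H1 H2. rewrite <- RInt_unit by assumption. symmetry; now apply RInt_of_derivative. Qed.

(** Values of [RInt] are typed in a normed module; [ring] wants to see [R]. *)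
Ltac toR := match goal with |- @eq _ ?a ?b => change (@eq R a b) end.

(** Leibniz's rule for a slope: [ck] and [dk] are the slopes of the bounds. *)
Lemma slope_of_RInt (h : R -> R -> R) (k : R -> R) (c d : R -> R) (y y' ck dk : R) :
  cont (h y) -> cont (h y') -> cont k ->
  (forall s, h y' s - h y s = (y' - y) * k s) ->
  c y' - c y = (y' - y) * ck -> d y' - d y = (y' - y) * dk ->
  RInt (h y') (c y') (d y') - RInt (h y) (c y) (d y) =
  (y' - y) * (dk * RInt (fun s => h y' (d y + s * (d y' - d y))) 0 1
              - ck * RInt (fun s => h y' (c y + s * (c y' - c y))) 0 1
              + RInt k (c y) (d y)).
Proof.
intros H1 H2 Hk E Ec Ed.
assert (A : RInt (h y') (c y') (d y') = RInt (h y') (c y) (d y) + RInt (h y') (d y) (d y') - RInt (h y') (c y) (c y')).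
{ rewrite <- (RInt_split (h y') (c y') (c y) (d y')) by assumption.
  rewrite <- (RInt_split (h y') (c y) (d y) (d y')) by assumption.
  rewrite (RInt_flip (h y') (c y') (c y)) by assumption. toR; ring. }
assert (B : RInt (h y') (c y) (d y) - RInt (h y) (c y) (d y) = (y' - y) * RInt k (c y) (d y)).
{ rewrite <- RInt_sub, <- RInt_mult_const by assumption. apply RInt_ext; intros; apply E. }
rewrite A, (RInt_unit _ (d y)), (RInt_unit _ (c y) (c y')), Ed, Ec by assumption.
replace (RInt (h y') (c y) (d y)) with (RInt (h y) (c y) (d y) + (y' - y) * RInt k (c y) (d y)) by lra.
rewrite <- Ed, <- Ec. 
set (X := RInt _ 0 1). set (Y := RInt _ 0 1).
rewrite Ed, Ec. ring.
Qed.

Lemma der_const (c x : R) : is_derive (fun _ : R => c) x 0.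
Proof. exact (is_derive_const (V := R_NormedModule) c x). Qed.
Lemma der_plus (f g : R -> R) (x a b : R) :
  is_derive f x a -> is_derive g x b -> is_derive (fun t => f t + g t) x (a + b).
Proof. exact (is_derive_plus (V := R_NormedModule) f g x a b). Qed.
Lemma der_minus (f g : R -> R) (x a b : R) :
  is_derive f x a -> is_derive g x b -> is_derive (fun t => f t - g t) x (a - b).
Proof. exact (is_derive_minus (V := R_NormedModule) f g x a b). Qed.
Lemma der_opp (f : R -> R) (x a : R) : is_derive f x a -> is_derive (fun t => - f t) x (- a).
Proof. exact (is_derive_opp (V := R_NormedModule) f x a). Qed.
Lemma der_mult (f g : R -> R) (x a b : R) :
  is_derive f x a -> is_derive g x b -> is_derive (fun t => f t * g t) x (a * g x + f x * b).
Proof. intros H1 H2. exact (is_derive_mult f g x a b H1 H2 Rmult_comm). Qed.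
Lemma der_comp (f g : R -> R) (x a b : R) :
  is_derive f (g x) a -> is_derive g x b -> is_derive (fun t => f (g t)) x (b * a).
Proof. exact (is_derive_comp f g x a b). Qed.

Lemma der_lin (f g : R -> R) (x l m c d : R) :
  is_derive f x l -> is_derive g x m -> is_derive (fun y => c * f y + d * g y) x (c * l + d * m).
Proof.
intros Hf Hg.
assert (S : forall (g : R -> R) (x l c : R), is_derive g x l -> is_derive (fun y => c * g y) x (c * l)).
{ intros g' x' l' c' H. replace (c' * l') with (0 * g' x' + c' * l') by ring.
  apply (der_mult (fun _ => c')); [apply der_const | exact H]. }
apply der_plus; now apply S.
Qed.

Definition C1_slope (h : R -> R) : Prop :=
  exists k : R * R -> R, cont k /\ forall y y', h y' - h y = (y' - y) * k (y, y').

Lemma eq_of_derive (f g d : R -> R) (c x : R) :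
  (forall x : R, is_derive f x (d x)) -> (forall x : R, is_derive g x (d x)) -> cont d -> f c = g c -> f x = g x.
Proof.
intros Hf Hg Cd E.
assert (A := RInt_of_derivative f d c x Hf Cd). assert (B := RInt_of_derivative g d c x Hg Cd).
assert (X : f x - f c = g x - g c) by (now rewrite <- A, <- B). lra.
Qed.

Lemma RInt_unit_const (f : R -> R) (c : R) : (forall s, f s = c) -> RInt f 0 1 = c.
Proof.
intros H. rewrite (RInt_ext _ (fun _ => c)) by (intros; apply H).
rewrite RInt_const. unfold scal; simpl; unfold mult; simpl. ring.
Qed.

Lemma RInt_translate (k : R -> R) (z h : R) : cont k -> RInt (fun s => k (z + s)) 0 h = RInt k z (z + h).
Proof.
intros Ck.
assert (E := RInt_comp_lin (V := R_CompleteNormedModule) k 1 z 0 h (ex_RInt_cont _ _ _ Ck)).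
replace (1 * 0 + z) with z in E by ring. replace (1 * h + z) with (z + h) in E by ring.
rewrite <- E. apply RInt_ext. intros s _. unfold scal; simpl; unfold mult; simpl.
rewrite !Rmult_1_l. f_equal. ring.
Qed.

(** * Functions of class C^k up to the boundary *)

Lemma cont_vplus {U : UniformSpace} {V : NormedModule R_AbsRing} (f g : U -> V) :
  cont f -> cont g -> cont (fun u => plus (f u) (g u)).
Proof. intros Hf Hg x. exact (continuous_plus f g x (Hf x) (Hg x)). Qed.

Lemma cont_vscal {U : UniformSpace} {V : NormedModule R_AbsRing} (k : U -> R) (f : U -> V) :
  cont k -> cont f -> cont (fun u => scal (k u) (f u)).
Proof. intros Hf Hg x. exact (continuous_scal k f x (Hf x) (Hg x)). Qed.

(** Composing with a map into [D] turns continuity on [D] into global continuity;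
    all statements about [D] below are transported to whole spaces in this way. *)
Lemma cont_comp_on {U V W : UniformSpace} (D : V -> Prop) (g : V -> W) (m : U -> V) :
  continuous_on D g -> cont m -> (forall u, D (m u)) -> cont (fun u => g (m u)).
Proof.
intros Hg Hm HD x S HS.
generalize (Hm x _ (Hg (m x) (HD x) S HS)). unfold filtermap, within.
apply filter_imp; auto.
Qed.

Lemma continuous_interior {V W : UniformSpace} (D : V -> Prop) (g : V -> W) (p : V) :
  continuous_on D g -> interior_of D p -> continuous g p.
Proof.
intros Hg Hp S HS. unfold filtermap. generalize (filter_and _ _ Hp (Hg p (locally_singleton _ _ Hp) S HS)).
apply filter_imp; intros q [H1 H2]; auto.
Qed.


Lemma cont_eq_at_0 (f g : R -> R) :
  cont f -> cont g -> (forall x, 0 < x -> f x = g x) -> f 0 = g 0.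
Proof.
intros Hf Hg H.
assert (Z : forall eps, 0 < eps -> Rabs (f 0 - g 0) < eps).
{ intros eps He.
  assert (He2 : 0 < eps / 2) by lra.
  destruct (filter_and _ _ (continuous_R_eps f 0 (Hf 0) _ He2) (continuous_R_eps g 0 (Hg 0) _ He2)) as [d Hd].
  assert (Pd := cond_pos d).
  destruct (Hd (d / 2)) as [H1 H2].
  { unfold ball; simpl; unfold AbsRing_ball, abs, minus, plus, opp; simpl.
    rewrite Rabs_pos_eq; lra. }
  rewrite <- H in H2 by lra.
  replace (f 0 - g 0) with ((f (d/2) - g 0) - (f (d/2) - f 0)) by ring.
  apply Rle_lt_trans with (1 := Rabs_triang _ _). rewrite Rabs_Ropp. lra. }
destruct (Req_dec (f 0) (g 0)) as [E | E]; [exact E | exfalso].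
specialize (Z (Rabs (f 0 - g 0))). apply (Rlt_irrefl (Rabs (f 0 - g 0))), Z, Rabs_pos_lt. lra.
Qed.

Lemma along_shift {V : NormedModule R_AbsRing} (g : V -> R) (p e : V) (s l : R) :
  is_derive (along g (plus p (scal s e)) e) 0 l -> is_derive (along g p e) s l.
Proof.
intros H.
assert (H2 : is_derive (fun r => along g (plus p (scal s e)) e (r - s)) s l).
{ rewrite <- (Rmult_1_l l).
  apply (is_derive_comp (fun x : R => along g (plus p (scal s e)) e x) (fun r => r - s)).
  - replace (s - s) with 0 by ring. exact H.
  - auto_derive; [exact I | ring]. }
apply is_derive_ext with (2 := H2). intros t. unfold along. f_equal.
rewrite <- plus_assoc. f_equal.
rewrite <- (scal_distr_r (V := V)). f_equal. unfold plus; simpl. ring.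
Qed.

(** Every point of [D] can be pushed into the interior along one fixed vector.  For
    such [D] the derivatives of a C^k function are determined on all of [D] by their
    values in the interior, and identities in the interior extend to [D]. *)
Definition collared {V : NormedModule R_AbsRing} (D : V -> Prop) : Prop :=
  exists n : V, forall (q : V) (eps : R), D q -> 0 < eps -> interior_of D (plus q (scal eps n)).

(** The increment of a function over a segment of [D], which may lie in the boundary,
    is the integral of its extended derivative: this is the fundamental theorem of
    calculus on the segments pushed inside by [eps], in the limit [eps -> 0]. *)
Lemma increment_along {V : NormedModule R_AbsRing} (D : V -> Prop) (e p : V) (g g' : V -> R) (h : R) :
  continuous_on D g -> continuous_on D g' ->
  (forall q, interior_of D q -> is_derive (along g q e) 0 (g' q)) ->
  (forall s, Rmin 0 h <= s <= Rmax 0 h -> D (plus p (scal s e))) ->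
  collared D ->
  RInt (fun s => g' (plus p (scal s e))) 0 h = g (plus p (scal h e)) - g p.
Proof.
intros Hg Hg' Hd HD [n HI].
(* [cl] clamps to the segment, so that [m] is defined and lies in [D] everywhere *)
set (cl := fun s => Rmax (Rmin 0 h) (Rmin s (Rmax 0 h))).
assert (B : Rmin 0 h <= Rmax 0 h) by (apply Rle_trans with 0; [apply Rmin_l | apply Rmax_l]).
assert (Hcl : forall s, Rmin 0 h <= cl s <= Rmax 0 h).
{ intros s; unfold cl; split; [apply Rmax_l |]. apply Rmax_lub; [exact B | apply Rmin_r]. }
assert (Hcl' : forall s, Rmin 0 h <= s <= Rmax 0 h -> cl s = s).
{ intros s [H1 H2]; unfold cl. rewrite (Rmin_left s), Rmax_right; auto. }
set (m := fun q : R * R => plus (plus p (scal (cl (snd q)) e)) (scal (Rabs (fst q)) n)).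
assert (Cm : cont (U := prod_UniformSpace R_UniformSpace R_UniformSpace) m).
{ unfold m, cl. apply cont_vplus; [apply cont_vplus; [apply cont_const | apply cont_vscal; [| apply cont_const]] | apply cont_vscal; [| apply cont_const]]; cont_tac. }
assert (Dm : forall q, D (m q)).
{ intros q; unfold m. destruct (Req_dec (fst q) 0) as [E | E].
  - rewrite E, Rabs_R0. rewrite (scal_zero_l (V := V)), plus_zero_r. apply HD, Hcl.
  - apply (locally_singleton _ _ (HI _ _ (HD _ (Hcl _)) (Rabs_pos_lt _ E))). }
assert (C1 := cont_comp_on D g m Hg Cm Dm). assert (C2 := cont_comp_on D g' m Hg' Cm Dm). simpl in C1, C2.
assert (Bh : Rmin 0 h <= h <= Rmax 0 h) by (split; [apply Rmin_r | apply Rmax_r]).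
assert (B0 : Rmin 0 h <= 0 <= Rmax 0 h) by (split; [apply Rmin_l | apply Rmax_l]).
assert (E : RInt (fun s => g' (m (0, s))) 0 h = g (m (0, h)) - g (m (0, 0))).
{ apply (cont_eq_at_0 (fun x => RInt (fun s => g' (m (x, s))) 0 h) (fun x => g (m (x, h)) - g (m (x, 0)))).
  - set (k := fun q => g' (m q)) in C2.
    change (cont (fun x : R => RInt (fun s => k (x, s)) 0 h)). cont_tac.
  - set (k := fun q => g (m q)) in C1.
    change (cont (fun x : R => k (x, h) - k (x, 0))). cont_tac.
  - intros x Hx. apply is_RInt_unique.
    replace (g (m (x, h))) with (along g (plus p (scal x n)) e h).
    replace (g (m (x, 0))) with (along g (plus p (scal x n)) e 0).
    apply (is_RInt_derive (V := R_CompleteNormedModule)).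
    + intros s Hs. apply along_shift.
      replace (m (x, s)) with (plus (plus p (scal x n)) (scal s e)).
      * apply Hd.
        rewrite <- plus_assoc, (plus_comm (scal x n)), plus_assoc. apply HI; auto.
      * unfold m; simpl. rewrite Hcl', Rabs_pos_eq by (auto; lra).
        rewrite <- plus_assoc, (plus_comm (scal x n)), plus_assoc. reflexivity.
    + intros s _. apply (cont_comp (fun q => g' (m q)) (fun s : R => (x, s))); [exact C2 | cont_tac].
    + unfold m, along; simpl. rewrite Hcl', Rabs_pos_eq by (auto; lra). f_equal.
      rewrite <- plus_assoc, (plus_comm (scal x n)), plus_assoc. reflexivity.
    + unfold m, along; simpl. rewrite Hcl', Rabs_pos_eq by (auto; lra). f_equal.
      rewrite <- plus_assoc, (plus_comm (scal x n)), plus_assoc. reflexivity. }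
assert (M : forall s, Rmin 0 h <= s <= Rmax 0 h -> m (0, s) = plus p (scal s e)).
{ intros s Hs. unfold m; simpl. rewrite Hcl' by exact Hs. rewrite Rabs_R0, (scal_zero_l (V := V)), plus_zero_r. reflexivity. }
rewrite M in E by exact Bh. rewrite M in E by exact B0.
rewrite (scal_zero_l (V := V)), plus_zero_r in E. rewrite <- E.
apply RInt_ext. intros s Hs. rewrite M; [reflexivity | lra].
Qed.

Lemma along2 (g : R * R -> R) (x y c d h : R) :
  along g (x, y) (c, d) h = g (x + h * c, y + h * d).
Proof. reflexivity. Qed.

Lemma plus_scal2 (x y c d h : R) :
  plus (x, y) (scal h (c, d)) = (x + h * c, y + h * d).
Proof. reflexivity. Qed.

Lemma partial_t (g : R * R -> R) (u v l : R) :
  is_derive (along g (u, v) e_t) 0 l -> is_derive (fun z => g (z, v)) u l.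
Proof.
intros H. apply is_derive_ext with (f := along g (0, v) e_t).
- intros t; unfold e_t; rewrite along2; apply f_equal, (f_equal2 pair); ring.
- apply along_shift. unfold e_t in *. rewrite plus_scal2.
  replace (0 + u * 1) with u by ring. replace (v + u * 0) with v by ring. exact H.
Qed.

Lemma partial_x (g : R * R -> R) (u v l : R) :
  is_derive (along g (u, v) e_x) 0 l -> is_derive (fun z => g (u, z)) v l.
Proof.
intros H. apply is_derive_ext with (f := along g (u, 0) e_x).
- intros t; unfold e_x; rewrite along2; apply f_equal, (f_equal2 pair); ring.
- apply along_shift. unfold e_x in *. rewrite plus_scal2.
  replace (0 + v * 1) with v by ring. replace (u + v * 0) with u by ring. exact H.
Qed.

(** Differentiability of a function with continuous partial derivatives. *)
Lemma chain2 (D : R * R -> Prop) (g gt gx : R * R -> R) (q : R * R) (e1 e2 : R) :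
  continuous_on D gt ->
  (forall q, interior_of D q -> is_derive (along g q e_t) 0 (gt q)) ->
  (forall q, interior_of D q -> is_derive (along g q e_x) 0 (gx q)) ->
  interior_of D q ->
  is_derive (along g q (e1, e2)) 0 (e1 * gt q + e2 * gx q).
Proof.
intros Ct Ht Hx Hq. destruct q as [x y].
assert (T : forall u v, interior_of D (u, v) -> is_derive (fun z => g (z, v)) u (gt (u, v)))
  by (intros; now apply partial_t, Ht).
assert (X : forall u v, interior_of D (u, v) -> is_derive (fun z => g (u, z)) v (gx (u, v)))
  by (intros; now apply partial_x, Hx).
assert (Dif : differentiable_pt_lim (fun u v => g (u, v)) x y (gt (x, y)) (gx (x, y))).
{ apply filterdiff_differentiable_pt_lim.
  apply (is_derive_filterdiff (fun u v => g (u, v)) x y (fun u v => gt (u, v)) (gx (x, y))).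
  - generalize (locally_locally _ _ Hq). apply filter_imp. intros [u v] Huv. apply T, Huv.
  - apply X, Hq.
  - apply continuous_ext with gt; [intros []; reflexivity |].
    now apply continuous_interior with D. }
apply is_derive_Reals.
apply derivable_pt_lim_ext with (f := fun h => (fun u v => g (u, v)) (x + h * e1) (y + h * e2)).
{ intros z; reflexivity. }
rewrite (Rmult_comm e1), (Rmult_comm e2).
apply (derivable_pt_lim_comp_2d (fun u v => g (u, v)) (fun h => x + h * e1) (fun h => y + h * e2) 0).
- rewrite !Rmult_0_l, !Rplus_0_r. exact Dif.
- apply is_derive_Reals. auto_derive; [exact I | ring].
- apply is_derive_Reals. auto_derive; [exact I | ring].
Qed.
Lemma closure_of_shift {V : NormedModule R_AbsRing} (D : V -> Prop) (p n : V) :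
  (forall eps, 0 < eps -> D (plus p (scal eps n))) -> closure_of D p.
Proof.
intros H eps.
set (m := fun x : R => plus p (scal x n)).
assert (Cm : cont m).
{ unfold m. apply cont_vplus; [apply cont_const |]. apply cont_vscal; [apply cont_id | apply cont_const]. }
assert (M0 : m 0 = p) by (unfold m; rewrite (scal_zero_l (V := V)), plus_zero_r; reflexivity).
assert (L : locally 0 (fun x => ball (m 0) eps (m x))) by (apply (proj1 (filterlim_locally m (m 0)) (Cm 0) eps)).
destruct L as [d Hd]. assert (Pd := cond_pos d).
exists (m (d / 2)); split.
- rewrite <- M0. apply Hd. change (Rabs (d / 2 - 0) < d). rewrite Rminus_0_r, Rabs_pos_eq; lra.
- apply H; lra.
Qed.

Lemma closure_of_le {V : UniformSpace} (D : V -> Prop) (l : V -> R) (p : V) :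
  cont l -> (forall q, D q -> 0 <= l q) -> closure_of D p -> 0 <= l p.
Proof.
intros Cl H Hp. apply Rnot_lt_le; intros Hn.
assert (L := continuous_R_eps l p (Cl p) (- l p) ltac:(lra)).
destruct L as [d Hd]. destruct (Hp d) as [q [Hq1 Hq2]].
specialize (H q Hq2). specialize (Hd q Hq1). simpl in Hd.
apply Rabs_def2 in Hd. lra.
Qed.

Lemma interior_pos {V : UniformSpace} (l : V -> R) (p : V) :
  cont l -> 0 < l p -> locally p (fun q => 0 < l q).
Proof.
intros Cl Hp. generalize (continuous_R_eps l p (Cl p) (l p) Hp). apply filter_imp.
intros q Hq. apply Rabs_def2 in Hq. lra.
Qed.

Lemma continuous_on_ext {U V : UniformSpace} (D : U -> Prop) (f g : U -> V) :
  (forall x, D x -> f x = g x) -> continuous_on D f -> continuous_on D g.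
Proof.
intros E H x Dx. rewrite <- (E x Dx). intros S HS.
generalize (H x Dx S HS). unfold filtermap, within. apply filter_imp.
intros y Hy Dy. rewrite <- (E y Dy). auto.
Qed.

Lemma cont_continuous_on {U V : UniformSpace} (D : U -> Prop) (f : U -> V) : cont f -> continuous_on D f.
Proof. intros H; apply continuous_on_forall; intros; apply H. Qed.

Lemma along_ext_loc {V : NormedModule R_AbsRing} (f g : V -> R) (p e : V) (l : R) :
  locally p (fun q => f q = g q) -> is_derive (along f p e) 0 l -> is_derive (along g p e) 0 l.
Proof.
intros H. apply (is_derive_ext_loc (V := R_NormedModule)). unfold along.
assert (Cm : cont (fun h : R => plus p (scal h e))).
{ apply cont_vplus; [apply cont_const |]. apply cont_vscal; [apply cont_id | apply cont_const]. }
apply (Cm 0 (fun q => f q = g q)). rewrite (scal_zero_l (V := V)), plus_zero_r. exact H.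
Qed.

Lemma CK_ext {V : NormedModule R_AbsRing} (b : list V) (k : nat) (D : V -> Prop) (f g : V -> R) :
  (forall x, D x -> f x = g x) -> CK b k D f -> CK b k D g.
Proof.
intros E. destruct k as [| k]; intros [H1 H2]; (split; [now apply continuous_on_ext with f |]).
- exact I.
- intros e He. destruct (H2 e He) as [g' [G1 G2]]. exists g'; split; [| exact G2].
  intros p Hp. apply along_ext_loc with f; [| now apply G1].
  exact (filter_imp _ _ E Hp).
Qed.

Lemma CK_cont {V : NormedModule R_AbsRing} (b : list V) (k : nat) (D : V -> Prop) (f : V -> R) :
  CK b k D f -> continuous_on D f.
Proof. destruct k; intros [H _]; exact H. Qed.

(** [pderiv] is a witness for the derivatives required by [CK], so the existential
    quantifiers of [CK] can be avoided from here on. *)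
Lemma CK_pderiv {V : NormedModule R_AbsRing} (b : list V) (k : nat) (D : V -> Prop) (e : V) (f : V -> R) :
  collared D ->
  CK b (S k) D f -> In e b ->
  CK b k D (pderiv D e f) /\
  forall q, interior_of D q -> is_derive (along f q e) 0 (pderiv D e f q).
Proof.
intros [n HI] [_ H] He. destruct (H e He) as [g' [G1 G2]].
assert (E : forall p, D p -> pderiv D e f p = g' p).
{ intros p Dp. apply pderiv_eq; [now apply CK_cont with b k | exact G1 | exact Dp |].
  apply closure_of_shift with n. intros eps Heps. now apply HI. }
split.
- apply CK_ext with g'; [| exact G2]. intros x Dx; symmetry; now apply E.
- intros q Hq. rewrite E; [now apply G1 | now apply locally_singleton].
Qed.

Lemma pderiv_ext {V : NormedModule R_AbsRing} (D : V -> Prop) (e : V) (f g g' : V -> R) :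
  collared D ->
  (forall p, D p -> f p = g p) -> continuous_on D g' ->
  (forall q, interior_of D q -> is_derive (along g q e) 0 (g' q)) ->
  forall p, D p -> pderiv D e f p = g' p.
Proof.
intros [n HI] E Hc Hd p Dp. apply pderiv_eq; [exact Hc | | exact Dp |].
- intros q Hq. apply along_ext_loc with g; [| now apply Hd].
  apply (filter_imp D); [| exact Hq]. intros x Hx; symmetry; now apply E.
- apply closure_of_shift with n. intros eps Heps. now apply HI.
Qed.

Lemma continuous_on_minus {U : UniformSpace} (D : U -> Prop) (f g : U -> R) :
  continuous_on D f -> continuous_on D g -> continuous_on D (fun x => f x - g x).
Proof.
intros Hf Hg x Dx.
apply (filterlim_comp_2 (F := within D (locally x)) f g (fun a b => plus a (opp b)) (G := locally (f x)) (H := locally (g x)));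
  [now apply Hf | now apply Hg |].
apply (filterlim_comp_2 (F := filter_prod (locally (f x)) (locally (g x))) fst (fun z => opp (snd z)) plus (G := locally (f x)) (H := locally (opp (g x)))).
- apply filterlim_fst.
- apply filterlim_comp with (2 := filterlim_opp (g x)). apply filterlim_snd.
- apply (filterlim_plus (V := R_NormedModule)).
Qed.

Lemma continuous_on_scal {U : UniformSpace} (D : U -> Prop) (c : R) (w : U -> R) :
  continuous_on D w -> continuous_on D (fun p => c * w p).
Proof.
intros H x Dx. apply filterlim_comp with (1 := H x Dx).
exact (filterlim_scal_r (V := R_NormedModule) c (w x)).
Qed.

Lemma continuous_on_lin {U : UniformSpace} (D : U -> Prop) (c d : R) (w w' : U -> R) :
  continuous_on D w -> continuous_on D w' -> continuous_on D (fun p => c * w p + d * w' p).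
Proof.
intros H H'. apply continuous_on_ext with (fun p => c * w p - (- d) * w' p); [intros; toR; ring |].
apply continuous_on_minus; now apply continuous_on_scal.
Qed.

Lemma CK_weaken (D : R * R -> Prop) (v : R * R -> R) : CK basis2 2 D v -> CK basis2 1 D v.
Proof.
intros [H1 H2]. split; [exact H1 |]. intros e He. destruct (H2 e He) as [g' [A B]].
exists g'. split; [exact A |]. split; [apply CK_cont with (1 := B) | exact I].
Qed.

Lemma mixed_partials_agree (D : R * R -> Prop) (g gt gx gtx gxt : R * R -> R) (q : R * R) :
  continuous_on D gtx -> continuous_on D gxt ->
  (forall q, interior_of D q -> is_derive (along g q e_t) 0 (gt q)) ->
  (forall q, interior_of D q -> is_derive (along g q e_x) 0 (gx q)) ->
  (forall q, interior_of D q -> is_derive (along gt q e_x) 0 (gtx q)) ->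
  (forall q, interior_of D q -> is_derive (along gx q e_t) 0 (gxt q)) ->
  interior_of D q -> gtx q = gxt q.
Proof.
intros Ctx Cxt Ht Hx Htx Hxt Hq. destruct q as [x y].
assert (O : forall u v, interior_of D (u, v) -> locally u (fun z => interior_of D (z, v)) /\ locally v (fun z => interior_of D (u, z))).
{ intros u v H. assert (L := locally_locally _ _ H). split.
  - assert (C : cont (fun z : R => (z, v))) by cont_tac. exact (C u _ L).
  - assert (C : cont (fun z : R => (u, z))) by cont_tac. exact (C v _ L). }
assert (A1 : forall u v, interior_of D (u, v) -> is_derive (fun z => Derive (fun t => g (z, t)) v) u (gxt (u, v))).
{ intros u v H. apply is_derive_ext_loc with (f := fun z => gx (z, v)).
  - generalize (proj1 (O u v H)). apply filter_imp. intros z Hz. symmetry.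
    apply is_derive_unique. now apply partial_x, Hx.
  - now apply partial_t, Hxt. }
assert (A2 : forall u v, interior_of D (u, v) -> is_derive (fun z => Derive (fun t => g (t, z)) u) v (gtx (u, v))).
{ intros u v H. apply is_derive_ext_loc with (f := fun z => gt (u, z)).
  - generalize (proj2 (O u v H)). apply filter_imp. intros z Hz. symmetry.
    apply is_derive_unique. now apply partial_t, Ht.
  - now apply partial_x, Htx. }
assert (L : locally (x, y) (interior_of D)) by exact (locally_locally _ _ Hq).
refine (eq_trans (eq_sym (is_derive_unique _ _ _ (A2 x y Hq))) (eq_trans _ (is_derive_unique _ _ _ (A1 x y Hq)))).
symmetry.
apply (Schwarz (fun u v => g (u, v))).
- apply locally_2d_locally. generalize L. apply filter_imp. intros [u v] H; simpl.
  split; [exists (gt (u, v)); now apply partial_t, Ht |].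
  split; [exists (gx (u, v)); now apply partial_x, Hx |].
  split; [exists (gxt (u, v)); now apply A1 | exists (gtx (u, v)); now apply A2].
- apply continuity_2d_pt_ext_loc with (f := fun u v => gxt (u, v)).
  + apply locally_2d_locally. generalize L. apply filter_imp. intros [u v] H; simpl. symmetry. now apply is_derive_unique, A1.
  + apply continuity_2d_pt_filterlim. apply filterlim_ext with gxt; [intros []; reflexivity |].
    exact (continuous_interior D gxt (x, y) Cxt Hq).
- apply continuity_2d_pt_ext_loc with (f := fun u v => gtx (u, v)).
  + apply locally_2d_locally. generalize L. apply filter_imp. intros [u v] H; simpl. symmetry. now apply is_derive_unique, A2.
  + apply continuity_2d_pt_filterlim. apply filterlim_ext with gtx; [intros []; reflexivity |].
    exact (continuous_interior D gtx (x, y) Ctx Hq).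
Qed.

Lemma increment_flat (D : R * R -> Prop) (w w' : R * R -> R) (e1 e2 h : R) (p : R * R) :
  collared D -> continuous_on D w -> continuous_on D w' ->
  (forall q, interior_of D q -> is_derive (along w q (e1, e2)) 0 (w' q)) ->
  (forall s, Rmin 0 h <= s <= Rmax 0 h -> D (fst p + s * e1, snd p + s * e2)) ->
  RInt (fun s => w' (fst p + s * e1, snd p + s * e2)) 0 h = w (fst p + h * e1, snd p + h * e2) - w p.
Proof. intros. destruct p as [t x]. now apply (increment_along D (e1, e2) (t, x)). Qed.

(** * The nonlinearity in characteristic coordinates *)

Lemma Qbar_iff (p : R * R) : Qbar p <-> 0 <= fst p.
Proof.
split.
- intros H. apply (closure_of_le Q (fun q => fst q)); [cont_tac | | exact H]. intros q Hq; apply Rlt_le, Hq.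
- intros H. destruct p as [t x]. apply (closure_of_shift Q (t, x) (1, 0)). intros eps He.
  rewrite plus_scal2. unfold Q; simpl in *. lra.
Qed.

Definition space5 : NormedModule R_AbsRing :=
  prod_NormedModule _ (prod_NormedModule _ R_NormedModule R_NormedModule)
   (prod_NormedModule _ (prod_NormedModule _ R_NormedModule R_NormedModule) R_NormedModule).

Definition domain5 (q : (R * R) * (R * R * R)) : Prop := Qbar (fst q).

Lemma domain5_interior (q : (R * R) * (R * R * R)) : 0 < fst (fst q) -> interior_of domain5 q.
Proof.
intros H. assert (C : cont (fun q : (R * R) * (R * R * R) => fst (fst q))) by cont_tac.
unfold interior_of. generalize (interior_pos _ q C H). apply filter_imp.
intros [[t x] w] Hq. unfold domain5. apply Qbar_iff. simpl in *; lra.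
Qed.

Lemma increment_along5 (N N' : (R * R) * (R * R * R) -> R) (e q : space5) (h : R) :
  continuous_on (T := space5) domain5 N -> continuous_on (T := space5) domain5 N' ->
  (forall q, interior_of (T := space5) domain5 q -> is_derive (along (V := space5) N q e) 0 (N' q)) ->
  (forall s, Rmin 0 h <= s <= Rmax 0 h -> 0 <= fst (fst (plus q (scal s e)))) ->
  RInt (fun s => N' (plus q (scal s e))) 0 h = N (plus q (scal h e)) - N q.
Proof.
intros C C' Hd Hs.
apply (increment_along (V := space5) domain5); [exact C | exact C' | exact Hd | |].
- intros s Hs'. unfold domain5. apply Qbar_iff. now apply Hs.
- exists ((1, 0), (0, 0, 0)). intros [[t x] w] eps Hq He. apply domain5_interior. unfold domain5 in Hq. apply Qbar_iff in Hq.
  change (0 < t + eps * 1). simpl in Hq. lra.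
Qed.

Definition coord_t (q : (R * R) * (R * R * R)) : R := fst (fst q).
Definition coord_x (q : (R * R) * (R * R * R)) : R := snd (fst q).
Definition coord_u (q : (R * R) * (R * R * R)) : R := fst (fst (snd q)).
Definition coord_v (q : (R * R) * (R * R * R)) : R := snd (fst (snd q)).
Definition coord_w (q : (R * R) * (R * R * R)) : R := snd (snd q).

(** [N] minus its trace on t = 0, extended to t < 0 as an odd function of t, plus the
    trace.  Class C^1 on t >= 0 becomes class C^1 on the whole space, and the Lipschitz
    condition survives with three times the constant: no boundary is left in the
    analysis. *)
Definition reflect (N : (R * R) * (R * R * R) -> R) (q : (R * R) * (R * R * R)) : R :=
  N ((Rmax (fst (fst q)) 0, snd (fst q)), snd q)
  - N ((Rmax (- fst (fst q)) 0, snd (fst q)), snd q) + N ((0, snd (fst q)), snd q).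

Lemma reflect_id N q : 0 <= fst (fst q) -> reflect N q = N q.
Proof.
destruct q as [[t x] w]; simpl; intros H. unfold reflect; simpl.
rewrite Rmax_left, Rmax_right by lra. ring.
Qed.

Lemma cont_on_domain5 (N : (R * R) * (R * R * R) -> R) {U : UniformSpace} (t x : U -> R) (w : U -> R * R * R) :
  continuous_on (T := space5) domain5 N -> cont t -> cont x -> cont w -> (forall u, 0 <= t u) ->
  cont (fun u => N ((t u, x u), w u)).
Proof.
intros HN Ct Cx Cw Hp.
apply (cont_comp_on (V := space5) domain5 N (fun u => ((t u, x u), w u))); [exact HN | cont_tac |].
intros u. unfold domain5. apply Qbar_iff. apply Hp.
Qed.

Lemma cont_reflect (N : (R * R) * (R * R * R) -> R) :
  continuous_on (T := space5) domain5 N -> cont (reflect N).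
Proof.
intros HN. unfold reflect. apply cont_plus; [apply cont_minus |]; apply cont_on_domain5; try exact HN; try cont_tac.
- intros; apply Rmax_r.
- intros; apply Rmax_r.
- intros; lra.
Qed.

Lemma reflect_lipschitz (N : (R * R) * (R * R * R) -> R) (L : R) :
  (forall p, Qbar p -> forall u v w u' v' w', Rabs (N (p, (u, v, w)) - N (p, (u', v', w'))) <=
     L * (Rabs (u - u') + Rabs (v - v') + Rabs (w - w'))) ->
  forall p u v w u' v' w', Rabs (reflect N (p, (u, v, w)) - reflect N (p, (u', v', w'))) <=
     3 * L * (Rabs (u - u') + Rabs (v - v') + Rabs (w - w')).
Proof.
intros H [t x] u v w u' v' w'. unfold reflect; simpl.
assert (A := fun t' (Ht : 0 <= t') => H (t', x) (proj2 (Qbar_iff (t', x)) Ht) u v w u' v' w').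
assert (A1 := A _ (Rmax_r t 0)). assert (A2 := A _ (Rmax_r (- t) 0)). assert (A3 := A 0 (Rle_refl 0)).
apply Rabs_le_between in A1. apply Rabs_le_between in A2. apply Rabs_le_between in A3.
apply Rabs_le_between. lra.
Qed.

Lemma line5 (t x u v w a b c d e s : R) :
  plus (G := space5) ((t, x), (u, v, w)) (scal (V := space5) s ((a, b), (c, d, e))) =
  ((t + s * a, x + s * b), (u + s * c, v + s * d, w + s * e)).
Proof. reflexivity. Qed.

(** In a direction parallel to t = 0 the derivative of the reflection is the
    reflection of the derivative. *)
Lemma reflect_tangential (N N' : (R * R) * (R * R * R) -> R) (t x u v w b c d e h : R) :
  continuous_on (T := space5) domain5 N -> continuous_on (T := space5) domain5 N' ->
  (forall q, interior_of (T := space5) domain5 q -> is_derive (along (V := space5) N q ((0, b), (c, d, e))) 0 (N' q)) ->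
  reflect N ((t, x + h * b), (u + h * c, v + h * d, w + h * e)) - reflect N ((t, x), (u, v, w)) =
  h * RInt (fun s => reflect N' ((t, x + s * h * b), (u + s * h * c, v + s * h * d, w + s * h * e))) 0 1.
Proof.
intros C C' Hd.
assert (S : forall t, 0 <= t -> cont (fun s => N' ((t, x + s * b), (u + s * c, v + s * d, w + s * e)))).
{ intros t' Ht. apply cont_on_domain5; [exact C' | cont_tac | cont_tac | cont_tac | auto]. }
assert (I : forall t, 0 <= t -> RInt (fun s => N' ((t, x + s * b), (u + s * c, v + s * d, w + s * e))) 0 h =
  N ((t, x + h * b), (u + h * c, v + h * d, w + h * e)) - N ((t, x), (u, v, w))).
{ intros t' Ht.
  assert (E := increment_along5 N N' ((0, b), (c, d, e)) ((t', x), (u, v, w)) h C C' Hd).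
  rewrite line5, Rmult_0_r, Rplus_0_r in E. rewrite <- E.
  - apply RInt_ext; intros s _. rewrite line5, Rmult_0_r, Rplus_0_r. reflexivity.
  - intros s _. change (0 <= t' + s * 0). lra. }
assert (P1 := Rmax_r t 0). assert (P2 := Rmax_r (- t) 0). assert (P3 := Rle_refl 0).
assert (CR := cont_reflect N' C').
transitivity (RInt (fun s => reflect N' ((t, x + s * b), (u + s * c, v + s * d, w + s * e))) 0 h).
- unfold reflect; simpl.
  assert (S1 := S _ P1). assert (S2 := S _ P2). assert (S3 := S _ P3).
  rewrite (RInt_add (fun s => N' (Rmax t 0, x + s * b, (u + s * c, v + s * d, w + s * e)) -
     N' (Rmax (- t) 0, x + s * b, (u + s * c, v + s * d, w + s * e)))); [| now apply cont_minus | exact S3].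
  rewrite RInt_sub by assumption. rewrite !I by assumption. toR; ring.
- rewrite RInt_unit by cont_tac. f_equal; [toR; ring |]. apply RInt_ext; intros s _. 
  rewrite Rminus_0_r, Rplus_0_l. reflexivity.
Qed.

(** Across t = 0 the derivative of the reflection is the even extension of the
    derivative, which is continuous. *)
Lemma reflect_normal (N N' : (R * R) * (R * R * R) -> R) (t t' x : R) (w : R * R * R) :
  continuous_on (T := space5) domain5 N -> continuous_on (T := space5) domain5 N' ->
  (forall q, interior_of (T := space5) domain5 q -> is_derive (along (V := space5) N q ((1, 0), (0, 0, 0))) 0 (N' q)) ->
  reflect N ((t', x), w) - reflect N ((t, x), w) =
  (t' - t) * RInt (fun s => N' ((Rabs (t + s * (t' - t)), x), w)) 0 1.
Proof.
intros C C' Hd. destruct w as [[u v] w].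
assert (CA : cont (fun s => N' ((Rabs s, x), (u, v, w)))).
{ apply cont_on_domain5; [exact C' | cont_tac | cont_tac | cont_tac | intros; apply Rabs_pos]. }
assert (I : forall t, 0 <= t -> RInt (fun s => N' ((Rabs s, x), (u, v, w))) 0 t =
   N ((t, x), (u, v, w)) - N ((0, x), (u, v, w))).
{ intros r Hr.
  assert (E := increment_along5 N N' ((1, 0), (0, 0, 0)) ((0, x), (u, v, w)) r C C' Hd).
  rewrite line5 in E.
  replace (0 + r * 1) with r in E by ring. rewrite !Rmult_0_r, !Rplus_0_r in E. rewrite <- E.
  - apply RInt_ext; intros s. rewrite Rmin_left, Rmax_right by exact Hr. intros Hs.
    rewrite line5. rewrite !Rmult_0_r, !Rplus_0_r, Rmult_1_r, Rplus_0_l, Rabs_pos_eq by lra. reflexivity.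
  - intros s. rewrite Rmin_left, Rmax_right by exact Hr. intros Hs. change (0 <= 0 + s * 1). lra. }
assert (J : forall t, reflect N ((t, x), (u, v, w)) = N ((0, x), (u, v, w)) + RInt (fun s => N' ((Rabs s, x), (u, v, w))) 0 t).
{ intros r. destruct (Rle_dec 0 r) as [L | L].
  - rewrite reflect_id by exact L. rewrite I by exact L. toR; ring.
  - assert (E := RInt_comp_lin (V := R_CompleteNormedModule) (fun s => N' ((Rabs s, x), (u, v, w))) (-1) 0 0 (- r)
      (ex_RInt_cont _ _ _ CA)).
    replace (-1 * 0 + 0) with 0 in E by ring. replace (-1 * - r + 0) with r in E by ring. rewrite <- E.
    rewrite (RInt_ext _ (fun s => (-1) * N' ((Rabs s, x), (u, v, w)))).
    + rewrite RInt_mult_const by exact CA. rewrite I by lra.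
      unfold reflect; simpl. rewrite Rmax_right, Rmax_left by lra. toR; ring.
    + intros s _. unfold scal; simpl; unfold mult; simpl. do 4 f_equal.
      rewrite Rplus_0_r. rewrite <- (Rabs_Ropp s). f_equal; ring. }
rewrite !J, <- (RInt_unit (fun s => N' ((Rabs s, x), (u, v, w)))) by exact CA.
rewrite <- (RInt_split _ 0 t t') by exact CA. toR; ring.
Qed.

Definition C1_slopes5 (G : (R * R) * (R * R * R) -> R) : Prop :=
  exists k1 k2 k3 k4 k5 : ((R * R) * (R * R * R)) * ((R * R) * (R * R * R)) -> R,
  cont k1 /\ cont k2 /\ cont k3 /\ cont k4 /\ cont k5 /\
  forall t x u p q t' x' u' p' q',
  let v := (((t, x), (u, p, q)), ((t', x'), (u', p', q'))) in
  G ((t', x'), (u', p', q')) - G ((t, x), (u, p, q)) =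
  (t' - t) * k1 v + (x' - x) * k2 v + (u' - u) * k3 v + (p' - p) * k4 v + (q' - q) * k5 v.

(** One coordinate is changed at a time; each change is an integral of a continuous
    function, by the two lemmas above. *)
Lemma reflect_slopes (N N1 N2 N3 N4 N5 : (R * R) * (R * R * R) -> R) :
  continuous_on (T := space5) domain5 N -> continuous_on (T := space5) domain5 N1 -> continuous_on (T := space5) domain5 N2 ->
  continuous_on (T := space5) domain5 N3 -> continuous_on (T := space5) domain5 N4 -> continuous_on (T := space5) domain5 N5 ->
  (forall q, interior_of (T := space5) domain5 q -> is_derive (along (V := space5) N q ((1, 0), (0, 0, 0))) 0 (N1 q)) ->
  (forall q, interior_of (T := space5) domain5 q -> is_derive (along (V := space5) N q ((0, 1), (0, 0, 0))) 0 (N2 q)) ->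
  (forall q, interior_of (T := space5) domain5 q -> is_derive (along (V := space5) N q ((0, 0), (1, 0, 0))) 0 (N3 q)) ->
  (forall q, interior_of (T := space5) domain5 q -> is_derive (along (V := space5) N q ((0, 0), (0, 1, 0))) 0 (N4 q)) ->
  (forall q, interior_of (T := space5) domain5 q -> is_derive (along (V := space5) N q ((0, 0), (0, 0, 1))) 0 (N5 q)) ->
  C1_slopes5 (reflect N).
Proof.
intros C0 C1 C2 C3 C4 C5 H1 H2 H3 H4 H5.
assert (R2 := cont_reflect N2 C2). assert (R3 := cont_reflect N3 C3).
assert (R4 := cont_reflect N4 C4). assert (R5 := cont_reflect N5 C5).
assert (E1 : cont (fun q : (R * R) * (R * R * R) => N1 ((Rabs (fst (fst q)), snd (fst q)), snd q))).
{ apply cont_on_domain5; [exact C1 | cont_tac | cont_tac | cont_tac | intros; apply Rabs_pos]. }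
set (E := fun q : (R * R) * (R * R * R) => N1 ((Rabs (fst (fst q)), snd (fst q)), snd q)) in E1.
exists (fun v => RInt (fun s => E ((coord_t (fst v) + s * (coord_t (snd v) - coord_t (fst v)), coord_x (snd v)), (coord_u (snd v), coord_v (snd v), coord_w (snd v)))) 0 1).
exists (fun v => RInt (fun s => reflect N2 ((coord_t (fst v), coord_x (fst v) + s * (coord_x (snd v) - coord_x (fst v))), (coord_u (snd v), coord_v (snd v), coord_w (snd v)))) 0 1).
exists (fun v => RInt (fun s => reflect N3 ((coord_t (fst v), coord_x (fst v)), (coord_u (fst v) + s * (coord_u (snd v) - coord_u (fst v)), coord_v (snd v), coord_w (snd v)))) 0 1).
exists (fun v => RInt (fun s => reflect N4 ((coord_t (fst v), coord_x (fst v)), (coord_u (fst v), coord_v (fst v) + s * (coord_v (snd v) - coord_v (fst v)), coord_w (snd v)))) 0 1).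
exists (fun v => RInt (fun s => reflect N5 ((coord_t (fst v), coord_x (fst v)), (coord_u (fst v), coord_v (fst v), coord_w (fst v) + s * (coord_w (snd v) - coord_w (fst v))))) 0 1).
unfold coord_t, coord_x, coord_u, coord_v, coord_w.
split; [cont_tac |]. split; [cont_tac |]. split; [cont_tac |]. split; [cont_tac |]. split; [cont_tac |].
intros t x u p q t' x' u' p' q'; simpl.
assert (A1 := reflect_normal N N1 t t' x' (u', p', q') C0 C1 H1).
assert (A2 := reflect_tangential N N2 t x u' p' q' 1 0 0 0 (x' - x) C0 C2 H2).
assert (A3 := reflect_tangential N N3 t x u p' q' 0 1 0 0 (u' - u) C0 C3 H3).
assert (A4 := reflect_tangential N N4 t x u p q' 0 0 1 0 (p' - p) C0 C4 H4).
assert (A5 := reflect_tangential N N5 t x u p q 0 0 0 1 (q' - q) C0 C5 H5).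
rewrite !Rmult_0_r, !Rplus_0_r, !Rmult_1_r in A2, A3, A4, A5.
replace (x + (x' - x)) with x' in A2 by ring. replace (u + (u' - u)) with u' in A3 by ring.
replace (p + (p' - p)) with p' in A4 by ring. replace (q + (q' - q)) with q' in A5 by ring.
assert (X2 : RInt (fun s => reflect N2 (t, x + s * (x' - x), (u', p', q'))) 0 1 =
  RInt (fun s => reflect N2 (t, x + s * (x' - x) * 1, (u' + s * (x' - x) * 0, p' + s * (x' - x) * 0, q' + s * (x' - x) * 0))) 0 1).
{ apply RInt_ext; intros s _. rewrite !Rmult_0_r, !Rplus_0_r, !Rmult_1_r. reflexivity. }
assert (X3 : RInt (fun s => reflect N3 (t, x, (u + s * (u' - u), p', q'))) 0 1 =
  RInt (fun s => reflect N3 (t, x + s * (u' - u) * 0, (u + s * (u' - u) * 1, p' + s * (u' - u) * 0, q' + s * (u' - u) * 0))) 0 1).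
{ apply RInt_ext; intros s _. rewrite !Rmult_0_r, !Rplus_0_r, !Rmult_1_r. reflexivity. }
assert (X4 : RInt (fun s => reflect N4 (t, x, (u, p + s * (p' - p), q'))) 0 1 =
  RInt (fun s => reflect N4 (t, x + s * (p' - p) * 0, (u + s * (p' - p) * 0, p + s * (p' - p) * 1, q' + s * (p' - p) * 0))) 0 1).
{ apply RInt_ext; intros s _. rewrite !Rmult_0_r, !Rplus_0_r, !Rmult_1_r. reflexivity. }
assert (X5 : RInt (fun s => reflect N5 (t, x, (u, p, q + s * (q' - q)))) 0 1 =
  RInt (fun s => reflect N5 (t, x + s * (q' - q) * 0, (u + s * (q' - q) * 0, p + s * (q' - q) * 0, q + s * (q' - q) * 1))) 0 1).
{ apply RInt_ext; intros s _. rewrite !Rmult_0_r, !Rplus_0_r, !Rmult_1_r. reflexivity. }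
rewrite <- X2 in A2. rewrite <- X3 in A3. rewrite <- X4 in A4. rewrite <- X5 in A5.
unfold E; simpl. rewrite <- A1, <- A2, <- A3, <- A4, <- A5. toR; ring.
Qed.
Lemma continuous_on_fst (F : R * R -> R) : continuous_on Qbar F -> continuous_on (T := space5) domain5 (fun q => F (fst q)).
Proof.
intros H q Dq S HS. unfold filtermap, within.
assert (C : cont (fun q : (R * R) * (R * R * R) => fst q)) by cont_tac.
exact (C q _ (H (fst q) Dq S HS)).
Qed.

(** What is used of the equation in the coordinates y = x - a t, z = x + a t: there it
    reads u_yz = G (y, z, u, u_y, u_z), with [G] defined, Lipschitz and of class C^1 on
    all of R^5.  Only y <= z, that is t >= 0, has a meaning for the problem. *)
Record nonlinearity (a : R) (F : R * R -> R) (f G : (R * R) * (R * R * R) -> R) : Prop := {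
  non_F : continuous_on Qbar F;
  non_f : continuous_on (T := space5) domain5 f;
  non_G : cont G;
  non_lip : exists K, 0 <= K /\ forall p u v w u' v' w',
    Rabs (G (p, (u, v, w)) - G (p, (u', v', w'))) <= K * (Rabs (u - u') + Rabs (v - v') + Rabs (w - w'));
  non_slopes : C1_slopes5 G;
  non_eq : forall y z u p q, y <= z -> G ((y, z), (u, p, q)) =
     - / (4 * a ^ 2) * (F (P a y z) - f (P a y z, (u, a * (q - p), p + q))) }.

Section Nonlinearity.
Variables (a L : R) (F : R * R -> R) (f : (R * R) * (R * R * R) -> R).
Hypothesis ha : 0 < a.
Hypothesis hF : CK basis2 1 Qbar F.
Hypothesis hf : CK basis5 1 (fun q : (R * R) * (R * R * R) => Qbar (fst q)) f.
Hypothesis hLip : forall p : R * R, Qbar p -> forall z1 z2 z3 w1 w2 w3 : R,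
       Rabs (f (p, (z1, z2, z3)) - f (p, (w1, w2, w3)))
         <= L * (Rabs (z1 - w1) + Rabs (z2 - w2) + Rabs (z3 - w3)).

Lemma domain5_interior_fst (q : (R * R) * (R * R * R)) : interior_of (T := space5) domain5 q -> interior_of Qbar (fst q).
Proof.
intros H.
assert (C : cont (fun p : R * R => ((p, snd q) : space5))) by cont_tac.
assert (Hq : locally ((fst q, snd q) : space5) domain5) by (destruct q; exact H).
exact (C (fst q) _ Hq).
Qed.

Lemma nonlin_C1 : let N := fun q : (R * R) * (R * R * R) => F (fst q) - f q in
  continuous_on (T := space5) domain5 N /\
  forall e, In e basis5 -> exists N', continuous_on (T := space5) domain5 N' /\
    forall q, interior_of (T := space5) domain5 q -> is_derive (along (V := space5) N q e) 0 (N' q).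
Proof.
intros N. destruct hF as [CF DF]. destruct hf as [Cf Df].
split; [apply (continuous_on_minus (U := space5)); [now apply continuous_on_fst | exact Cf] |].
intros e He. destruct (Df e He) as [f' [D1 [D2 _]]].
assert (X : exists F', continuous_on Qbar F' /\ forall q : (R * R) * (R * R * R), interior_of Qbar (fst q) ->
   is_derive (fun h : R => F (plus (fst q) (scal h (fst e)))) 0 (F' (fst q))).
{ assert (Z : fst e = (0, 0) -> exists F', continuous_on Qbar F' /\ forall q : (R * R) * (R * R * R), interior_of Qbar (fst q) ->
   is_derive (fun h : R => F (plus (fst q) (scal h (fst e)))) 0 (F' (fst q))).
  { intros ->. exists (fun _ => 0). split; [apply cont_continuous_on, cont_const |].
    intros q _. apply is_derive_ext with (f := fun _ : R => F (fst q)); [| apply der_const].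
    intros h. destruct q as [[t x] w]. simpl fst. f_equal. rewrite plus_scal2.
    rewrite Rmult_0_r, !Rplus_0_r. reflexivity. }
  destruct He as [<- | [<- | He]].
  - destruct (DF e_t (or_introl eq_refl)) as [F' [E1 [E2 _]]]. exists F'; split; [exact E2 |].
    intros q Hq. apply (E1 (fst q) Hq).
  - destruct (DF e_x (or_intror (or_introl eq_refl))) as [F' [E1 [E2 _]]]. exists F'; split; [exact E2 |].
    intros q Hq. apply (E1 (fst q) Hq).
  - apply Z. destruct He as [<- | [<- | [<- | []]]]; reflexivity. }
destruct X as [F' [CF' DF']].
exists (fun q => F' (fst q) - f' q); split.
- apply (continuous_on_minus (U := space5)); [now apply continuous_on_fst | exact D2].
- intros q Hq. unfold N, along. apply der_minus; [| now apply D1].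
  apply DF'. now apply domain5_interior_fst.
Qed.

Lemma nonlinearity_exists : exists G, nonlinearity a F f G.
Proof.
destruct nonlin_C1 as [C0 HN]. set (N := fun q : (R * R) * (R * R * R) => F (fst q) - f q) in *.
destruct (HN (e_t, (0, 0, 0)) ltac:(simpl; auto)) as [N1 [C1 H1]].
destruct (HN (e_x, (0, 0, 0)) ltac:(simpl; auto)) as [N2 [C2 H2]].
destruct (HN ((0, 0), (1, 0, 0)) ltac:(simpl; auto)) as [N3 [C3 H3]].
destruct (HN ((0, 0), (0, 1, 0)) ltac:(simpl; auto)) as [N4 [C4 H4]].
destruct (HN ((0, 0), (0, 0, 1)) ltac:(simpl; auto 6)) as [N5 [C5 H5]].
destruct (reflect_slopes N N1 N2 N3 N4 N5 C0 C1 C2 C3 C4 C5 H1 H2 H3 H4 H5)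
  as [k1 [k2 [k3 [k4 [k5 [K1 [K2 [K3 [K4 [K5 HK]]]]]]]]]].
assert (CN := cont_reflect N C0).
set (c := - / (4 * a ^ 2)).
set (lin := fun q : (R * R) * (R * R * R) =>
   (((snd (fst q) - fst (fst q)) / (2 * a), (snd (fst q) + fst (fst q)) / 2),
    (fst (fst (snd q)), a * (snd (snd q) - snd (fst (snd q))), snd (fst (snd q)) + snd (snd q)))).
assert (Cl : cont lin) by (unfold lin; cont_tac).
set (lin2 := fun v : ((R * R) * (R * R * R)) * ((R * R) * (R * R * R)) => (lin (fst v), lin (snd v))).
assert (Cl2 : cont lin2) by (unfold lin2; cont_tac).
exists (fun q => c * reflect N (lin q)).
split; [exact (CK_cont _ _ _ _ hF) | exact (CK_cont _ _ _ _ hf) | cont_tac | | |].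
- exists (Rabs c * (3 * Rabs L * (1 + 2 * (Rabs a + 1)))).
  assert (Pa := Rabs_pos a). assert (PL := Rabs_pos L). assert (Pc := Rabs_pos c).
  split; [apply Rmult_le_pos; [exact Pc |]; apply Rmult_le_pos; lra |].
  assert (HL : forall p, Qbar p -> forall u v w u' v' w', Rabs (N (p, (u, v, w)) - N (p, (u', v', w'))) <=
     Rabs L * (Rabs (u - u') + Rabs (v - v') + Rabs (w - w'))).
  { intros p Hp u v w u' v' w'. unfold N; simpl.
    replace (F p - f (p, (u, v, w)) - (F p - f (p, (u', v', w')))) with
       (- (f (p, (u, v, w)) - f (p, (u', v', w')))) by ring.
    rewrite Rabs_Ropp. apply Rle_trans with (1 := hLip p Hp _ _ _ _ _ _).
    apply Rmult_le_compat_r; [| apply Rle_abs].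
    generalize (Rabs_pos (u - u')) (Rabs_pos (v - v')) (Rabs_pos (w - w')); lra. }
  intros p u v w u' v' w'.
  rewrite <- Rmult_minus_distr_l, Rabs_mult, Rmult_assoc. apply Rmult_le_compat_l; [exact Pc |].
  unfold lin; simpl. apply Rle_trans with (1 := reflect_lipschitz N _ HL _ _ _ _ _ _ _).
  rewrite (Rmult_assoc (3 * Rabs L) (1 + 2 * (Rabs a + 1))). apply Rmult_le_compat_l; [lra |].
  assert (A1 := Rabs_pos (u - u')). assert (A2 := Rabs_pos (v - v')). assert (A3 := Rabs_pos (w - w')).
  assert (B1 : Rabs (a * (w - v) - a * (w' - v')) <= Rabs a * (Rabs (v - v') + Rabs (w - w'))).
  { replace (a * (w - v) - a * (w' - v')) with (a * ((w - w') - (v - v'))) by ring.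
    rewrite Rabs_mult. apply Rmult_le_compat_l; [exact Pa |].
    apply Rle_trans with (1 := Rabs_triang _ _). rewrite Rabs_Ropp. lra. }
  assert (B2 : Rabs (v + w - (v' + w')) <= Rabs (v - v') + Rabs (w - w')).
  { replace (v + w - (v' + w')) with ((v - v') + (w - w')) by ring. apply Rabs_triang. }
  assert (X1 := Rmult_le_pos _ _ Pa A1). assert (X2 := Rmult_le_pos _ _ Pa A2). assert (X3 := Rmult_le_pos _ _ Pa A3).
  nra.
- exists (fun v => c * (- / (2 * a) * k1 (lin2 v) + / 2 * k2 (lin2 v))),
  (fun v => c * (/ (2 * a) * k1 (lin2 v) + / 2 * k2 (lin2 v))),
  (fun v => c * k3 (lin2 v)),
  (fun v => c * (- a * k4 (lin2 v) + k5 (lin2 v))),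
  (fun v => c * (a * k4 (lin2 v) + k5 (lin2 v))).
  split; [cont_tac |]. split; [cont_tac |]. split; [cont_tac |]. split; [cont_tac |]. split; [cont_tac |].
  intros y z u p q y' z' u' p' q' v.
  rewrite <- Rmult_minus_distr_l. unfold lin at 1 2; simpl. rewrite HK.
  match goal with |- context [k1 ?w] => change w with (lin2 v) end.
  clearbody c. field. lra.
- intros y z u p q Hyz. unfold lin; simpl. rewrite reflect_id.
  + reflexivity.
  + simpl. apply Rdiv_le_0_compat; lra.
Qed.
End Nonlinearity.

(** * Characteristic integral equations *)

(** The sign [e] stands for the orientation of the path towards [z]. *)
Lemma RInt_exp (M lam r z a b : R) (e : R) : lam <> 0 -> e * e = 1 ->
  RInt (fun s => M * exp (lam * (r - e * (z - s)))) a b =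
  e * M / lam * (exp (lam * (r - e * (z - b))) - exp (lam * (r - e * (z - a)))).
Proof.
intros Hl He.
rewrite (RInt_of_derivative (fun s => e * M / lam * exp (lam * (r - e * (z - s))))).
- toR; ring.
- intros s. auto_derive; [exact I |].
  replace (M * exp (lam * (r - e * (z - s)))) with (e * e * M * exp (lam * (r - e * (z - s))))
    by (rewrite He; ring).
  unfold Rminus. field. exact Hl.
- cont_tac.
Qed.

(** Integrating the weight exp (lam r) towards larger [r] gains the factor 1 / lam; with
    [lam] large the Picard map below becomes a contraction on sets of any size. *)
Lemma weighted_RInt (h : R -> R) (c z M lam r : R) :
  0 < lam -> cont h ->
  (forall s, Rmin c z <= s <= Rmax c z -> Rabs (h s) <= M * exp (lam * (r - Rabs (z - s)))) ->
  Rabs (RInt h c z) <= M * exp (lam * r) / lam.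
Proof.
intros Hl Hh HM.
assert (M0 : 0 <= M).
{ specialize (HM z). assert (E := exp_pos (lam * (r - Rabs (z - z)))).
  assert (A := Rabs_pos (h z)).
  apply Rmult_le_reg_r with (1 := E). rewrite Rmult_0_l.
  apply Rle_trans with (1 := A), HM. split; [apply Rmin_r | apply Rmax_r]. }
assert (Mn : forall x, 0 <= M / lam * exp x).
{ intros x; apply Rmult_le_pos; [| left; apply exp_pos]. now apply Rdiv_le_0_compat. }
destruct (Rle_dec c z) as [L | L].
- rewrite Rmin_left, Rmax_right in HM by exact L.
  apply Rle_trans with (RInt (fun s => M * exp (lam * (r - 1 * (z - s)))) c z).
  + apply Rle_trans with (1 := abs_RInt_le h c z L (ex_RInt_cont _ _ _ Hh)).
    apply RInt_le; [exact L | apply ex_RInt_cont; cont_tac | apply ex_RInt_cont; cont_tac |].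
    intros s Hs. replace (1 * (z - s)) with (Rabs (z - s)) by (rewrite Rabs_pos_eq; lra).
    apply HM; lra.
  + rewrite RInt_exp by lra. replace (r - 1 * (z - z)) with r by ring.
    assert (N := Mn (lam * (r - 1 * (z - c)))).
    replace (1 * M / lam) with (M / lam) by (unfold Rdiv; ring).
    replace (M * exp (lam * r) / lam) with (M / lam * exp (lam * r)) by (unfold Rdiv; ring). lra.
- assert (L' : z <= c) by lra.
  rewrite Rmin_right, Rmax_left in HM by exact L'.
  rewrite RInt_flip, Rabs_Ropp by exact Hh.
  apply Rle_trans with (RInt (fun s => M * exp (lam * (r - (-1) * (z - s)))) z c).
  + apply Rle_trans with (1 := abs_RInt_le h z c L' (ex_RInt_cont _ _ _ Hh)).
    apply RInt_le; [exact L' | apply ex_RInt_cont; cont_tac | apply ex_RInt_cont; cont_tac |].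
    intros s Hs. replace (-1 * (z - s)) with (Rabs (z - s)) by (rewrite Rabs_left1; lra).
    apply HM; lra.
  + rewrite RInt_exp by lra. replace (r - -1 * (z - z)) with r by ring.
    assert (N := Mn (lam * (r - -1 * (z - c)))).
    replace (-1 * M / lam) with (-(M / lam)) by (unfold Rdiv; ring).
    replace (M * exp (lam * r) / lam) with (M / lam * exp (lam * r)) by (unfold Rdiv; ring). lra.
Qed.

Definition box (x0 r : R) (p : R * R) : Prop :=
  Rabs (fst p - x0) <= r /\ Rabs (snd p - x0) <= r.

Lemma box_bound (f : R * R -> R) (x0 r : R) :
  cont f -> exists M, forall p, box x0 r p -> Rabs (f p) <= M.
Proof.
intros Hf.
(* the radius d also records a bound on f nearby: d <= 1 / (|f| + 1) *)
assert (H : forall s t : R, {d : posreal | (forall s' t', Rabs (s' - s) < d -> Rabs (t' - t) < d ->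
            Rabs (f (s', t') - f (s, t)) < 1) /\ d <= / (Rabs (f (s, t)) + 1) }).
{ intros s t.
  destruct (constructive_indefinite_description _
              (continuous_R_eps f (s, t) (Hf (s, t)) _ Rlt_0_1)) as [d Hd].
  assert (P0 : 0 < / (Rabs (f (s, t)) + 1)).
  { apply Rinv_0_lt_compat. generalize (Rabs_pos (f (s, t))); lra. }
  exists (mkposreal _ (Rmin_stable_in_posreal d (mkposreal _ P0))); simpl; split.
  - intros s' t' Hs Ht. apply Hd. split.
    + apply Rlt_le_trans with (1 := Hs), Rmin_l.
    + apply Rlt_le_trans with (1 := Ht), Rmin_l.
  - apply Rmin_r. }
destruct (compactness_value_2d (x0 - r) (x0 + r) (x0 - r) (x0 + r) (fun s t => proj1_sig (H s t))) as [d Hd].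
exists (/ d). intros [s t] [Hs Ht]; simpl in Hs, Ht.
destruct (Rle_dec (Rabs (f (s, t))) (/ d)) as [|Hn]; [assumption | exfalso].
apply Rabs_le_between in Hs. apply Rabs_le_between in Ht.
apply (Hd s t); [lra | lra |]. intros [u [v [_ [_ [Hu [Hv Hdt]]]]]]; apply Hn; clear Hn.
destruct (H u v) as [e [H1 H2]]; simpl in *.
specialize (H1 s t Hu Hv).
assert (P1 := Rabs_pos (f (u, v))). assert (Pd := cond_pos d).
assert (A : Rabs (f (u, v)) + 1 <= / d).
{ rewrite <- (Rinv_inv (Rabs (f (u, v)) + 1)).
  apply Rinv_le_contravar; [exact Pd | lra]. }
replace (f (s, t)) with ((f (s, t) - f (u, v)) + f (u, v)) by ring.
apply Rle_trans with (1 := Rabs_triang _ _). lra.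
Qed.

(** Differentiability of the solution of an ordinary differential equation in z with
    respect to the parameter y.  The hypothesis on [g] linearizes the equation exactly:
    for fixed y, y', the increment p (y', z) - p (y, z) solves a linear equation in z
    with coefficients [A] and [B] that are continuous in (y, y', z).  Its solution by an
    integrating factor is y' - y times a continuous function, which is thus a slope. *)
Lemma ode_param (p g : R * R -> R) (al gam : R -> R) (A B : R * R * R -> R) (al1 : R * R -> R) (k : R) :
  cont p -> cont g -> cont gam -> cont A -> cont B -> cont al1 ->
  (forall y z, p (y, z) = al y + RInt (fun s => g (y, s)) (gam y) z) ->
  (forall y y', al y' - al y = (y' - y) * al1 (y, y')) ->
  (forall y y', gam y' - gam y = (y' - y) * k) ->
  (forall y y' s, g (y', s) - g (y, s) = (y' - y) * B (y, y', s) + (p (y', s) - p (y, s)) * A (y, y', s)) ->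
  exists E : R * R * R -> R, cont E /\
    forall y y' z, p (y', z) - p (y, z) = (y' - y) * E (y, y', z).
Proof.
intros Cp Cg Cgam CA CB Cal Hp Hal Hgam Hg.
set (I := (fun w => RInt (fun s => A (fst w, s)) (gam (fst (fst w))) (snd w)) : R * R * R -> R).
assert (CI : cont I) by (unfold I; cont_tac).
set (c0 := fun w : R * R => al1 w - k * RInt (fun s => g (snd w, gam (fst w) + s * (gam (snd w) - gam (fst w)))) 0 1).
assert (Cc0 : cont c0) by (unfold c0; cont_tac).
set (E := fun w : R * R * R => exp (I w) * (c0 (fst w) +
   RInt (fun s => B (fst w, s) * exp (- I (fst w, s))) (gam (fst (fst w))) (snd w))).
exists E; split; [unfold E; cont_tac |].
intros y y' z.
set (X := fun z => (p (y', z) - p (y, z)) * exp (- I (y, y', z))).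
assert (DX : forall s : R, is_derive X s ((y' - y) * (B (y, y', s) * exp (- I (y, y', s))))).
{ intros s.
  assert (Dp : forall y, is_derive (fun z => p (y, z)) s (g (y, s))).
  { intros w. apply is_derive_ext with (f := fun z => al w + RInt (fun s => g (w, s)) (gam w) z).
    - intros t; now rewrite Hp.
    - rewrite <- (Rplus_0_l (g (w, s))). apply der_plus; [apply der_const |].
      apply (is_derive_RInt_cont (fun s => g (w, s))). cont_tac. }
  assert (DI : is_derive (fun z => I (y, y', z)) s (A (y, y', s))).
  { unfold I; simpl. apply (is_derive_RInt_cont (fun s => A (y, y', s))). cont_tac. }
  assert (DI' := der_comp exp (fun z => - I (y, y', z)) s _ _ (is_derive_exp _) (der_opp _ s _ DI)).
  assert (R0 := der_mult _ _ s _ _ (der_minus _ _ s _ _ (Dp y') (Dp y)) DI').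
  match type of R0 with is_derive _ _ ?l => replace ((y' - y) * (B (y, y', s) * exp (- I (y, y', s)))) with l end.
  - exact R0.
  - rewrite Hg. clearbody I. generalize (exp (- I (y, y', s))); intros e.
    change (((y' - y) * B (y, y', s) + (p (y', s) - p (y, s)) * A (y, y', s)) * e
      + (p (y', s) - p (y, s)) * (- A (y, y', s) * e) = (y' - y) * (B (y, y', s) * e)). ring. }
assert (S := RInt_of_derivative X _ (gam y) z DX).
rewrite (RInt_mult_const (fun s => B (y, y', s) * exp (- I (y, y', s)))) in S by cont_tac.
assert (X0 : X (gam y) = (y' - y) * c0 (y, y')).
{ unfold X, c0, I; simpl. rewrite RInt_same, Ropp_0, exp_0, Rmult_1_r.
  rewrite !Hp, RInt_same, (RInt_flip (fun s => g (y', s))) by cont_tac.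
  rewrite (RInt_unit (fun s => g (y', s)) (gam y)) by cont_tac. rewrite Hgam.
  replace (al y' + - ((y' - y) * k * RInt (fun s => g (y', gam y + s * ((y' - y) * k))) 0 1) - (al y + 0))
    with ((al y' - al y) - (y' - y) * k * RInt (fun s => g (y', gam y + s * ((y' - y) * k))) 0 1) by ring.
  rewrite Hal. ring. }
assert (S' := S ltac:(cont_tac)). clear S. rewrite X0 in S'.
unfold E; simpl.
assert (EE : exp (I (y, y', z)) * exp (- I (y, y', z)) = 1) by (rewrite <- exp_plus, Rplus_opp_r; apply exp_0).
replace (p (y', z) - p (y, z)) with (exp (I (y, y', z)) * X z).
- replace (X z) with ((y' - y) * (c0 (y, y') + RInt (fun s => B (y, y', s) * exp (- I (y, y', s))) (gam y) z)) by lra.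
  ring.
- unfold X. replace (p (y', z) - p (y, z)) with ((p (y', z) - p (y, z)) * 1) at 2 by ring. rewrite <- EE. ring.
Qed.
(** Going back along characteristics to the points (y, gam y) and (gam z, z) of the data
    curve does not leave [C], so that the integral operators below can be restricted to
    [C]; [rho] measures the length of such paths. *)
Definition path_closed (gam : R -> R) (rho : R * R -> R) (C : R * R -> Prop) : Prop :=
  forall y z, C (y, z) ->
    (forall s, Rmin (gam y) z <= s <= Rmax (gam y) z ->
       C (y, s) /\ rho (y, s) <= rho (y, z) - Rabs (z - s)) /\
    (forall s, Rmin (gam z) y <= s <= Rmax (gam z) y ->
       C (s, z) /\ rho (s, z) <= rho (y, z) - Rabs (y - s)).

Section Operators.

Variables (al be U0 gam : R -> R) (G : (R * R) * (R * R * R) -> R) (K : R).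
Hypothesis Cal : cont al.
Hypothesis Cbe : cont be.
Hypothesis CU0 : cont U0.
Hypothesis Cgam : cont gam.
Hypothesis CG : cont G.
Hypothesis K0 : 0 <= K.
Hypothesis LG : forall p u v w u' v' w',
  Rabs (G (p, (u, v, w)) - G (p, (u', v', w'))) <= K * (Rabs (u - u') + Rabs (v - v') + Rabs (w - w')).

(** Given g in the role of u_yz, [Pop g], [Qop g] and [Uop g] are u_y, u_z and u,
    rebuilt from the data [al], [be], [U0] on the curve; u_yz = G (...) becomes the fixed
    point equation [g = Top g] for the single unknown g.  The curve is the diagonal
    (gam = id) for the Cauchy problem, and the two characteristics through (x0, x0)
    (gam = x0) for the Goursat problem. *)
Definition Pop (g : R * R -> R) (p : R * R) : R :=
  al (fst p) + RInt (fun s => g (fst p, s)) (gam (fst p)) (snd p).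
Definition Qop (g : R * R -> R) (p : R * R) : R :=
  be (snd p) + RInt (fun s => g (s, snd p)) (gam (snd p)) (fst p).
Definition Uop (g : R * R -> R) (p : R * R) : R :=
  U0 (fst p) + RInt (fun s => Qop g (fst p, s)) (gam (fst p)) (snd p).
Definition Top (g : R * R -> R) (p : R * R) : R := G (p, (Uop g p, Pop g p, Qop g p)).

Lemma cont_Pop g : cont g -> cont (Pop g).
Proof. intros H; unfold Pop; cont_tac. Qed.
Lemma cont_Qop g : cont g -> cont (Qop g).
Proof. intros H; unfold Qop; cont_tac. Qed.
Lemma cont_Uop g : cont g -> cont (Uop g).
Proof. intros H; assert (H' := cont_Qop g H); unfold Uop; cont_tac. Qed.
Lemma cont_Top g : cont g -> cont (Top g).
Proof.
intros H; assert (H1 := cont_Qop g H); assert (H2 := cont_Pop g H); assert (H3 := cont_Uop g H).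
unfold Top; cont_tac.
Qed.

(** Each of the three integrals gains at least the factor 1 / lam, and lam = 6 K + 1 makes
    their sum, multiplied by the Lipschitz constant, at most one half. *)
Lemma Top_contracts (rho : R * R -> R) (C : R * R -> Prop) (g g' : R * R -> R) (M : R) :
  path_closed gam rho C -> cont g -> cont g' ->
  (forall p, C p -> Rabs (g p - g' p) <= M * exp ((6 * K + 1) * rho p)) ->
  forall p, C p -> Rabs (Top g p - Top g' p) <= M / 2 * exp ((6 * K + 1) * rho p).
Proof.
intros HC Cg Cg' HM. set (lam := 6 * K + 1) in *.
assert (Hl : 1 <= lam) by (unfold lam; lra).
assert (Hl' : lam <> 0) by lra.
assert (HM' : forall p r, C p -> rho p <= r -> Rabs (g p - g' p) <= M * exp (lam * r)).
{ intros p r Hp Hr. apply Rle_trans with (1 := HM p Hp).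
  assert (M0 : 0 <= M).
  { apply Rmult_le_reg_r with (1 := exp_pos (lam * rho p)). rewrite Rmult_0_l.
    apply Rle_trans with (2 := HM p Hp), Rabs_pos. }
  apply Rmult_le_compat_l; [exact M0 |].
  destruct (Rle_lt_or_eq_dec _ _ Hr) as [L | ->]; [| lra].
  left; apply exp_increasing. apply Rmult_lt_compat_l; lra. }
assert (DQ : forall p, C p -> Rabs (Qop g p - Qop g' p) <= M * exp (lam * rho p) / lam).
{ intros [y z] Hp. destruct (HC y z Hp) as [_ H2]. unfold Qop; simpl.
  replace (_ - _) with (RInt (fun s => g (s, z) - g' (s, z)) (gam z) y).
  - apply weighted_RInt; [lra | cont_tac |]. intros s Hs. destruct (H2 s Hs) as [H3 H4]. now apply HM'.
  - rewrite RInt_sub by cont_tac. toR; ring. }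
assert (DP : forall p, C p -> Rabs (Pop g p - Pop g' p) <= M * exp (lam * rho p) / lam).
{ intros [y z] Hp. destruct (HC y z Hp) as [H2 _]. unfold Pop; simpl.
  replace (_ - _) with (RInt (fun s => g (y, s) - g' (y, s)) (gam y) z).
  - apply weighted_RInt; [lra | cont_tac |]. intros s Hs. destruct (H2 s Hs) as [H3 H4]. now apply HM'.
  - rewrite RInt_sub by cont_tac. toR; ring. }
intros [y z] Hp.
assert (M0 : 0 <= M).
{ apply Rmult_le_reg_r with (1 := exp_pos (lam * rho (y, z))). rewrite Rmult_0_l.
  apply Rle_trans with (2 := HM _ Hp), Rabs_pos. }
assert (CQ := cont_Qop g Cg). assert (CQ' := cont_Qop g' Cg').
set (e := M * exp (lam * rho (y, z))).
assert (E0 : 0 <= e) by (apply Rmult_le_pos; [exact M0 | left; apply exp_pos]).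
assert (Il : 0 <= / lam <= 1).
{ split; [left; apply Rinv_0_lt_compat; lra |]. rewrite <- Rinv_1. apply Rinv_le_contravar; lra. }
assert (DU : Rabs (Uop g (y, z) - Uop g' (y, z)) <= e / lam).
{ destruct (HC y z Hp) as [H2 _]. unfold Uop; simpl.
  replace (_ - _) with (RInt (fun s => Qop g (y, s) - Qop g' (y, s)) (gam y) z).
  - apply Rle_trans with (M / lam * exp (lam * rho (y, z)) / lam).
    + apply weighted_RInt; [lra | cont_tac |]. intros s Hs. destruct (H2 s Hs) as [H3 H4].
      apply Rle_trans with (1 := DQ _ H3).
      replace (M / lam * exp (lam * (rho (y, z) - Rabs (z - s))))
        with (M * exp (lam * (rho (y, z) - Rabs (z - s))) / lam) by (unfold Rdiv; ring).
      apply Rmult_le_compat_r; [lra |]. apply Rmult_le_compat_l; [exact M0 |].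
      destruct (Rle_lt_or_eq_dec _ _ H4) as [L | ->]; [| lra].
      left; apply exp_increasing. apply Rmult_lt_compat_l; lra.
    + replace (M / lam * exp (lam * rho (y, z)) / lam) with (e / lam * / lam) by (unfold e, Rdiv; ring).
      rewrite <- (Rmult_1_r (e / lam)) at 2. apply Rmult_le_compat_l; [| lra].
      apply Rmult_le_pos; lra.
  - rewrite RInt_sub by cont_tac. toR; ring. }
unfold Top. apply Rle_trans with (1 := LG _ _ _ _ _ _ _).
specialize (DQ _ Hp); specialize (DP _ Hp). fold e in DQ, DP.
apply Rle_trans with (K * (e / lam + e / lam + e / lam)).
- apply Rmult_le_compat_l; [exact K0 | lra].
- replace (M / 2 * exp (lam * rho (y, z))) with (e / 2) by (unfold e; field).
  replace (K * (e / lam + e / lam + e / lam)) with (e * (3 * K / lam)) by (unfold Rdiv; ring).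
  unfold Rdiv at 2. apply Rmult_le_compat_l; [exact E0 |].
  apply Rmult_le_reg_r with lam; [lra |]. unfold Rdiv. rewrite Rmult_assoc, Rinv_l by exact Hl'.
  unfold lam; lra.
Qed.

Lemma half_pow_small (M eps : R) : 0 < eps -> exists n, M * (/ 2) ^ n < eps.
Proof.
intros He. destruct (Rle_dec M 0) as [L | L].
- exists 0%nat; simpl; lra.
- assert (He2 : 0 < eps / M) by (apply Rdiv_lt_0_compat; lra).
  destruct (pow_lt_1_zero (/ 2) ltac:(rewrite Rabs_pos_eq; lra) _ He2) as [n Hn].
  exists n. specialize (Hn n (Nat.le_refl n)). rewrite Rabs_pos_eq in Hn by (apply pow_le; lra).
  apply Rmult_lt_reg_r with (/ M); [apply Rinv_0_lt_compat; lra |].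
  replace (M * (/ 2) ^ n * / M) with ((/ 2) ^ n) by (field; lra). exact Hn.
Qed.

(** Fixed points on a part [C] of the plane agree there, since [Top] only reads the values
    on [C]; this gives uniqueness on each sector separately. *)
Lemma fixed_point_unique (rho : R * R -> R) (C : R * R -> Prop) (x0 : R) (g g' : R * R -> R) :
  cont rho ->
  path_closed gam rho C -> (forall r, path_closed gam rho (box x0 r)) -> cont g -> cont g' ->
  (forall p, C p -> g p = Top g p) -> (forall p, C p -> g' p = Top g' p) ->
  forall p, C p -> g p = g' p.
Proof.
intros Cr HC HB Cg Cg' Hg Hg' p Hp.
set (r := Rabs (fst p - x0) + Rabs (snd p - x0)).
assert (Bp : box x0 r p).
{ unfold box, r. generalize (Rabs_pos (fst p - x0)) (Rabs_pos (snd p - x0)); lra. }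
assert (HCB : path_closed gam rho (fun q => C q /\ box x0 r q)).
{ intros y z [H1 H2]. destruct (HC y z H1) as [A1 A2]. destruct (HB r y z H2) as [B1 B2].
  split; intros s Hs.
  - destruct (A1 s Hs), (B1 s Hs). auto.
  - destruct (A2 s Hs), (B2 s Hs). auto. }
destruct (box_bound (fun q => (g q - g' q) * exp (- ((6 * K + 1) * rho q))) x0 r ltac:(cont_tac)) as [M HM].
assert (Z : forall n q, C q /\ box x0 r q -> Rabs (g q - g' q) <= M * (/ 2) ^ n * exp ((6 * K + 1) * rho q)).
{ induction n as [| n IH]; intros q Hq.
  - specialize (HM q (proj2 Hq)). rewrite Rabs_mult, (Rabs_pos_eq (exp _)) in HM by (left; apply exp_pos).
    rewrite Rmult_1_r.
    apply Rmult_le_reg_r with (1 := exp_pos (- ((6 * K + 1) * rho q))).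
    rewrite Rmult_assoc, <- exp_plus, Rplus_opp_r, exp_0, Rmult_1_r. exact HM.
  - rewrite Hg, Hg' by apply Hq.
    replace (M * (/ 2) ^ S n) with (M * (/ 2) ^ n / 2) by (simpl; field).
    apply Top_contracts with (C := fun q => C q /\ box x0 r q); assumption. }
assert (Z' : forall eps, 0 < eps -> Rabs (g p - g' p) < eps).
{ intros eps He. destruct (half_pow_small (M * exp ((6 * K + 1) * rho p)) eps He) as [n Hn].
  apply Rle_lt_trans with (1 := Z n p (conj Hp Bp)).
  replace (M * (/ 2) ^ n * exp ((6 * K + 1) * rho p)) with (M * exp ((6 * K + 1) * rho p) * (/ 2) ^ n) by ring.
  exact Hn. }
destruct (Req_dec (g p) (g' p)) as [E | E]; [exact E | exfalso].
apply (Rlt_irrefl (Rabs (g p - g' p))), Z', Rabs_pos_lt. lra.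
Qed.

(** The iterates converge uniformly on each box, and the boxes exhaust the plane, so the
    solution is global although the constants depend on the box. *)
Lemma fixed_point_exists (rho : R * R -> R) (x0 : R) :
  cont rho -> (forall r, path_closed gam rho (box x0 r)) ->
  exists g, cont g /\ forall p, g p = Top g p.
Proof.
intros Cr HB. set (lam := 6 * K + 1).
set (gn := fun n => Nat.iter n Top (fun _ => 0)).
assert (Cn : forall n, cont (gn n)).
{ induction n; [apply cont_const | apply cont_Top, IHn]. }
set (W := fun p => exp (lam * rho p)).
assert (CW : cont W) by (unfold W; cont_tac).
assert (Wp : forall p, 0 < W p) by (intros; apply exp_pos).
assert (B1 : forall r, exists M, 0 <= M /\ forall n p, box x0 r p -> Rabs (gn (S n) p - gn n p) <= M * (/ 2) ^ n * W p).
{ intros r. assert (C1 := Cn 1%nat). 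
  destruct (box_bound (fun q => gn 1%nat q * exp (- (lam * rho q))) x0 r ltac:(cont_tac)) as [M HM].
  exists (Rmax M 0); split; [apply Rmax_r |].
  induction n as [| n IH]; intros q Hq.
  - specialize (HM q Hq). rewrite Rabs_mult, (Rabs_pos_eq (exp _)) in HM by (left; apply exp_pos).
    rewrite Rmult_1_r. change (gn 0%nat q) with 0. rewrite Rminus_0_r.
    apply Rmult_le_reg_r with (1 := exp_pos (- (lam * rho q))). unfold W.
    rewrite Rmult_assoc, <- exp_plus, Rplus_opp_r, exp_0, Rmult_1_r.
    apply Rle_trans with (1 := HM), Rmax_l.
  - replace (Rmax M 0 * (/ 2) ^ S n) with (Rmax M 0 * (/ 2) ^ n / 2) by (simpl; field).
    apply (Top_contracts rho (box x0 r) (gn (S n)) (gn n)); auto. }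
assert (B2 : forall r, exists M, 0 <= M /\ forall n m p, (n <= m)%nat -> box x0 r p -> Rabs (gn m p - gn n p) <= M * (/ 2) ^ n * W p).
{ intros r. destruct (B1 r) as [M [M0 HM]]. exists (2 * M); split; [lra |].
  intros n m p Hnm Hp.
  assert (A : Rabs (gn m p - gn n p) <= 2 * M * ((/ 2) ^ n - (/ 2) ^ m) * W p).
  { induction Hnm as [| m Hnm IH].
    - rewrite Rminus_diag, Rabs_R0. right; ring.
    - replace (gn (S m) p - gn n p) with ((gn (S m) p - gn m p) + (gn m p - gn n p)) by ring.
      apply Rle_trans with (1 := Rabs_triang _ _). specialize (HM m p Hp).
      replace (2 * M * ((/ 2) ^ n - (/ 2) ^ S m) * W p) with
        (M * (/ 2) ^ m * W p + 2 * M * ((/ 2) ^ n - (/ 2) ^ m) * W p) by (simpl; field).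
      lra. }
  apply Rle_trans with (1 := A). apply Rmult_le_compat_r; [left; apply Wp |].
  apply Rmult_le_compat_l; [lra |]. assert (0 <= (/ 2) ^ m) by (apply pow_le; lra). lra. }
assert (Bself : forall p, box x0 (Rabs (fst p - x0) + Rabs (snd p - x0)) p).
{ intros p; unfold box. generalize (Rabs_pos (fst p - x0)) (Rabs_pos (snd p - x0)); lra. }
assert (Lim : forall p, is_lim_seq (fun n => gn n p) (real (Lim_seq (fun n => gn n p)))).
{ intros p. apply Lim_seq_correct'. apply ex_lim_seq_cauchy_corr.
  destruct (B2 (Rabs (fst p - x0) + Rabs (snd p - x0))) as [M [M0 HM]].
  intros eps. destruct (half_pow_small (2 * (M * W p)) eps (cond_pos eps)) as [N HN].
  exists N. intros n m Hn Hm.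
  assert (A1 := HM N n p Hn (Bself p)). assert (A2 := HM N m p Hm (Bself p)).
  replace (gn n p - gn m p) with ((gn n p - gn N p) - (gn m p - gn N p)) by ring.
  apply Rle_lt_trans with (1 := Rabs_triang _ _). rewrite Rabs_Ropp.
  replace (2 * (M * W p) * (/ 2) ^ N) with (M * (/ 2) ^ N * W p + M * (/ 2) ^ N * W p) in HN by ring. lra. }
set (g := fun p => real (Lim_seq (fun n => gn n p))).
assert (B3 : forall r, exists M, 0 <= M /\ forall n p, box x0 r p -> Rabs (g p - gn n p) <= M * (/ 2) ^ n * W p).
{ intros r. destruct (B2 r) as [M [M0 HM]]. exists M; split; [exact M0 |]. intros n p Hp.
  assert (LL : is_lim_seq (fun m => Rabs (gn (m + n)%nat p - gn n p)) (Rabs (g p - gn n p))).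
  { apply (is_lim_seq_abs (fun m => gn (m + n)%nat p - gn n p) (g p - gn n p)).
    apply (is_lim_seq_minus' (fun m => gn (m + n)%nat p) (fun _ => gn n p)); [| apply is_lim_seq_const].
    apply (is_lim_seq_incr_n (fun m => gn m p)). apply Lim. }
  apply (is_lim_seq_le _ (fun _ => M * (/ 2) ^ n * W p) _ _ (fun m => HM n (m + n)%nat p (Nat.le_add_l n m) Hp) LL (is_lim_seq_const _)). }
assert (Cg : cont g).
{ intros p. apply continuous_R_intro. intros eps He.
  set (r := Rabs (fst p - x0) + Rabs (snd p - x0)).
  destruct (B3 (r + 1)) as [M [M0 HM]].
  destruct (box_bound W x0 (r + 1) CW) as [MW HMW].
  assert (Hloc : locally p (fun q => box x0 (r + 1) q)).
  { exists (mkposreal 1 Rlt_0_1). intros q [H1 H2].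
    change (Rabs (fst q - fst p) < 1) in H1. change (Rabs (snd q - snd p) < 1) in H2.
    unfold box, r. generalize (Rabs_pos (fst p - x0)) (Rabs_pos (snd p - x0)); intros.
    split.
    - apply Rle_trans with (Rabs (fst q - fst p) + Rabs (fst p - x0)); [| lra].
      assert (T := Rabs_triang (fst q - fst p) (fst p - x0)).
      replace (fst q - fst p + (fst p - x0)) with (fst q - x0) in T by ring. exact T.
    - apply Rle_trans with (Rabs (snd q - snd p) + Rabs (snd p - x0)); [| lra].
      assert (T := Rabs_triang (snd q - snd p) (snd p - x0)).
      replace (snd q - snd p + (snd p - x0)) with (snd q - x0) in T by ring. exact T. }
  assert (He3 : 0 < eps / 3) by lra.
  destruct (half_pow_small (M * MW) _ He3) as [n Hn].
  assert (Near : forall q, box x0 (r + 1) q -> Rabs (g q - gn n q) < eps / 3).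
  { intros q Hq. apply Rle_lt_trans with (1 := HM n q Hq). apply Rle_lt_trans with (2 := Hn).
    replace (M * MW * (/ 2) ^ n) with (M * (/ 2) ^ n * MW) by ring.
    apply Rmult_le_compat_l; [apply Rmult_le_pos; [exact M0 | apply pow_le; lra] |].
    apply Rle_trans with (2 := HMW q Hq), Rle_abs. }
  generalize (filter_and _ _ Hloc (continuous_R_eps (gn n) p (Cn n p) _ He3)).
  apply filter_imp. intros q [Hq1 Hq2].
  assert (N1 := Near q Hq1). assert (N2 := Near p (locally_singleton _ _ Hloc)).
  replace (g q - g p) with ((g q - gn n q) + (gn n q - gn n p) - (g p - gn n p)) by ring.
  apply Rle_lt_trans with (1 := Rabs_triang _ _). rewrite Rabs_Ropp.
  assert (N3 := Rabs_triang (g q - gn n q) (gn n q - gn n p)). lra. }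
exists g; split; [exact Cg |]. intros p.
set (r := Rabs (fst p - x0) + Rabs (snd p - x0)).
destruct (B3 r) as [M [M0 HM]].
assert (Z : forall eps, 0 < eps -> Rabs (g p - Top g p) < eps).
{ intros eps He. destruct (half_pow_small (2 * (M * W p)) eps He) as [n Hn].
  assert (A1 := HM (S n) p (Bself p)).
  assert (A2 := Top_contracts rho (box x0 r) g (gn n) (M * (/ 2) ^ n) (HB r) Cg (Cn n) (HM n) p (Bself p)).
  change (Top (gn n) p) with (gn (S n) p) in A2. fold lam in A2. fold (W p) in A2.
  replace (g p - Top g p) with ((g p - gn (S n) p) - (Top g p - gn (S n) p)) by ring.
  apply Rle_lt_trans with (1 := Rabs_triang _ _). rewrite Rabs_Ropp.
  simpl pow in A1. apply Rle_lt_trans with (2 := Hn).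
  replace (M * (/ 2 * (/ 2) ^ n) * W p) with (M * W p * (/ 2) ^ n / 2) in A1 by field.
  replace (M * (/ 2) ^ n / 2 * W p) with (M * W p * (/ 2) ^ n / 2) in A2 by field.
  assert (0 <= M * W p * (/ 2) ^ n).
  { apply Rmult_le_pos; [apply Rmult_le_pos; [exact M0 | left; apply Wp] | apply pow_le; lra]. }
  lra. }
destruct (Req_dec (g p) (Top g p)) as [E | E]; [exact E | exfalso].
apply (Rlt_irrefl (Rabs (g p - Top g p))), Z, Rabs_pos_lt. lra.
Qed.

Lemma Pop_dz (g : R * R -> R) (y z : R) : cont g -> is_derive (fun z => Pop g (y, z)) z (g (y, z)).
Proof.
intros H. unfold Pop; simpl. rewrite <- (Rplus_0_l (g (y, z))).
apply der_plus; [apply der_const |]. apply (is_derive_RInt_cont (fun s => g (y, s))). cont_tac.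
Qed.

Lemma Qop_dy (g : R * R -> R) (y z : R) : cont g -> is_derive (fun y => Qop g (y, z)) y (g (y, z)).
Proof.
intros H. unfold Qop; simpl. rewrite <- (Rplus_0_l (g (y, z))).
apply der_plus; [apply der_const |]. apply (is_derive_RInt_cont (fun s => g (s, z))). cont_tac.
Qed.

Lemma Uop_dz (g : R * R -> R) (y z : R) : cont g -> is_derive (fun z => Uop g (y, z)) z (Qop g (y, z)).
Proof.
intros H. unfold Uop; simpl. rewrite <- (Rplus_0_l (Qop g (y, z))).
assert (H' := cont_Qop g H).
apply der_plus; [apply der_const |]. apply (is_derive_RInt_cont (fun s => Qop g (y, s))). cont_tac.
Qed.

Variable k : R.
Hypothesis Hgam : forall y y', gam y' - gam y = (y' - y) * k.
Hypothesis Hk : k = 0 \/ forall y, gam y = y.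
Hypothesis HU0 : forall y, is_derive U0 y (al y + k * be (gam y)).

(** Although [Uop g] integrates u_z along y = const only, its y-derivative is [Pop g]:
    this is the compatibility [HU0] of the data along the curve. *)
Lemma Uop_dy (g : R * R -> R) (y z : R) : cont g -> is_derive (fun y => Uop g (y, z)) y (Pop g (y, z)).
Proof.
intros Cg. assert (CQ := cont_Qop g Cg).
assert (D2 : is_derive (fun y => RInt (fun s => Qop g (y, s)) (gam y) z) y
   (- (k * Qop g (y, gam y)) + RInt (fun s => g (y, s)) (gam y) z)).
{ set (kk := fun y' => 0 * RInt (fun s => Qop g (y', z + s * (z - z))) 0 1
       - k * RInt (fun s => Qop g (y', gam y + s * (gam y' - gam y))) 0 1
       + RInt (fun s => RInt (fun r => g (y + r * (y' - y), s)) 0 1) (gam y) z).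
  replace (- _ + _) with (kk y).
  - apply derive_of_slope.
    + intros y'.
      apply (slope_of_RInt (fun y s => Qop g (y, s)) (fun s => RInt (fun r => g (y + r * (y' - y), s)) 0 1)
         gam (fun _ => z)); [cont_tac | cont_tac | cont_tac | | apply Hgam | ring].
      intros s. apply mean_slope with (h := fun y => Qop g (y, s)) (h' := fun y => g (y, s)).
      * intros x. now apply Qop_dy.
      * cont_tac.
    + assert (cont kk) by (unfold kk; cont_tac). apply H.
  - unfold kk. rewrite Rmult_0_l, Rminus_0_l. f_equal.
    + do 2 f_equal. rewrite (RInt_ext _ (fun _ => Qop g (y, gam y))).
      * rewrite RInt_const. unfold scal; simpl; unfold mult; simpl. ring.
      * intros x _. do 2 f_equal. ring.
    + apply RInt_ext. intros s _. rewrite (RInt_ext _ (fun _ => g (y, s))).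
      * rewrite RInt_const. unfold scal; simpl; unfold mult; simpl. ring.
      * intros x _. do 2 f_equal. ring. }
assert (D := der_plus _ _ y _ _ (HU0 y) D2).
replace (Pop g (y, z)) with (al y + k * be (gam y) + (- (k * Qop g (y, gam y)) + RInt (fun s => g (y, s)) (gam y) z)).
- exact D.
- unfold Pop, Qop; simpl. destruct Hk as [-> | E]; [toR; ring |].
  rewrite !E. rewrite (RInt_same (fun s => g (s, y))). toR; ring.
Qed.

Hypothesis Hal1 : C1_slope al.
Hypothesis Hbe1 : C1_slope be.
Hypothesis HG : C1_slopes5 G.

(** Second derivatives.  Only u_yy and u_zz are in question, as u_yz = g.  Along
    y = const, u_y solves the ordinary differential equation d/dz u_y = G in which u and
    u_z are known functions with y-derivatives u_y and g; so u_y is differentiable in the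
    parameter y.  The other case is symmetric. *)
Lemma fixed_point_C2 (g : R * R -> R) : cont g -> (forall p, g p = Top g p) ->
  exists r s : R * R -> R, cont r /\ cont s /\
    (forall y z, is_derive (fun y => Pop g (y, z)) y (r (y, z))) /\
    (forall y z, is_derive (fun z => Qop g (y, z)) z (s (y, z))).
Proof.
intros Cg Hg.
destruct Hal1 as [al1 [Cal1 Eal]]. destruct Hbe1 as [be1 [Cbe1 Ebe]].
destruct HG as [k1 [k2 [k3 [k4 [k5 [Ck1 [Ck2 [Ck3 [Ck4 [Ck5 Hk5]]]]]]]]]].
assert (CQ := cont_Qop g Cg). assert (CP := cont_Pop g Cg). assert (CU := cont_Uop g Cg).
set (U := Uop g) in *. set (p := Pop g) in *. set (q := Qop g) in *.
set (jet := fun w : R * R => (w, (U w, p w, q w))).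
assert (Cj : cont jet) by (unfold jet; cont_tac).
assert (Py : exists E : R * R * R -> R, cont E /\
    forall y y' z, p (y', z) - p (y, z) = (y' - y) * E (y, y', z)).
{ set (v := fun w : R * R * R => (jet (fst (fst w), snd w), jet (snd (fst w), snd w))).
  assert (Cv : cont v) by (unfold v; cont_tac).
  apply (ode_param p g al gam (fun w => k4 (v w))
    (fun w => k1 (v w) + RInt (fun s => p (fst (fst w) + s * (snd (fst w) - fst (fst w)), snd w)) 0 1 * k3 (v w)
              + RInt (fun s => g (fst (fst w) + s * (snd (fst w) - fst (fst w)), snd w)) 0 1 * k5 (v w)) al1 k);
   [cont_tac | cont_tac | cont_tac | cont_tac | cont_tac | cont_tac | reflexivity | exact Eal | exact Hgam |].
  intros y y' s. rewrite (Hg (y', s)), (Hg (y, s)). unfold Top. rewrite Hk5. simpl.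
  fold U p q.
  assert (E1 := mean_slope (fun y => U (y, s)) (fun y => p (y, s)) y y' (fun x => Uop_dy g x s Cg) ltac:(cont_tac)).
  assert (E2 := mean_slope (fun y => q (y, s)) (fun y => g (y, s)) y y' (fun x => Qop_dy g x s Cg) ltac:(cont_tac)).
  rewrite E1, E2. unfold v, jet; simpl. toR. ring. }
assert (Qz : exists E : R * R * R -> R, cont E /\
    forall z z' y, q (y, z') - q (y, z) = (z' - z) * E (z, z', y)).
{ set (v := fun w : R * R * R => (jet (snd w, fst (fst w)), jet (snd w, snd (fst w)))).
  assert (Cv : cont v) by (unfold v; cont_tac).
  apply (ode_param (fun w => q (snd w, fst w)) (fun w => g (snd w, fst w)) be gam (fun w => k5 (v w))
    (fun w => k2 (v w) + RInt (fun s => q (snd w, fst (fst w) + s * (snd (fst w) - fst (fst w)))) 0 1 * k3 (v w)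
              + RInt (fun s => g (snd w, fst (fst w) + s * (snd (fst w) - fst (fst w)))) 0 1 * k4 (v w)) be1 k);
   [cont_tac | cont_tac | cont_tac | cont_tac | cont_tac | cont_tac | reflexivity | exact Ebe | exact Hgam |].
  intros y y' s. simpl. rewrite (Hg (s, y')), (Hg (s, y)). unfold Top. rewrite Hk5. simpl.
  fold U p q.
  assert (E1 := mean_slope (fun y => U (s, y)) (fun y => q (s, y)) y y' (fun x => Uop_dz g s x Cg) ltac:(cont_tac)).
  assert (E2 := mean_slope (fun y => p (s, y)) (fun y => g (s, y)) y y' (fun x => Pop_dz g s x Cg) ltac:(cont_tac)).
  rewrite E1, E2. unfold v, jet; simpl. toR. ring. }
destruct Py as [E [CE HE]]. destruct Qz as [E' [CE' HE']].
exists (fun w => E (fst w, fst w, snd w)), (fun w => E' (snd w, snd w, fst w)).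
split; [cont_tac |]. split; [cont_tac |]. split; intros y z.
- apply (derive_of_slope (fun y => p (y, z)) (fun y' => E (y, y', z))); [intros; apply HE |].
  assert (H : cont (fun y' => E (y, y', z))) by cont_tac. apply H.
- apply (derive_of_slope (fun z => q (y, z)) (fun z' => E' (z, z', y))); [intros; apply HE' |].
  assert (H : cont (fun z' => E' (z, z', y))) by cont_tac. apply H.
Qed.

End Operators.

(** * Pieces of the solution as fixed points *)

Definition to_char (a : R) (p : R * R) : R * R := (snd p - a * fst p, snd p + a * fst p).
Definition of_char (a : R) (q : R * R) : R * R := P a (fst q) (snd q).

Lemma of_to_char (a : R) (p : R * R) : 0 < a -> of_char a (to_char a p) = p.
Proof. intros Ha; destruct p as [t x]; unfold of_char, to_char, P; simpl; f_equal; field; lra. Qed.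
Lemma to_char_P (a y z : R) : 0 < a -> to_char a (P a y z) = (y, z).
Proof. intros Ha; unfold to_char, P; simpl; f_equal; field; lra. Qed.
Lemma P_to_char (a t x : R) : 0 < a -> P a (x - a * t) (x + a * t) = (t, x).
Proof. intros Ha. exact (of_to_char a (t, x) Ha). Qed.
Lemma cont_to_char a : cont (to_char a).
Proof. unfold to_char; cont_tac. Qed.
Lemma cont_of_char a : cont (of_char a).
Proof. unfold of_char, P; cont_tac. Qed.

(** [D] is a set of points (t, x) and [C] the same set in characteristic coordinates.  The
    retraction [ret] onto [C] extends continuous functions on [D] to the plane. *)
Record region (a : R) (D C : R * R -> Prop) (gam : R -> R) (ret : R * R -> R * R) : Prop := {
  reg_D : forall p, D p <-> C (to_char a p);
  reg_collared : collared D;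
  reg_ret : cont ret;
  reg_retC : forall q, C (ret q);
  reg_retid : forall q, C q -> ret q = q;
  reg_future : forall y z, C (y, z) -> y <= z;
  reg_gam : cont gam;
  reg_path : exists rho c, cont rho /\ path_closed gam rho C /\ forall r, path_closed gam rho (box c r);
  reg_convy : forall y y' z s, C (y, z) -> C (y', z) -> Rmin y y' <= s <= Rmax y y' -> C (s, z);
  reg_convz : forall y z z' s, C (y, z) -> C (y, z') -> Rmin z z' <= s <= Rmax z z' -> C (y, s) }.

(** Data on the curve: [al y] is u_y and [U0 y] is u at (y, gam y), while [be z] is u_z at
    (gam z, z).  [dat_compat] is the derivative of [U0] along the curve, for the diagonal
    (second alternative) or for a pair of characteristics (k = 0). *)
Record curve_data (al be U0 gam : R -> R) : Prop := {
  dat_al : cont al; dat_be : cont be; dat_U0 : cont U0;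
  dat_al1 : C1_slope al; dat_be1 : C1_slope be;
  dat_compat : exists k, (forall y y', gam y' - gam y = (y' - y) * k) /\
    (k = 0 \/ forall y, gam y = y) /\ forall y, is_derive U0 y (al y + k * be (gam y)) }.

(** The mixed derivative v_yz that the equation prescribes, extended by the retraction. *)
Definition char_source (a : R) (F : R * R -> R) (f : (R * R) * (R * R * R) -> R) (D : R * R -> Prop)
  (ret : R * R -> R * R) (v : R * R -> R) (q : R * R) : R :=
  - / (4 * a ^ 2) * source F f D v (of_char a (ret q)).

Definition deriv_y (a : R) (D : R * R -> Prop) (v : R * R -> R) (p : R * R) : R :=
  (pderiv D e_x v p - pderiv D e_t v p / a) / 2.
Definition deriv_z (a : R) (D : R * R -> Prop) (v : R * R -> R) (p : R * R) : R :=
  (pderiv D e_x v p + pderiv D e_t v p / a) / 2.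

(** The integral equation of [v] in characteristic coordinates.  All the descriptions of
    the solution (equation with side conditions, and either kind of integro-differential
    equation) are compared with this one. *)
Definition represented (a : R) (F : R * R -> R) (f : (R * R) * (R * R * R) -> R) (D C : R * R -> Prop)
  (ret : R * R -> R * R) (be U0 gam : R -> R) (v : R * R -> R) : Prop :=
  forall y z, C (y, z) -> v (P a y z) = Uop be U0 gam (char_source a F f D ret v) (y, z).

Definition pde (a : R) (F : R * R -> R) (f : (R * R) * (R * R * R) -> R) (D : R * R -> Prop) (v : R * R -> R) (p : R * R) : Prop :=
  pderiv D e_t (pderiv D e_t v) p - a ^ 2 * pderiv D e_x (pderiv D e_x v) p
       + f (p, (v p, pderiv D e_t v p, pderiv D e_x v p)) = F p.

Lemma along_t (g : R * R -> R) (u v l : R) :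
  is_derive (fun z => g (z, v)) u l -> is_derive (along g (u, v) e_t) 0 l.
Proof.
intros H. rewrite <- (Rmult_1_l l).
apply is_derive_ext with (f := fun h : R => (fun z => g (z, v)) (u + h)).
- intros h. unfold e_t. rewrite along2. rewrite Rmult_1_r, Rmult_0_r, Rplus_0_r. reflexivity.
- apply (der_comp (fun z => g (z, v)) (fun h => u + h)); [rewrite Rplus_0_r; exact H |].
  auto_derive; [exact I | ring].
Qed.

Lemma along_x (g : R * R -> R) (u v l : R) :
  is_derive (fun z => g (u, z)) v l -> is_derive (along g (u, v) e_x) 0 l.
Proof.
intros H. rewrite <- (Rmult_1_l l).
apply is_derive_ext with (f := fun h : R => (fun z => g (u, z)) (v + h)).
- intros h. unfold e_x. rewrite along2. rewrite Rmult_1_r, Rmult_0_r, Rplus_0_r. reflexivity.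
- apply (der_comp (fun z => g (u, z)) (fun h => v + h)); [rewrite Rplus_0_r; exact H |].
  auto_derive; [exact I | ring].
Qed.

(** The chain rule for the change to characteristic coordinates. *)
Lemma along_to_char (a : R) (W Wy Wz : R * R -> R) (e1 e2 : R) (q : R * R) :
  cont Wy -> (forall y z, is_derive (fun y => W (y, z)) y (Wy (y, z))) ->
  (forall y z, is_derive (fun z => W (y, z)) z (Wz (y, z))) ->
  is_derive (along (fun p => W (to_char a p)) q (e1, e2)) 0 ((e2 - a * e1) * Wy (to_char a q) + (e2 + a * e1) * Wz (to_char a q)).
Proof.
intros Cy Hy Hz.
assert (T : interior_of (fun _ : R * R => True) (to_char a q)) by (exists (mkposreal 1 Rlt_0_1); auto).
assert (E := chain2 (fun _ => True) W Wy Wz (to_char a q) (e2 - a * e1) (e2 + a * e1)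
  (cont_continuous_on _ _ Cy)
  (fun q _ => match q with (u, v) => along_t W u v _ (Hy u v) end)
  (fun q _ => match q with (u, v) => along_x W u v _ (Hz u v) end) T).
apply is_derive_ext with (2 := E).
intros h. destruct q as [t x]. unfold to_char; simpl. rewrite along2. unfold along. f_equal.
rewrite plus_scal2; simpl. f_equal; ring.
Qed.

(** Class C^1 on the plane with the partial derivatives as part of the data. *)
Definition C1_partials (W Wy Wz : R * R -> R) : Prop :=
  cont W /\ cont Wy /\ cont Wz /\
  (forall y z, is_derive (fun y => W (y, z)) y (Wy (y, z))) /\
  (forall y z, is_derive (fun z => W (y, z)) z (Wz (y, z))).

Definition C2_partials (W Wy Wz : R * R -> R) : Prop :=
  C1_partials W Wy Wz /\ (exists Wyy Wyz, C1_partials Wy Wyy Wyz) /\ (exists Wzy Wzz, C1_partials Wz Wzy Wzz).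

Lemma C1_partials_lin (W1 W1y W1z W2 W2y W2z : R * R -> R) (c d : R) :
  C1_partials W1 W1y W1z -> C1_partials W2 W2y W2z ->
  C1_partials (fun p => c * W1 p + d * W2 p) (fun p => c * W1y p + d * W2y p) (fun p => c * W1z p + d * W2z p).
Proof.
intros [A1 [A2 [A3 [A4 A5]]]] [B1 [B2 [B3 [B4 B5]]]].
split; [cont_tac |]. split; [cont_tac |]. split; [cont_tac |].
split; intros y z; apply der_lin; auto.
Qed.

Lemma C1_along_t (a : R) (W Wy Wz : R * R -> R) (q : R * R) : C1_partials W Wy Wz ->
  is_derive (along (fun p => W (to_char a p)) q e_t) 0 ((fun p => - a * Wy p + a * Wz p) (to_char a q)).
Proof.
intros [A1 [A2 [A3 [A4 A5]]]]. assert (E := along_to_char a W Wy Wz 1 0 q A2 A4 A5).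
replace (- a * Wy (to_char a q) + a * Wz (to_char a q)) with ((0 - a * 1) * Wy (to_char a q) + (0 + a * 1) * Wz (to_char a q)) by ring.
exact E.
Qed.

Lemma C1_along_x (a : R) (W Wy Wz : R * R -> R) (q : R * R) : C1_partials W Wy Wz ->
  is_derive (along (fun p => W (to_char a p)) q e_x) 0 ((fun p => 1 * Wy p + 1 * Wz p) (to_char a q)).
Proof.
intros [A1 [A2 [A3 [A4 A5]]]]. assert (E := along_to_char a W Wy Wz 0 1 q A2 A4 A5).
replace (1 * Wy (to_char a q) + 1 * Wz (to_char a q)) with ((1 - a * 0) * Wy (to_char a q) + (1 + a * 0) * Wz (to_char a q)) by ring.
exact E.
Qed.

Lemma to_char_on (a : R) (D : R * R -> Prop) (W : R * R -> R) : cont W -> continuous_on D (fun p => W (to_char a p)).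
Proof. intros H. apply cont_continuous_on, (cont_comp W (to_char a) H (cont_to_char a)). Qed.

Lemma CK1_to_char (a : R) (D : R * R -> Prop) (W Wy Wz : R * R -> R) : C1_partials W Wy Wz ->
  CK basis2 1 D (fun p => W (to_char a p)).
Proof.
intros H. assert (H' := H). destruct H' as [A1 [A2 [A3 _]]].
split; [now apply to_char_on |]. intros e [<- | [<- | []]].
- exists (fun q => (fun p => - a * Wy p + a * Wz p) (to_char a q)). split; [intros p _; now apply C1_along_t |].
  split; [| exact I]. apply (to_char_on a D (fun p => - a * Wy p + a * Wz p)). cont_tac.
- exists (fun q => (fun p => 1 * Wy p + 1 * Wz p) (to_char a q)). split; [intros p _; now apply C1_along_x |].
  split; [| exact I]. apply (to_char_on a D (fun p => 1 * Wy p + 1 * Wz p)). cont_tac.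
Qed.

Lemma CK2_to_char (a : R) (D : R * R -> Prop) (W Wy Wz : R * R -> R) :
  C2_partials W Wy Wz -> CK basis2 2 D (fun p => W (to_char a p)).
Proof.
intros [H [[Wyy [Wyz Hy]] [Wzy [Wzz Hz]]]].
split; [apply to_char_on, H |]. intros e [<- | [<- | []]].
- exists (fun q => (fun p => - a * Wy p + a * Wz p) (to_char a q)). split; [intros p _; now apply C1_along_t |].
  apply (CK1_to_char a D _ _ _ (C1_partials_lin _ _ _ _ _ _ (- a) a Hy Hz)).
- exists (fun q => (fun p => 1 * Wy p + 1 * Wz p) (to_char a q)). split; [intros p _; now apply C1_along_x |].
  apply (CK1_to_char a D _ _ _ (C1_partials_lin _ _ _ _ _ _ 1 1 Hy Hz)).
Qed.

Section Piece.
Variables (a : R) (F : R * R -> R) (f G : (R * R) * (R * R * R) -> R).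
Variables (D C : R * R -> Prop) (gam : R -> R) (ret : R * R -> R * R).
Variables (al be U0 : R -> R).
Hypothesis ha : 0 < a.
Hypothesis HN : nonlinearity a F f G.
Hypothesis HR : region a D C gam ret.

Let inner := reg_collared _ _ _ _ _ HR.

Lemma region_P (y z : R) : C (y, z) -> D (P a y z).
Proof. intros H. apply (reg_D _ _ _ _ _ HR). now rewrite to_char_P. Qed.

Lemma region_Qbar (p : R * R) : D p -> Qbar p.
Proof.
intros H. apply (reg_D _ _ _ _ _ HR) in H. destruct p as [t x].
apply (reg_future _ _ _ _ _ HR) in H. simpl in H. apply Qbar_iff; simpl.
apply Rmult_le_reg_l with a; lra.
Qed.

Lemma region_retract (q : R * R) : D (of_char a (ret q)).
Proof.
assert (H := reg_retC _ _ _ _ _ HR q). destruct (ret q) as [y z]. now apply region_P.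
Qed.

Lemma cont_retract : cont (fun q => of_char a (ret q)).
Proof. apply (cont_comp (of_char a) ret); [apply cont_of_char | apply HR]. Qed.

Lemma cont_pullback (w : R * R -> R) : continuous_on D w -> cont (fun q => w (of_char a (ret q))).
Proof.
intros H. apply (cont_comp_on D w (fun q => of_char a (ret q)) H); [apply cont_retract | apply region_retract].
Qed.

Lemma cont_pderiv (v : R * R -> R) (e : R * R) (m : nat) :
  CK basis2 (S m) D v -> In e basis2 -> continuous_on D (pderiv D e v).
Proof. intros H He. apply CK_cont with basis2 m. now apply (CK_pderiv basis2 m D e v inner H). Qed.

Lemma in_t : In e_t basis2. Proof. now left. Qed.
Lemma in_x : In e_x basis2. Proof. right; now left. Qed.

Lemma cont_char_source (v : R * R -> R) (m : nat) : CK basis2 (S m) D v -> cont (char_source a F f D ret v).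
Proof.
intros H. unfold char_source, source.
assert (A0 := cont_pullback v (CK_cont _ _ _ _ H)).
assert (A1 := cont_pullback _ (cont_pderiv v e_t m H in_t)).
assert (A2 := cont_pullback _ (cont_pderiv v e_x m H in_x)).
assert (A3 : cont (fun q => F (of_char a (ret q)))).
{ apply (cont_comp_on Qbar F (fun q => of_char a (ret q))); [apply HN | apply cont_retract | intros; apply region_Qbar, region_retract]. }
set (jet := fun q => (of_char a (ret q), (v (of_char a (ret q)), pderiv D e_t v (of_char a (ret q)), pderiv D e_x v (of_char a (ret q))))).
assert (A4 : cont (fun q => f (jet q))).
{ apply (cont_comp_on (V := space5) domain5 f jet); [apply HN | | intros; apply region_Qbar, region_retract].
  assert (A5 := cont_retract). unfold jet.
  set (w0 := fun q => of_char a (ret q)) in *. set (w1 := fun q => v (of_char a (ret q))) in *.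
  set (w2 := fun q => pderiv D e_t v (of_char a (ret q))) in *. set (w3 := fun q => pderiv D e_x v (of_char a (ret q))) in *.
  change (cont (fun q => (w0 q, (w1 q, w2 q, w3 q)))). cont_tac. }
apply cont_mult; [apply cont_const |]. apply (cont_minus _ _ A3 A4).
Qed.

Lemma char_source_jet (v : R * R -> R) (y z : R) : C (y, z) ->
  char_source a F f D ret v (y, z) = G ((y, z), (v (P a y z), deriv_y a D v (P a y z), deriv_z a D v (P a y z))).
Proof.
intros H. unfold char_source. rewrite (reg_retid _ _ _ _ _ HR) by exact H.
rewrite (non_eq _ _ _ _ HN) by (now apply (reg_future _ _ _ _ _ HR)).
unfold of_char, source; simpl. do 5 f_equal.
- f_equal. unfold deriv_y, deriv_z. field. lra.
- unfold deriv_y, deriv_z. field. lra.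
Qed.

Hypothesis HD : curve_data al be U0 gam.

Lemma Uop_C1 (g : R * R -> R) : cont g ->
  C1_partials (Uop be U0 gam g) (Pop al gam g) (Qop be gam g).
Proof.
intros Cg. pose proof HD as [Cal Cbe CU0 _ _ [k [Hk1 [Hk2 Hk3]]]]. assert (CG := reg_gam _ _ _ _ _ HR).
split; [now apply cont_Uop |]. split; [now apply cont_Pop |]. split; [now apply cont_Qop |].
split; intros y z.
- apply Uop_dy with (k := k); assumption.
- now apply Uop_dz.
Qed.

(** Differentiating the integral equation once. *)
Lemma pderiv_rep (v g : R * R -> R) : cont g ->
  (forall y z, C (y, z) -> v (P a y z) = Uop be U0 gam g (y, z)) ->
  forall y z, C (y, z) -> deriv_y a D v (P a y z) = Pop al gam g (y, z) /\ deriv_z a D v (P a y z) = Qop be gam g (y, z).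
Proof.
intros Cg Hv y z Hyz.
assert (H1 := Uop_C1 g Cg). assert (H1' := H1). destruct H1' as [CU [CP [CQ _]]].
assert (E : forall p, D p -> v p = Uop be U0 gam g (to_char a p)).
{ intros p Hp. apply (reg_D _ _ _ _ _ HR) in Hp. 
  rewrite <- (of_to_char a p ha) at 1. unfold of_char. rewrite Hv; destruct (to_char a p); auto. }
assert (CT : cont (fun p => - a * Pop al gam g p + a * Qop be gam g p)) by cont_tac.
assert (CX : cont (fun p => 1 * Pop al gam g p + 1 * Qop be gam g p)) by cont_tac.
assert (Et := pderiv_ext D e_t v _ (fun q => (fun p => - a * Pop al gam g p + a * Qop be gam g p) (to_char a q)) inner E
  (to_char_on a D _ CT) (fun q _ => C1_along_t a _ _ _ q H1) (P a y z) (region_P _ _ Hyz)).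
assert (Ex := pderiv_ext D e_x v _ (fun q => (fun p => 1 * Pop al gam g p + 1 * Qop be gam g p) (to_char a q)) inner E
  (to_char_on a D _ CX) (fun q _ => C1_along_x a _ _ _ q H1) (P a y z) (region_P _ _ Hyz)).
cbv beta in Et, Ex. rewrite to_char_P in Et, Ex by exact ha.
unfold deriv_y, deriv_z. rewrite Et, Ex. split; field; lra.
Qed.

Lemma Uop_ext (g g' : R * R -> R) : (forall p, C p -> g p = g' p) ->
  forall y z, C (y, z) -> Uop be U0 gam g (y, z) = Uop be U0 gam g' (y, z).
Proof.
intros E y z Hyz. unfold Uop; simpl. f_equal. apply RInt_ext. intros s Hs.
destruct (reg_path _ _ _ _ _ HR) as [rho [c [_ [HC _]]]].
destruct (proj1 (HC y z Hyz) s ltac:(lra)) as [Hys _].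
unfold Qop; simpl. f_equal. apply RInt_ext. intros r Hr.
destruct (proj2 (HC y s Hys) r ltac:(lra)) as [Hrs _]. now apply E.
Qed.

Lemma rep_fixed (v : R * R -> R) (m : nat) : CK basis2 (S m) D v -> represented a F f D C ret be U0 gam v ->
  forall p, C p -> char_source a F f D ret v p = Top al be U0 gam G (char_source a F f D ret v) p.
Proof.
intros Hv Hr [y z] Hp. rewrite char_source_jet by exact Hp. unfold Top.
destruct (pderiv_rep v _ (cont_char_source v m Hv) Hr y z Hp) as [-> ->]. now rewrite Hr.
Qed.

(** A represented function is rebuilt from its source, which is a fixed point on [C]. *)
Lemma rep_unique (v v' : R * R -> R) : CK basis2 2 D v -> CK basis2 2 D v' ->
  represented a F f D C ret be U0 gam v -> represented a F f D C ret be U0 gam v' ->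
  forall p, D p -> v p = v' p.
Proof.
intros Hv Hv' Rv Rv'.
assert (E : forall p, C p -> char_source a F f D ret v p = char_source a F f D ret v' p).
{ pose proof HD as [Cal Cbe CU0 _ _ _]. destruct (reg_path _ _ _ _ _ HR) as [rho [c [Crho [HC HB]]]].
  destruct (non_lip _ _ _ _ HN) as [K [HK0 HK]].
  apply (fixed_point_unique al be U0 gam G K) with (rho := rho) (x0 := c); try assumption; try apply HR; try apply HN.
  - now apply cont_char_source with 1%nat.
  - now apply cont_char_source with 1%nat.
  - now apply rep_fixed with 1%nat.
  - now apply rep_fixed with 1%nat. }
intros p Hp. apply (reg_D _ _ _ _ _ HR) in Hp. rewrite <- (of_to_char a p ha). unfold of_char.
destruct (to_char a p) as [y z]; simpl. rewrite Rv, Rv' by exact Hp. now apply Uop_ext.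
Qed.

(** The fixed point, read in the plane and then restricted; [W] is kept because traces of
    it serve as data for the Goursat problem. *)
Lemma rep_exists : exists v, CK basis2 2 D v /\ represented a F f D C ret be U0 gam v /\
  (exists W Wy Wz, C2_partials W Wy Wz /\ v = (fun p => W (to_char a p)) /\
     (forall y, Wy (y, gam y) = al y) /\ (forall z, Wz (gam z, z) = be z) /\ (forall y, W (y, gam y) = U0 y)) /\
  forall p, D p -> pde a F f D v p.
Proof.
assert (X : exists g, cont g /\ forall p, g p = Top al be U0 gam G g p).
{ pose proof HD as [Cal Cbe CU0 _ _ _]. destruct (reg_path _ _ _ _ _ HR) as [rho [c [Crho [HC HB]]]].
  destruct (non_lip _ _ _ _ HN) as [K [HK0 HK]].
  apply (fixed_point_exists al be U0 gam G K) with (rho := rho) (x0 := c); try assumption; try apply HR; apply HN. }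
destruct X as [g [Cg Hg]].
assert (X : exists r s : R * R -> R, cont r /\ cont s /\
    (forall y z, is_derive (fun y => Pop al gam g (y, z)) y (r (y, z))) /\
    (forall y z, is_derive (fun z => Qop be gam g (y, z)) z (s (y, z)))).
{ pose proof HD as [Cal Cbe CU0 Hal Hbe [k [Hk1 [Hk2 Hk3]]]].
  apply (fixed_point_C2 al be U0 gam G) with (k := k); try assumption; try apply HR; apply HN. }
destruct X as [r [s [Cr [Cs [Hr Hs]]]]].
assert (H1 := Uop_C1 g Cg). assert (H1' := H1). destruct H1' as [CU [CP [CQ _]]].
set (U := Uop be U0 gam g) in *. set (p := Pop al gam g) in *. set (q := Qop be gam g) in *.
assert (H2 : C1_partials p r g).
{ split; [exact CP |]. split; [exact Cr |]. split; [exact Cg |]. split; [exact Hr |].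
  intros; now apply Pop_dz. }
assert (H3 : C1_partials q g s).
{ split; [exact CQ |]. split; [exact Cg |]. split; [exact Cs |]. split; [| exact Hs].
  intros; now apply Qop_dy. }
set (v := fun w => U (to_char a w)).
assert (HvP : forall y z, v (P a y z) = U (y, z)) by (intros; unfold v; now rewrite to_char_P).
assert (H4 : C2_partials U p q) by (split; [exact H1 | split; [now exists r, g | now exists g, s]]).
assert (Hv : CK basis2 2 D v) by (apply (CK2_to_char a D _ _ _ H4)).
assert (Hc : forall w, C w -> char_source a F f D ret v w = g w).
{ intros [y z] Hw. rewrite char_source_jet by exact Hw.
  destruct (pderiv_rep v g Cg (fun y z _ => HvP y z) y z Hw) as [-> ->]. rewrite HvP, (Hg (y, z)). reflexivity. }
exists v. split; [exact Hv |]. split; [| split].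
- intros y z Hyz. rewrite HvP. unfold U. apply Uop_ext; [| exact Hyz]. intros w Hw; symmetry; now apply Hc.
- exists U, p, q. split; [exact H4 |]. split; [reflexivity |].
  unfold U, p, q, Uop, Pop, Qop; simpl. split; [| split]; intros; rewrite RInt_same; toR; ring.
- intros w Hw.
  assert (T := C1_partials_lin _ _ _ _ _ _ (- a) a H2 H3). assert (X := C1_partials_lin _ _ _ _ _ _ 1 1 H2 H3).
  assert (Et := fun w => pderiv_ext D e_t v v (fun q' => (fun p' => - a * p p' + a * q p') (to_char a q')) inner (fun _ _ => eq_refl)
   (to_char_on a D _ (proj1 T)) (fun q _ => C1_along_t a _ _ _ q H1) w).
  assert (Ex := fun w => pderiv_ext D e_x v v (fun q' => (fun p' => 1 * p p' + 1 * q p') (to_char a q')) inner (fun _ _ => eq_refl)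
   (to_char_on a D _ (proj1 X)) (fun q _ => C1_along_x a _ _ _ q H1) w).
  assert (Ett : pderiv D e_t (pderiv D e_t v) w = - a * (- a * r (to_char a w) + a * g (to_char a w)) + a * (- a * g (to_char a w) + a * s (to_char a w))).
  { apply (pderiv_ext D e_t _ _ (fun q' => (fun w => - a * (- a * r w + a * g w) + a * (- a * g w + a * s w)) (to_char a q')) inner Et); [| | exact Hw].
    - apply (to_char_on a D (fun w => - a * (- a * r w + a * g w) + a * (- a * g w + a * s w))). cont_tac.
    - intros q' _. apply (C1_along_t a _ _ _ q' T). }
  assert (Exx : pderiv D e_x (pderiv D e_x v) w = 1 * (1 * r (to_char a w) + 1 * g (to_char a w)) + 1 * (1 * g (to_char a w) + 1 * s (to_char a w))).
  { apply (pderiv_ext D e_x _ _ (fun q' => (fun w => 1 * (1 * r w + 1 * g w) + 1 * (1 * g w + 1 * s w)) (to_char a q')) inner Ex); [| | exact Hw].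
    - apply (to_char_on a D (fun w => 1 * (1 * r w + 1 * g w) + 1 * (1 * g w + 1 * s w))). cont_tac.
    - intros q' _. apply (C1_along_x a _ _ _ q' X). }
  assert (Cw : C (to_char a w)) by (now apply (reg_D _ _ _ _ _ HR)).
  assert (Hs' := Hc _ Cw). unfold char_source in Hs'. rewrite (reg_retid _ _ _ _ _ HR) in Hs' by exact Cw.
  rewrite of_to_char in Hs' by exact ha. unfold source in Hs'.
  unfold pde. rewrite Ett, Exx, <- Hs'. field. lra.
Qed.

End Piece.

(** * Differential, integral and characteristic formulations *)

(** Both sides vanish at z = c and have the same z-derivative. *)
Lemma RInt_exchange (g : R * R -> R) (c y z : R) : cont g ->
  RInt (fun s => RInt (fun r => g (r, s)) c y) c z = RInt (fun r => RInt (fun s => g (r, s)) c z) c y.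
Proof.
intros Cg.
apply (eq_of_derive (fun z => RInt (fun s => RInt (fun r => g (r, s)) c y) c z)
  (fun z => RInt (fun r => RInt (fun s => g (r, s)) c z) c y) (fun z => RInt (fun r => g (r, z)) c y) c).
- intros x. apply (is_derive_RInt_cont (fun s => RInt (fun r => g (r, s)) c y)). cont_tac.
- intros x.
  pose (kk := (fun x' => RInt (fun r => RInt (fun s => g (r, x + s * (x' - x))) 0 1) c y) : R -> R).
  assert (Dk : is_derive (fun z => RInt (fun r => RInt (fun s => g (r, s)) c z) c y : R) x (kk x)).
  { apply (derive_of_slope (fun z => RInt (fun r => RInt (fun s => g (r, s)) c z) c y) kk).
    - intros x'.
      assert (E := slope_of_RInt (fun x r => RInt (fun s => g (r, s)) c x) (fun r => RInt (fun s => g (r, x + s * (x' - x))) 0 1)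
        (fun _ => c) (fun _ => y) x x' 0 0 ltac:(cont_tac) ltac:(cont_tac) ltac:(cont_tac)).
      rewrite E; [unfold kk; toR; ring | | toR; ring | toR; ring].
      intros s. apply (mean_slope (fun x => RInt (fun t => g (s, t)) c x) (fun t => g (s, t))); [| cont_tac].
      intros t. apply (is_derive_RInt_cont (fun t => g (s, t))). cont_tac.
    - assert (H : cont kk) by (unfold kk; cont_tac). apply H. }
  assert (Ek : kk x = RInt (fun r => g (r, x)) c y).
  { unfold kk. apply RInt_ext. intros r _. apply RInt_unit_const. intros s. now replace (x + s * (x - x)) with x by ring. }
  exact (eq_ind (kk x) (fun l => is_derive _ x l) Dk _ Ek).
- cont_tac.
- rewrite RInt_same. rewrite (RInt_ext _ (fun _ => 0)) by (intros; apply RInt_same).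
  rewrite RInt_const. unfold scal; simpl; unfold mult; simpl. toR; ring.
Qed.

(** The double integral of d'Alembert's formula in characteristic coordinates; again both
    sides vanish at z = y and have the same z-derivative. *)
Lemma triangle_integral (a : R) (g : R * R -> R) (y z : R) : 0 < a -> cont g ->
  - (2 * a) * RInt (fun tau => RInt (fun xi => g (to_char a (tau, xi))) (y + a * tau) (z - a * tau)) 0 ((z - y) / (2 * a))
  = RInt (fun s => RInt (fun r => g (r, s)) s y) y z.
Proof.
intros ha Cg. assert (Cc := cont_to_char a).
apply (eq_of_derive (fun z => - (2 * a) * RInt (fun tau => RInt (fun xi => g (to_char a (tau, xi))) (y + a * tau) (z - a * tau)) 0 ((z - y) / (2 * a)))
  (fun z => RInt (fun s => RInt (fun r => g (r, s)) s y) y z) (fun z => RInt (fun r => g (r, z)) z y) y).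
- intros x.
  set (h := fun x tau => RInt (fun xi => g (to_char a (tau, xi))) (y + a * tau) (x - a * tau)).
  set (d := fun x => (x - y) / (2 * a)).
  pose (kk := (fun x' => / (2 * a) * RInt (fun s => h x' (d x + s * (d x' - d x))) 0 1
     + RInt (fun tau => RInt (fun s => g (to_char a (tau, x - a * tau + s * (x' - x)))) 0 1) 0 (d x)) : R -> R).
  assert (Ch : forall x, cont (h x)) by (intros; unfold h; cont_tac).
  assert (Dk : is_derive (fun z => - (2 * a) * RInt (h z) 0 (d z)) x (- (2 * a) * kk x)).
  { apply (derive_of_slope (fun z => - (2 * a) * RInt (h z) 0 (d z)) (fun x' => - (2 * a) * kk x')).
    - intros x'.
      assert (E := slope_of_RInt h (fun tau => RInt (fun s => g (to_char a (tau, x - a * tau + s * (x' - x)))) 0 1)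
        (fun _ => 0) d x x' 0 (/ (2 * a)) (Ch x) (Ch x') ltac:(cont_tac)).
      rewrite <- Rmult_minus_distr_l, E; [unfold kk; toR; ring | | toR; ring | unfold d; field; lra].
      intros tau. unfold h.
      rewrite <- (RInt_split (fun xi => g (to_char a (tau, xi))) _ (x - a * tau) (x' - a * tau)) by cont_tac.
      rewrite (RInt_unit (fun xi => g (to_char a (tau, xi))) (x - a * tau)) by cont_tac.
      replace (x' - a * tau - (x - a * tau)) with (x' - x) by ring. toR; ring.
    - assert (H : cont (fun x' => - (2 * a) * kk x')) by (unfold kk, h, d; cont_tac). apply H. }
  assert (Ek : - (2 * a) * kk x = RInt (fun r => g (r, x)) x y).
  { unfold kk. rewrite (RInt_unit_const (fun s => h x (d x + s * (d x - d x))) 0).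
    - assert (Cgx : cont (fun r : R => g (r, x))) by cont_tac.
      assert (E := RInt_comp_lin (V := R_CompleteNormedModule) (fun r => g (r, x)) (- (2 * a)) x 0 (d x)
         (ex_RInt_cont _ _ _ Cgx)).
      replace (- (2 * a) * 0 + x) with x in E by ring.
      replace (- (2 * a) * d x + x) with y in E by (unfold d; field; lra).
      rewrite <- E. rewrite Rmult_0_r, Rplus_0_l, <- RInt_mult_const by cont_tac.
      apply RInt_ext. intros tau _. unfold scal; simpl; unfold mult; simpl. f_equal.
      apply RInt_unit_const. intros s. unfold to_char; simpl. f_equal. f_equal; ring.
    - intros s. replace (d x + s * (d x - d x)) with (d x) by ring. unfold h.
      replace (y + a * d x) with (x - a * d x) by (unfold d; field; lra). apply RInt_same. }
  exact (eq_ind (- (2 * a) * kk x) (fun l => is_derive _ x l) Dk _ Ek).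
- intros x. apply (is_derive_RInt_cont (fun s => RInt (fun r => g (r, s)) s y)). cont_tac.
- cont_tac.
- replace ((y - y) / (2 * a)) with 0 by (field; lra). rewrite !RInt_same. toR; ring.
Qed.

Section Representation.
Variables (a : R) (F : R * R -> R) (f G : (R * R) * (R * R * R) -> R).
Variables (D C : R * R -> Prop) (gam : R -> R) (ret : R * R -> R * R).
Hypothesis ha : 0 < a.
Hypothesis HN : nonlinearity a F f G.
Hypothesis HR : region a D C gam ret.

Let inner := reg_collared _ _ _ _ _ HR.
Notation src v := (char_source a F f D ret v).

Lemma increment_z (w w' : R * R -> R) (y z z' : R) :
  continuous_on D w -> continuous_on D w' ->
  (forall q, interior_of D q -> is_derive (along w q (/ (2 * a), / 2)) 0 (w' q)) ->
  C (y, z) -> C (y, z') ->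
  w (P a y z') - w (P a y z) = RInt (fun s => w' (of_char a (ret (y, s)))) z z'.
Proof.
intros Cw Cw' Hd H1 H2.
assert (Ck : cont (fun s => w' (of_char a (ret (y, s))))).
{ apply (cont_comp (fun q => w' (of_char a (ret q))) (fun s : R => (y, s))); [| cont_tac].
  now apply (cont_pullback a D C gam ret ha HR). }
assert (Pz : forall s, (fst (P a y z) + s * / (2 * a), snd (P a y z) + s * / 2) = P a y (z + s)).
{ intros s. unfold P; simpl. f_equal; field; lra. }
assert (Cs : forall s, Rmin 0 (z' - z) <= s <= Rmax 0 (z' - z) -> C (y, z + s)).
{ intros s Hs. apply (reg_convz _ _ _ _ _ HR y z z'); [exact H1 | exact H2 |].
  unfold Rmin, Rmax in *. destruct (Rle_dec 0 (z' - z)), (Rle_dec z z'); lra. }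
assert (E := increment_flat D w w' (/ (2 * a)) (/ 2) (z' - z) (P a y z) inner Cw Cw' Hd).
rewrite Pz in E. replace (z + (z' - z)) with z' in E by ring. rewrite <- E.
- transitivity (RInt (fun s => w' (of_char a (ret (y, z + s)))) 0 (z' - z)).
  + apply RInt_ext. intros s Hs. rewrite Pz.
    rewrite (reg_retid _ _ _ _ _ HR) by (apply Cs; lra). reflexivity.
  + rewrite (RInt_translate (fun s => w' (of_char a (ret (y, s)))) z (z' - z) Ck). f_equal; ring.
- intros s Hs. rewrite Pz. apply (region_P a D C gam ret ha HR), Cs, Hs.
Qed.

Lemma increment_y (w w' : R * R -> R) (y y' z : R) :
  continuous_on D w -> continuous_on D w' ->
  (forall q, interior_of D q -> is_derive (along w q (- / (2 * a), / 2)) 0 (w' q)) ->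
  C (y, z) -> C (y', z) ->
  w (P a y' z) - w (P a y z) = RInt (fun s => w' (of_char a (ret (s, z)))) y y'.
Proof.
intros Cw Cw' Hd H1 H2.
assert (Ck : cont (fun s => w' (of_char a (ret (s, z))))).
{ apply (cont_comp (fun q => w' (of_char a (ret q))) (fun s : R => (s, z))); [| cont_tac].
  now apply (cont_pullback a D C gam ret ha HR). }
assert (Py : forall s, (fst (P a y z) + s * - / (2 * a), snd (P a y z) + s * / 2) = P a (y + s) z).
{ intros s. unfold P; simpl. f_equal; field; lra. }
assert (Cs : forall s, Rmin 0 (y' - y) <= s <= Rmax 0 (y' - y) -> C (y + s, z)).
{ intros s Hs. apply (reg_convy _ _ _ _ _ HR y y' z); [exact H1 | exact H2 |].
  unfold Rmin, Rmax in *. destruct (Rle_dec 0 (y' - y)), (Rle_dec y y'); lra. }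
assert (E := increment_flat D w w' (- / (2 * a)) (/ 2) (y' - y) (P a y z) inner Cw Cw' Hd).
rewrite Py in E. replace (y + (y' - y)) with y' in E by ring. rewrite <- E.
- transitivity (RInt (fun s => w' (of_char a (ret (y + s, z)))) 0 (y' - y)).
  + apply RInt_ext. intros s Hs. rewrite Py.
    rewrite (reg_retid _ _ _ _ _ HR) by (apply Cs; lra). reflexivity.
  + rewrite (RInt_translate (fun s => w' (of_char a (ret (s, z)))) y (y' - y) Ck). f_equal; ring.
- intros s Hs. rewrite Py. apply (region_P a D C gam ret ha HR), Cs, Hs.
Qed.

Lemma deriv_z_eq v p : deriv_z a D v p = / 2 * pderiv D e_x v p + / (2 * a) * pderiv D e_t v p.
Proof. unfold deriv_z. field. lra. Qed.

Lemma deriv_z_on v m : CK basis2 (S m) D v -> continuous_on D (deriv_z a D v).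
Proof.
intros H. apply continuous_on_ext with (fun p => / 2 * pderiv D e_x v p + / (2 * a) * pderiv D e_t v p).
- intros; symmetry; apply deriv_z_eq.
- apply continuous_on_lin; apply (cont_pderiv a D C gam ret HR v) with (m := m); auto using in_t, in_x.
Qed.
Lemma source_on v : CK basis2 1 D v -> continuous_on D (fun p => - / (4 * a ^ 2) * source F f D v p).
Proof.
intros H.
assert (Cs := cont_char_source a F f G D C gam ret ha HN HR v 0 H).
apply continuous_on_ext with (fun p => src v (to_char a p)).
- intros p Hp. unfold char_source. rewrite (reg_retid _ _ _ _ _ HR), of_to_char by (auto; now apply (reg_D _ _ _ _ _ HR)).
  reflexivity.
- now apply to_char_on.
Qed.

(** The equation prescribes v_yz; the mixed terms of the chain rule cancel by symmetry of
    the second derivatives. *)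
Lemma deriv_z_along v q : CK basis2 2 D v -> (forall q, interior_of D q -> pde a F f D v q) ->
  interior_of D q ->
  is_derive (along (deriv_z a D v) q (- / (2 * a), / 2)) 0 (- / (4 * a ^ 2) * source F f D v q).
Proof.
intros Hv Hp Hq.
destruct (CK_pderiv basis2 1 D e_t v inner Hv in_t) as [Ht Dt].
destruct (CK_pderiv basis2 1 D e_x v inner Hv in_x) as [Hx Dx].
destruct (CK_pderiv basis2 0 D e_t _ inner Ht in_t) as [[Ctt _] Dtt].
destruct (CK_pderiv basis2 0 D e_x _ inner Ht in_x) as [[Ctx _] Dtx].
destruct (CK_pderiv basis2 0 D e_t _ inner Hx in_t) as [[Cxt _] Dxt].
destruct (CK_pderiv basis2 0 D e_x _ inner Hx in_x) as [[Cxx _] Dxx].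
assert (S := mixed_partials_agree D v _ _ _ _ q Ctx Cxt Dt Dx Dtx Dxt Hq).
assert (A1 := chain2 D _ _ _ q (- / (2 * a)) (/ 2) Cxt Dxt Dxx Hq).
assert (A2 := chain2 D _ _ _ q (- / (2 * a)) (/ 2) Ctt Dtt Dtx Hq).
assert (E := der_lin _ _ 0 _ _ (/ 2) (/ (2 * a)) A1 A2).
specialize (Hp q Hq). unfold pde in Hp. unfold source. rewrite <- Hp.
match type of E with is_derive _ _ ?l => replace (- / (4 * a ^ 2) * _) with l end.
- apply is_derive_ext with (2 := E). intros t. unfold along. symmetry. apply deriv_z_eq.
- rewrite S. field. lra.
Qed.

Lemma along_deriv_z v q : CK basis2 2 D v -> interior_of D q ->
  is_derive (along v q (/ (2 * a), / 2)) 0 (deriv_z a D v q).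
Proof.
intros Hv Hq.
destruct (CK_pderiv basis2 1 D e_t v inner Hv in_t) as [Ht Dt].
destruct (CK_pderiv basis2 1 D e_x v inner Hv in_x) as [Hx Dx].
assert (E := chain2 D _ _ _ q (/ (2 * a)) (/ 2) (CK_cont _ _ _ _ Ht) Dt Dx Hq).
rewrite deriv_z_eq, Rplus_comm. exact E.
Qed.

Lemma increment_z_of_v v y z z' : CK basis2 2 D v -> C (y, z) -> C (y, z') ->
  v (P a y z') - v (P a y z) = RInt (fun s => deriv_z a D v (of_char a (ret (y, s)))) z z'.
Proof.
intros Hv H1 H2. apply (increment_z); auto.
- now apply CK_cont with basis2 2%nat.
- now apply (deriv_z_on v 1).
- intros q Hq. now apply along_deriv_z.
Qed.

Lemma path_z y z s : C (y, z) -> Rmin (gam y) z <= s <= Rmax (gam y) z -> C (y, s).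
Proof. intros H Hs. destruct (reg_path _ _ _ _ _ HR) as [rho [c [_ [HC _]]]]. apply (proj1 (HC y z H) s Hs). Qed.
Lemma path_y y z s : C (y, z) -> Rmin (gam z) y <= s <= Rmax (gam z) y -> C (s, z).
Proof. intros H Hs. destruct (reg_path _ _ _ _ _ HR) as [rho [c [_ [HC _]]]]. apply (proj2 (HC y z H) s Hs). Qed.
Lemma path_z0 y z : C (y, z) -> C (y, gam y).
Proof. intros H. apply path_z with (1 := H). split; [apply Rmin_l | apply Rmax_l]. Qed.
Lemma path_y0 y z : C (y, z) -> C (gam z, z).
Proof. intros H. apply path_y with (1 := H). split; [apply Rmin_l | apply Rmax_l]. Qed.

Variables (be U0 : R -> R).
Hypothesis Cbe : cont be.

(** The equation integrated twice: once along z = const for v_z, then along y = const for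
    v.  The side conditions are the values of v and (integrated) of v_z on the curve. *)
Lemma pde_represented v : CK basis2 2 D v -> (forall q, interior_of D q -> pde a F f D v q) ->
  (forall y z, C (y, z) -> v (P a y (gam y)) = U0 y) ->
  (forall y z, C (y, z) -> RInt (fun s => deriv_z a D v (of_char a (ret (gam s, s)))) (gam y) z = RInt be (gam y) z) ->
  represented a F f D C ret be U0 gam v.
Proof.
intros Hv Hp H0 H1 y z Hyz.
assert (Cs := cont_char_source a F f G D C gam ret ha HN HR v 1 Hv).
assert (Cg := reg_gam _ _ _ _ _ HR).
assert (Cvz := cont_pullback a D C gam ret ha HR _ (deriv_z_on v 1 Hv)).
set (Vz := fun q => deriv_z a D v (of_char a (ret q))) in Cvz.
assert (A := increment_z_of_v v y (gam y) z Hv (path_z0 y z Hyz) Hyz).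
replace (v (P a y z)) with (v (P a y (gam y)) + (v (P a y z) - v (P a y (gam y)))) by ring.
rewrite A, (H0 y z Hyz). unfold Uop; simpl. f_equal.
transitivity (RInt (fun s => Vz (gam s, s) + RInt (fun r => src v (r, s)) (gam s) y) (gam y) z).
- apply RInt_ext. intros s Hs.
  assert (Cys : C (y, s)) by (apply path_z with (1 := Hyz); lra).
  assert (B := increment_y _ _ (gam s) y s
    (deriv_z_on v 1 Hv) (source_on v (CK_weaken D v Hv)) (fun q Hq => deriv_z_along v q Hv Hp Hq) (path_y0 y s Cys) Cys).
  unfold Vz. rewrite !(reg_retid _ _ _ _ _ HR) by (try exact Cys; now apply path_y0 with y).
  unfold of_char; simpl. unfold char_source.
  change (deriv_z a D v (P a y s) = deriv_z a D v (P a (gam s) s) + RInt (fun r => - / (4 * a ^ 2) * source F f D v (of_char a (ret (r, s)))) (gam s) y).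
  rewrite <- B. ring.
- unfold Qop; simpl. rewrite RInt_add by cont_tac. rewrite RInt_add by cont_tac. f_equal. exact (H1 y z Hyz).
Qed.

Lemma source_char_source v p : D p -> source F f D v p = - (4 * a ^ 2) * src v (to_char a p).
Proof.
intros Hp. unfold char_source.
rewrite (reg_retid _ _ _ _ _ HR) by (now apply (reg_D _ _ _ _ _ HR)).
rewrite of_to_char by exact ha. field. lra.
Qed.

(** d'Alembert's formula and [Uop] differ by the coordinates and by the order in which the
    source is integrated over the characteristic triangle. *)
Lemma cauchy_represented (phij psij : R -> R) v : CK basis2 2 D v ->
  (forall s, gam s = s) ->
  (forall y z, C (y, z) -> U0 y = phij y) ->
  (forall y z, C (y, z) -> RInt be y z = (phij z - phij y) / 2 + / (2 * a) * RInt psij y z) ->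
  (cauchy_equation a F f phij psij D v <-> represented a F f D C ret be U0 gam v).
Proof.
intros Hv Hgam H0 H1.
assert (Cs := cont_char_source a F f G D C gam ret ha HN HR v 1 Hv).
assert (Cg := reg_gam _ _ _ _ _ HR). assert (Cc := cont_to_char a).
assert (Key : forall y z t x, C (y, z) -> y = x - a * t -> z = x + a * t ->
  (phij (x - a * t) + phij (x + a * t)) / 2 + / (2 * a) * RInt psij (x - a * t) (x + a * t)
      + / (2 * a) * RInt (fun tau => RInt (fun xi => source F f D v (tau, xi))
                     (x - a * (t - tau)) (x + a * (t - tau))) 0 t
  = Uop be U0 gam (src v) (y, z)).
{ intros y z t x Hyz Ey Ez. rewrite <- Ey, <- Ez.
  assert (Et : t = (z - y) / (2 * a)) by (rewrite Ey, Ez; field; lra).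
  assert (Lyz := reg_future _ _ _ _ _ HR y z Hyz).
  assert (Lt : 0 <= t) by (rewrite Et; apply Rdiv_le_0_compat; lra).
  assert (I : RInt (fun tau => RInt (fun xi => source F f D v (tau, xi)) (x - a * (t - tau)) (x + a * (t - tau))) 0 t
    = - (4 * a ^ 2) * RInt (fun tau => RInt (fun xi => src v (to_char a (tau, xi))) (y + a * tau) (z - a * tau)) 0 ((z - y) / (2 * a))).
  { rewrite <- Et, <- RInt_mult_const by cont_tac. apply RInt_ext.
    rewrite Rmin_left, Rmax_right by exact Lt. intros tau Htau.
    replace (x - a * (t - tau)) with (y + a * tau) by (rewrite Ey; ring).
    replace (x + a * (t - tau)) with (z - a * tau) by (rewrite Ez; ring).
    assert (Lb : y + a * tau <= z - a * tau).
    { assert (a * tau <= a * t) by (apply Rmult_le_compat_l; lra). lra. }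
    assert (La : 0 < a * tau) by (apply Rmult_lt_0_compat; lra).
    rewrite <- RInt_mult_const by cont_tac. apply RInt_ext.
    rewrite Rmin_left, Rmax_right by exact Lb. intros xi Hxi.
    apply source_char_source. apply (reg_D _ _ _ _ _ HR). unfold to_char; simpl.
    apply path_y with y.
    - apply path_z with z; [exact Hyz |]. rewrite Hgam, Rmin_left, Rmax_right; lra.
    - rewrite Hgam, Rmin_right, Rmax_left; lra. }
  rewrite I.
  assert (T := triangle_integral a (src v) y z ha Cs).
  replace (/ (2 * a) * (- (4 * a ^ 2) * RInt (fun tau => RInt (fun xi => src v (to_char a (tau, xi))) (y + a * tau) (z - a * tau)) 0 ((z - y) / (2 * a))))
   with (- (2 * a) * RInt (fun tau => RInt (fun xi => src v (to_char a (tau, xi))) (y + a * tau) (z - a * tau)) 0 ((z - y) / (2 * a)))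
   by (field; lra).
  rewrite T. unfold Uop, Qop; simpl. rewrite Hgam, (H0 y z Hyz).
  rewrite RInt_add by cont_tac. rewrite (H1 y z Hyz).
  rewrite (RInt_ext (fun s => RInt (fun r => src v (r, s)) (gam s) y) (fun s => RInt (fun r => src v (r, s)) s y))
    by (intros; now rewrite Hgam).
  toR; field; lra. }
split; intros H.
- intros y z Hyz. rewrite <- (Key y z (fst (P a y z)) (snd (P a y z)) Hyz).
  + apply (H (fst (P a y z)) (snd (P a y z))). destruct (P a y z) eqn:E; simpl. rewrite <- E. now apply (region_P a D C gam ret ha HR).
  + unfold P; simpl; field; lra.
  + unfold P; simpl; field; lra.
- intros t x Htx. apply (reg_D _ _ _ _ _ HR) in Htx. unfold to_char in Htx; simpl in Htx.
  rewrite (Key _ _ t x Htx eq_refl eq_refl), <- (H _ _ Htx). now rewrite P_to_char.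
Qed.

(** The two equations integrate the source over the same characteristic rectangle, in
    opposite orders. *)
Lemma goursat_represented (x0 A : R) (phi1 phi2 : R -> R) (uj : idx -> R * R -> R) :
  CK basis2 2 D (uj j3) -> D = Qsbar a x0 j3 -> (forall p, Qstar a x0 j3 p <-> D p) ->
  (forall s, gam s = x0) ->
  (forall y z, C (y, z) -> U0 y = uj j1 (P a y x0) + A - phi1 x0) ->
  (forall y z, C (y, z) -> RInt be x0 z = uj j2 (P a x0 z) - phi2 x0) ->
  (goursat_equation a x0 A F f phi1 phi2 uj <-> represented a F f D C ret be U0 gam (uj j3)).
Proof.
intros Hv ED Hstar Hgam H0 H1.
assert (Cs := cont_char_source a F f G D C gam ret ha HN HR _ 1 Hv).
assert (Cg := reg_gam _ _ _ _ _ HR).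
assert (Key : forall y z t x, C (y, z) -> y = x - a * t -> z = x + a * t ->
  uj j1 ((x0 + a * t - x) / (2 * a), (x0 - a * t + x) / 2)
      + uj j2 ((a * t + x - x0) / (2 * a), (a * t + x + x0) / 2)
      + A - phi1 x0 - phi2 x0
      - / (4 * a ^ 2) *
        RInt (fun y => RInt (fun z => source F f (Qsbar a x0 j3) (uj j3) (P a y z)) x0 (x + a * t)) x0 (x - a * t)
  = Uop be U0 gam (src (uj j3)) (y, z)).
{ intros y z t x Hyz Ey Ez. rewrite <- ED, <- Ey, <- Ez.
  replace ((x0 + a * t - x) / (2 * a), (x0 - a * t + x) / 2) with (P a y x0) by (unfold P; f_equal; rewrite Ey; field; lra).
  replace ((a * t + x - x0) / (2 * a), (a * t + x + x0) / 2) with (P a x0 z) by (unfold P; f_equal; rewrite Ez; field; lra).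
  assert (I : RInt (fun y => RInt (fun z => source F f D (uj j3) (P a y z)) x0 z) x0 y
     = - (4 * a ^ 2) * RInt (fun r => RInt (fun s => src (uj j3) (r, s)) x0 z) x0 y).
  { rewrite <- RInt_mult_const by cont_tac. apply RInt_ext. intros r Hr. rewrite <- RInt_mult_const by cont_tac. apply RInt_ext. intros s Hs.
    assert (Crs : C (r, s)).
    { apply path_y with y.
      - apply path_z with z; [exact Hyz |]. rewrite Hgam; lra.
      - rewrite Hgam; lra. }
    rewrite source_char_source by (now apply (region_P a D C gam ret ha HR)). now rewrite to_char_P. }
  rewrite I, <- RInt_exchange by exact Cs. unfold Uop, Qop; simpl. rewrite Hgam, (H0 y z Hyz).
  rewrite RInt_add by cont_tac. rewrite (H1 y z Hyz).
  rewrite (RInt_ext (fun s => RInt (fun r => src (uj j3) (r, s)) (gam s) y) (fun s => RInt (fun r => src (uj j3) (r, s)) x0 y))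
    by (intros; now rewrite Hgam).
  toR; field; lra. }
split; intros H.
- intros y z Hyz. rewrite <- (Key y z (fst (P a y z)) (snd (P a y z)) Hyz).
  + apply (H (fst (P a y z)) (snd (P a y z))). apply Hstar.
    destruct (P a y z) eqn:E; simpl. rewrite <- E. now apply (region_P a D C gam ret ha HR).
  + unfold P; simpl; field; lra.
  + unfold P; simpl; field; lra.
- intros t x Htx. apply Hstar in Htx. apply (reg_D _ _ _ _ _ HR) in Htx. unfold to_char in Htx; simpl in Htx.
  rewrite (Key _ _ t x Htx eq_refl eq_refl), <- (H _ _ Htx). now rewrite P_to_char.
Qed.

End Representation.

(** * Data on half-lines *)

Section HalfLine.
Variables (x0 a : R) (D : R -> Prop) (cl : R -> R).
Hypothesis ha : 0 < a.
Hypothesis Dconv : forall x s, D x -> Rmin x0 x <= s <= Rmax x0 x -> D s.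
Hypothesis Dcol : collared (V := R_NormedModule) D.
Hypothesis Ccl : cont cl.
Hypothesis Dcl : forall x, D (cl x).
Hypothesis clid : forall x, D x -> cl x = x.

Lemma half_primitive (h h' k : R -> R) :
  continuous_on D h -> continuous_on D h' ->
  (forall p, interior_of D p -> is_derive (along h p 1) 0 (h' p)) ->
  (forall x, D x -> k x = h' x) -> forall x, D x -> h x = h x0 + RInt k x0 x.
Proof.
intros Ch Ch' Hd Hk x Dx.
assert (R1 : forall s : R, plus x0 (scal s 1) = x0 + s).
{ intros s. change (x0 + s * 1 = x0 + s). ring. }
assert (E := increment_along (V := R_NormedModule) D 1 x0 h h' (x - x0) Ch Ch' Hd).
assert (C1 : cont (fun s => h' (cl s))) by now apply (cont_comp_on D).
rewrite R1 in E. replace (x0 + (x - x0)) with x in E by ring.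
assert (B : forall s, Rmin 0 (x - x0) <= s <= Rmax 0 (x - x0) -> D (x0 + s)).
{ intros s Hs. apply Dconv with x; [exact Dx |].
  unfold Rmin, Rmax in *. destruct (Rle_dec 0 (x - x0)), (Rle_dec x0 x); lra. }
assert (E1 : RInt (fun s => h' (plus x0 (scal s 1))) 0 (x - x0) = RInt k x0 x).
{ transitivity (RInt (fun s => h' (cl (x0 + s))) 0 (x - x0)).
  - apply RInt_ext. intros s Hs. rewrite R1, clid; [reflexivity | apply B; lra].
  - rewrite (RInt_translate (fun s => h' (cl s)) x0 (x - x0) C1). replace (x0 + (x - x0)) with x by ring.
    apply RInt_ext. intros s Hs. assert (Ds : D s) by (apply Dconv with x; [exact Dx | lra]).
    rewrite clid, Hk; auto. }
assert (E2 : RInt (fun s => h' (plus x0 (scal s 1))) 0 (x - x0) = h x - h x0).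
{ apply E; [| exact Dcol]. intros s Hs. rewrite R1. now apply B. }
assert (E3 : RInt k x0 x = h x - h x0) by (now rewrite <- E1).
lra.
Qed.

(** The extension is affine outside [D]. *)
Lemma half_extension (h : R -> R) : CK basis1 1 D h ->
  exists H : R -> R, cont H /\ C1_slope H /\ forall x, D x -> H x = h x.
Proof.
intros [Ch Hd]. destruct (Hd 1 (or_introl eq_refl)) as [h' [D1 [Ch' _]]].
assert (C1 : cont (fun s => h' (cl s))) by now apply (cont_comp_on D).
set (k := fun s => h' (cl s)) in C1.
exists (fun x => h x0 + RInt k x0 x). split; [cont_tac |]. split.
- exists (fun w => RInt (fun s => k (fst w + s * (snd w - fst w))) 0 1). split; [cont_tac |].
  intros y y'. simpl. rewrite <- RInt_unit by exact C1. rewrite <- (RInt_split k x0 y y') by exact C1. toR; ring.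
- intros x Dx. symmetry. apply (half_primitive h h' k); auto. intros s Ds; unfold k; now rewrite clid.
Qed.

Lemma C1_slope_lin (c d : R) (g h : R -> R) :
  C1_slope g -> C1_slope h -> C1_slope (fun x => c * g x + d * h x).
Proof.
intros [k [Ck Hk]] [l [Cl Hl]]. exists (fun w => c * k w + d * l w). split; [cont_tac |].
intros y y'. transitivity (c * (g y' - g y) + d * (h y' - h y)); [ring |]. rewrite Hk, Hl. ring.
Qed.

(** On t = 0 one has u_x = phi' and u_t = psi, hence u_y = (phi' - psi / a) / 2 and
    u_z = (phi' + psi / a) / 2. *)
Lemma half_data (phij psij : R -> R) : CK basis1 2 D phij -> CK basis1 1 D psij ->
  exists al be U0 : R -> R,
    curve_data al be U0 (fun x => x) /\
    (forall x, D x -> U0 x = phij x) /\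
    (forall x, D x -> a * (be x - al x) = psij x) /\
    (forall y z, D y -> D z -> RInt be y z = (phij z - phij y) / 2 + / (2 * a) * RInt psij y z).
Proof.
intros [Cphi Hphi] Hpsi. destruct (Hphi 1 (or_introl eq_refl)) as [phi' [D1 H1]].
destruct (half_extension phi' H1) as [p [Cp [Sp Ep]]].
destruct (half_extension psij Hpsi) as [s [Cs [Ss Es]]].
set (U0 := (fun x => phij x0 + RInt p x0 x) : R -> R).
assert (EU : forall x, D x -> U0 x = phij x).
{ intros x Dx. unfold U0. symmetry. apply (half_primitive phij phi' p); auto. apply H1. }
exists (fun x => / 2 * p x + - / (2 * a) * s x), (fun x => / 2 * p x + / (2 * a) * s x), U0.
split; [split | split; [exact EU | split]].
- cont_tac.
- cont_tac.
- unfold U0; cont_tac.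
- now apply C1_slope_lin.
- now apply C1_slope_lin.
- exists 1. split; [intros; ring |]. split; [now right |]. intros y.
  replace (/ 2 * p y + - / (2 * a) * s y + 1 * (/ 2 * p y + / (2 * a) * s y)) with (0 + p y) by (field; lra).
  unfold U0. apply der_plus; [apply der_const | now apply is_derive_RInt_cont].
- intros x Dx. rewrite <- (Es x Dx). field. lra.
- intros y z Dy Dz.
  assert (Cp' : cont (fun x => / 2 * p x)) by cont_tac. assert (Cs' : cont (fun x => / (2 * a) * s x)) by cont_tac.
  rewrite (RInt_add _ _ _ _ Cp' Cs'), !RInt_mult_const by assumption.
  assert (A : RInt p y z = phij z - phij y).
  { rewrite <- (EU z Dz), <- (EU y Dy). unfold U0. rewrite <- (RInt_split p x0 y z) by exact Cp. lra. }
  assert (B : RInt s y z = RInt psij y z).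
  { apply RInt_ext. intros x Hx. apply Es.
    (* x lies between x0 and one of y, z *)
    unfold Rmin, Rmax in Hx. destruct (Rle_dec x0 x), (Rle_dec y z);
      (apply Dconv with z; [exact Dz |]; unfold Rmin, Rmax; destruct (Rle_dec x0 z); lra) ||
      (apply Dconv with y; [exact Dy |]; unfold Rmin, Rmax; destruct (Rle_dec x0 y); lra). }
  rewrite A, B. toR; field. lra.
Qed.
End HalfLine.

Definition side (x0 : R) (j : idx) : R -> Prop :=
  match j with j1 => fun x => x <= x0 | _ => fun x => x0 <= x end.

Lemma side_data (x0 a : R) (j : idx) (phij psij : R -> R) : 0 < a ->
  CK basis1 2 (side x0 j) phij -> CK basis1 1 (side x0 j) psij ->
  exists al be U0 : R -> R,
    curve_data al be U0 (fun x => x) /\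
    (forall x, side x0 j x -> U0 x = phij x) /\
    (forall x, side x0 j x -> a * (be x - al x) = psij x) /\
    (forall y z, side x0 j y -> side x0 j z ->
       RInt be y z = (phij z - phij y) / 2 + / (2 * a) * RInt psij y z).
Proof.
intros ha. set (sg := match j with j1 => -1 | _ => 1 end).
assert (Hs : forall x, side x0 j x <-> 0 <= sg * (x - x0)) by (intros x; destruct j; unfold side, sg; lra).
apply (half_data x0 a (side x0 j) (fun x => match j with j1 => Rmin x x0 | _ => Rmax x x0 end)).
- exact ha.
- intros x s. rewrite !Hs. unfold Rmin, Rmax, sg. destruct j, (Rle_dec x0 x); lra.
- exists sg. intros q eps Hq He. apply Hs in Hq. unfold interior_of.
  assert (C : cont (fun x : R => sg * (x - x0))) by cont_tac.
  assert (X : 0 < sg * (q + eps * sg - x0)) by (unfold sg in *; destruct j; lra).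
  generalize (interior_pos _ (q + eps * sg) C X). apply filter_imp. intros x Hx. apply Hs. lra.
- destruct j; cont_tac.
- intros x. destruct j; [apply Rmin_r | apply Rmax_r | apply Rmax_r].
- intros x Hx. destruct j; [now apply Rmin_left | now apply Rmax_left | now apply Rmax_left].
Qed.

(** * The three sectors *)

Definition sector (x0 : R) (j : idx) (q : R * R) : Prop :=
  match j with
  | j1 => fst q <= snd q /\ snd q <= x0
  | j2 => x0 <= fst q /\ fst q <= snd q
  | j3 => fst q <= x0 /\ x0 <= snd q
  end.

Section Sectors.
Variables (a x0 : R).
Hypothesis ha : 0 < a.

(** Affine forms in (t, x) whose signs describe sector j. *)
Definition edge1 (j : idx) (p : R * R) : R :=
  match j with j3 => x0 - (snd p - a * fst p) | _ => fst p end.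
Definition edge2 (j : idx) (p : R * R) : R :=
  match j with
  | j1 => x0 - (snd p + a * fst p)
  | j2 => snd p - a * fst p - x0
  | j3 => snd p + a * fst p - x0
  end.
Definition inward (j : idx) : R * R :=
  match j with j1 => (1, - (2 * a)) | j2 => (1, 2 * a) | j3 => (1, 0) end.

Lemma cont_edge1 j : cont (edge1 j).
Proof. destruct j; unfold edge1; cont_tac. Qed.
Lemma cont_edge2 j : cont (edge2 j).
Proof. destruct j; unfold edge2; cont_tac. Qed.

Lemma edges_inward (j : idx) (q : R * R) (eps : R) : 0 < eps ->
  edge1 j q < edge1 j (plus q (scal eps (inward j))) /\ edge2 j q < edge2 j (plus q (scal eps (inward j))).
Proof.
intros He. destruct q as [t x]. assert (0 < a * eps) by (apply Rmult_lt_0_compat; lra).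
destruct j; unfold inward; rewrite plus_scal2; simpl; lra.
Qed.

Lemma sector_edges (j : idx) (p : R * R) : sector x0 j (to_char a p) <-> 0 <= edge1 j p /\ 0 <= edge2 j p.
Proof. destruct j; unfold sector, to_char; simpl; split; intros [A B]; split; try lra; nra. Qed.

Lemma closure_between_edges (j : idx) (D : R * R -> Prop) :
  (forall q, 0 < edge1 j q -> 0 < edge2 j q -> D q) ->
  (forall q, D q -> 0 <= edge1 j q /\ 0 <= edge2 j q) ->
  forall p, closure_of D p <-> sector x0 j (to_char a p).
Proof.
intros H1 H2 p. rewrite sector_edges. split.
- intros H. split.
  + apply (closure_of_le D (edge1 j) p (cont_edge1 j)); [| exact H]. intros q Hq; now apply H2.
  + apply (closure_of_le D (edge2 j) p (cont_edge2 j)); [| exact H]. intros q Hq; now apply H2.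
- intros [A B]. apply (closure_of_shift D p (inward j)). intros eps He.
  destruct (edges_inward j p eps He) as [E1 E2].
  apply H1; [exact (Rle_lt_trans _ _ _ A E1) | exact (Rle_lt_trans _ _ _ B E2)].
Qed.

Lemma closure_Qsub (j : idx) (p : R * R) : closure_of (Qsub a x0 j) p <-> sector x0 j (to_char a p).
Proof.
apply closure_between_edges; intros [t x]; destruct j; unfold Qsub, Q; simpl; intros; repeat split; try lra; nra.
Qed.

Lemma Qstar_iff (j : idx) (p : R * R) : Qstar a x0 j p <->
  match j with j3 => 0 <= edge1 j p /\ 0 <= edge2 j p | _ => 0 <= edge1 j p /\ 0 < edge2 j p end.
Proof.
destruct j; unfold Qstar; rewrite ?closure_Qsub, ?sector_edges; simpl; [| | reflexivity].
- split; [| intros [A B]; split; [lra |]; nra].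
  intros [[A B] E]. split; [exact A |].
  destruct (Rlt_dec 0 (x0 - (snd p + a * fst p))) as [L | L]; [exact L |]. exfalso; apply E. nra.
- split; [| intros [A B]; split; [lra |]; nra].
  intros [[A B] E]. split; [exact A |].
  destruct (Rlt_dec 0 (snd p - a * fst p - x0)) as [L | L]; [exact L |]. exfalso; apply E. nra.
Qed.

Lemma Qsbar_iff (j : idx) (p : R * R) : Qsbar a x0 j p <-> sector x0 j (to_char a p).
Proof.
apply closure_between_edges; intros q; rewrite Qstar_iff; destruct j; lra.
Qed.

Lemma Qstar_Qsbar (j : idx) (p : R * R) : Qstar a x0 j p -> Qsbar a x0 j p.
Proof. intros H. unfold Qsbar. intros eps. exists p; split; [apply ball_center | exact H]. Qed.

Lemma Qstar_cover (p : R * R) : 0 <= fst p -> exists j, Qstar a x0 j p.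
Proof.
intros Hp. destruct (Rlt_dec 0 (edge2 j1 p)) as [L1 | L1]; [exists j1; now apply Qstar_iff |].
destruct (Rlt_dec 0 (edge2 j2 p)) as [L2 | L2]; [exists j2; now apply Qstar_iff |].
exists j3. apply Qstar_iff. simpl in *. lra.
Qed.

(** An interior point of the closed sector can be moved a little against [inward] without
    leaving it; as this lowers the edge forms, they were positive. *)
Lemma interior_Qstar (j : idx) (p : R * R) : interior_of (Qsbar a x0 j) p -> Qstar a x0 j p.
Proof.
intros H. assert (S := locally_singleton _ _ H). apply Qsbar_iff, sector_edges in S.
set (m := fun s : R => (fst p - s * fst (inward j), snd p - s * snd (inward j))).
assert (Cm : cont m) by (unfold m; cont_tac).
assert (L : locally 0 (fun s => Qsbar a x0 j (m s))).
{ apply (Cm 0 (Qsbar a x0 j)). unfold m. rewrite !Rmult_0_l, !Rminus_0_r. destruct p; exact H. }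
destruct L as [d Hd]. assert (Pd := cond_pos d).
assert (X : Qsbar a x0 j (m (d / 2))).
{ apply Hd. change (Rabs (d / 2 - 0) < d). rewrite Rminus_0_r, Rabs_pos_eq; lra. }
apply Qsbar_iff, sector_edges in X. destruct (edges_inward j (m (d / 2)) (d / 2) ltac:(lra)) as [_ E].
replace (plus (m (d / 2)) (scal (d / 2) (inward j))) with p in E.
- apply Qstar_iff. destruct j; lra.
- unfold m. destruct p as [t x], (inward j) as [n1 n2]. rewrite plus_scal2. simpl. f_equal; ring.
Qed.

Definition dist_diag (p : R * R) : R := Rabs (snd p - fst p).
Definition dist_axes (p : R * R) : R := Rabs (fst p - x0) + Rabs (snd p - x0).

Ltac minmax := unfold Rmin, Rmax in *;
  repeat match goal with
  | |- context [Rle_dec ?u ?v] => destruct (Rle_dec u v)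
  | H : context [Rle_dec ?u ?v] |- _ => destruct (Rle_dec u v)
  end.
Ltac absr := unfold Rabs in *;
  repeat match goal with
  | |- context [Rcase_abs ?u] => destruct (Rcase_abs u)
  | H : context [Rcase_abs ?u] |- _ => destruct (Rcase_abs u)
  end.

Lemma path_diag (C : R * R -> Prop) :
  (forall y z s, C (y, z) -> Rmin y z <= s <= Rmax y z -> C (y, s)) ->
  (forall y z s, C (y, z) -> Rmin z y <= s <= Rmax z y -> C (s, z)) ->
  path_closed (fun s => s) dist_diag C.
Proof.
intros H1 H2 y z Hyz. unfold dist_diag; simpl. split; intros s Hs.
- split; [now apply H1 with z |]. minmax; absr; lra.
- split; [now apply H2 with y |]. minmax; absr; lra.
Qed.

Lemma path_axes (C : R * R -> Prop) :
  (forall y z s, C (y, z) -> Rmin x0 z <= s <= Rmax x0 z -> C (y, s)) ->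
  (forall y z s, C (y, z) -> Rmin x0 y <= s <= Rmax x0 y -> C (s, z)) ->
  path_closed (fun _ => x0) dist_axes C.
Proof.
intros H1 H2 y z Hyz. unfold dist_axes; simpl. split; intros s Hs.
- split; [now apply H1 with z |]. minmax; absr; lra.
- split; [now apply H2 with y |]. minmax; absr; lra.
Qed.

Definition data_curve (j : idx) : R -> R := match j with j3 => fun _ => x0 | _ => fun s => s end.

Definition retract (j : idx) (q : R * R) : R * R :=
  match j with
  | j1 => (Rmin (fst q) (Rmin (snd q) x0), Rmin (snd q) x0)
  | j2 => (Rmax (fst q) x0, Rmax (snd q) (Rmax (fst q) x0))
  | j3 => (Rmin (fst q) x0, Rmax (snd q) x0)
  end.

Lemma sector_region (j : idx) : region a (Qsbar a x0 j) (sector x0 j) (data_curve j) (retract j).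
Proof.
split.
- apply Qsbar_iff.
- exists (inward j). intros q eps Hq He. apply Qsbar_iff, sector_edges in Hq.
  destruct (edges_inward j q eps He) as [E1 E2]. unfold interior_of.
  generalize (filter_and _ _ (interior_pos _ _ (cont_edge1 j) (Rle_lt_trans _ _ _ (proj1 Hq) E1))
    (interior_pos _ _ (cont_edge2 j) (Rle_lt_trans _ _ _ (proj2 Hq) E2))).
  apply filter_imp. intros x [X Y]. apply Qsbar_iff, sector_edges. lra.
- destruct j; unfold retract; cont_tac.
- intros [y z]; destruct j; unfold sector, retract; simpl; minmax; lra.
- intros [y z]; destruct j; unfold sector, retract; simpl; intros; f_equal; minmax; lra.
- destruct j; unfold sector; simpl; intros; lra.
- destruct j; unfold data_curve; cont_tac.
- destruct j; [exists dist_diag, x0 | exists dist_diag, x0 | exists dist_axes, x0].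
  + split; [unfold dist_diag; cont_tac |]. split; [apply path_diag; unfold sector; simpl; intros; minmax; lra |].
    intros r. apply path_diag; unfold box; simpl; intros; split; minmax; absr; lra.
  + split; [unfold dist_diag; cont_tac |]. split; [apply path_diag; unfold sector; simpl; intros; minmax; lra |].
    intros r. apply path_diag; unfold box; simpl; intros; split; minmax; absr; lra.
  + split; [unfold dist_axes; cont_tac |]. split; [apply path_axes; unfold sector; simpl; intros; minmax; lra |].
    intros r. apply path_axes; unfold box; simpl; intros; split; minmax; absr; lra.
- destruct j; unfold sector; simpl; intros; minmax; lra.
- destruct j; unfold sector; simpl; intros; minmax; lra.
Qed.

End Sectors.

(** * The outer pieces: Cauchy problems *)

Lemma P_diag (a s : R) : P a s s = (0, s).
Proof. unfold P. f_equal; [unfold Rdiv; rewrite Rminus_diag; ring | field]. Qed.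

Lemma quotient_lim (g : R -> R) (l : R) : is_derive g 0 l ->
  filterlim (fun h => (g h - g 0) / h) (at_right 0) (locally l).
Proof.
intros H. apply is_derive_Reals in H. apply filterlim_locally. intros eps.
destruct (H eps (cond_pos eps)) as [d Hd]. exists d. intros h Hh Hp.
change (Rabs (h - 0) < d) in Hh. rewrite Rminus_0_r in Hh.
assert (E := Hd h ltac:(lra) Hh). rewrite Rplus_0_l in E. exact E.
Qed.

Lemma quotient_lim_ext (g g' : R -> R) (d l : R) : 0 < d -> (forall h, 0 <= h <= d -> g h = g' h) ->
  filterlim (fun h => (g h - g 0) / h) (at_right 0) (locally l) ->
  filterlim (fun h => (g' h - g' 0) / h) (at_right 0) (locally l).
Proof.
intros Hd E. apply filterlim_ext_loc.
exists (mkposreal d Hd). intros h Hh Hp. change (Rabs (h - 0) < d) in Hh. rewrite Rminus_0_r in Hh.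
apply Rabs_def2 in Hh. rewrite !E by lra. reflexivity.
Qed.

Section CauchyPiece.
Variables (a : R) (F : R * R -> R) (f G : (R * R) * (R * R * R) -> R).
Variables (D C : R * R -> Prop) (gam : R -> R) (ret : R * R -> R * R).
Hypothesis ha : 0 < a.
Hypothesis HN : nonlinearity a F f G.
Hypothesis HR : region a D C gam ret.

(** The one-sided derivative at t = 0, about which the initial condition speaks, is the
    limit of the derivative from the interior. *)
Lemma initial_velocity (v : R * R -> R) (x d l : R) : CK basis2 2 D v -> 0 < d ->
  (forall h, 0 <= h <= d -> D (h, x)) ->
  filterlim (fun h => (v (h, x) - v (0, x)) / h) (at_right 0) (locally l) ->
  pderiv D e_t v (0, x) = l.
Proof.
intros Hv Hd HD Hl.
assert (inner := reg_collared _ _ _ _ _ HR).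
destruct (CK_pderiv basis2 1 D e_t v inner Hv in_t) as [Ht Dt].
assert (Ct := CK_cont _ _ _ _ Ht). assert (Cv := CK_cont _ _ _ _ Hv).
assert (Ck0 := cont_pullback a D C gam ret ha HR _ Ct).
set (k0 := fun q => pderiv D e_t v (of_char a (ret q))) in Ck0.
assert (Cc := cont_to_char a).
set (k := fun s : R => k0 (to_char a (s, x))).
assert (Ck : cont k) by (unfold k; cont_tac).
assert (Ek : forall s, 0 <= s <= d -> k s = pderiv D e_t v (s, x)).
{ intros s Hs. unfold k, k0. rewrite (reg_retid _ _ _ _ _ HR).
  - now rewrite of_to_char.
  - apply (reg_D _ _ _ _ _ HR). now apply HD. }
assert (Inc : forall h, 0 <= h <= d -> RInt k 0 h - RInt k 0 0 = v (h, x) - v (0, x)).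
{ intros h Hh. rewrite RInt_same, Rminus_0_r.
  assert (L : forall s, (fst (0, x) + s * 1, snd (0, x) + s * 0) = (s, x)) by (intros; simpl; f_equal; ring).
  assert (E := increment_flat D v (pderiv D e_t v) 1 0 h (0, x) inner Cv Ct Dt).
  rewrite L in E. rewrite <- E.
  - apply RInt_ext. rewrite Rmin_left, Rmax_right by lra. intros s Hs. rewrite L. apply Ek. lra.
  - rewrite Rmin_left, Rmax_right by lra. intros s Hs. rewrite L. apply HD. lra. }
rewrite <- Ek by lra.
apply (filterlim_locally_unique (V := R_NormedModule) (F := at_right 0)
   (fun h => (v (h, x) - v (0, x)) / h) (k 0) l); [| exact Hl].
apply (quotient_lim_ext (fun h => RInt k 0 h - (RInt k 0 0 - v (0, x))) (fun h => v (h, x)) d (k 0) Hd).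
- intros h Hh. specialize (Inc h Hh). lra.
- apply quotient_lim. rewrite <- (Rminus_0_r (k 0)).
  apply der_minus; [now apply is_derive_RInt_cont | apply der_const].
Qed.

(** A classical solution of the Cauchy problem satisfies the integral equation.  The
    initial conditions leave out the corner [x0] of the sector; the value there follows by
    continuity along the half-line of direction [m]. *)
Lemma cauchy_piece (phij psij be U0 : R -> R) (x0 m : R) (v : R * R -> R) :
  (forall s, gam s = s) -> cont be -> cont U0 ->
  (forall s, C (s, s) -> U0 s = phij s) ->
  (forall y z, C (y, z) -> RInt be y z = (phij z - phij y) / 2 + / (2 * a) * RInt psij y z) ->
  m <> 0 -> (forall e, 0 <= e -> C (x0 + e * m, x0 + e * m)) ->
  (forall y z, C (y, z) -> ~ (y < x0 < z)) ->
  CK basis2 2 D v -> (forall q, interior_of D q -> pde a F f D v q) ->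
  (forall s, C (s, s) -> s <> x0 -> v (0, s) = phij s) ->
  (forall s, C (s, s) -> s <> x0 -> exists d, 0 < d /\ (forall h, 0 <= h <= d -> D (h, s)) /\
     filterlim (fun h => (v (h, s) - v (0, s)) / h) (at_right 0) (locally (psij s))) ->
  represented a F f D C ret be U0 gam v.
Proof.
intros Hg Cbe CU H0 H1 Hm Hx0 Hcorner Hv Hp Hphi Hpsi.
assert (inner := reg_collared _ _ _ _ _ HR).
assert (Cg := reg_gam _ _ _ _ _ HR).
assert (diag : forall y z s, C (y, z) -> y <= s <= z -> C (s, s)).
{ intros y z s Hyz Hs.
  assert (C (y, s)).
  { apply (path_z a D C gam ret HR y z); [exact Hyz |]. rewrite Hg, Rmin_left, Rmax_right; lra. }
  apply (path_y a D C gam ret HR y s); [assumption |]. rewrite Hg, Rmin_right, Rmax_left; lra. }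
assert (Cv := cont_pullback a D C gam ret ha HR _ (CK_cont _ _ _ _ Hv)).
set (w := fun q => v (of_char a (ret q))) in Cv.
assert (W0 : forall s, C (s, s) -> of_char a (ret (s, s)) = (0, s)).
{ intros s Hs. rewrite (reg_retid _ _ _ _ _ HR) by exact Hs. apply P_diag. }
assert (Hphi' : forall s, C (s, s) -> v (0, s) = U0 s).
{ intros s Hs. destruct (Req_dec s x0) as [-> | Ns]; [| rewrite H0 by exact Hs; now apply Hphi].
  assert (E := cont_eq_at_0 (fun e => w (x0 + e * m, x0 + e * m)) (fun e => U0 (x0 + e * m)) ltac:(cont_tac) ltac:(cont_tac)).
  simpl in E. rewrite Rmult_0_l, Rplus_0_r in E. unfold w in E. rewrite W0 in E by exact Hs. apply E.
  intros e He. assert (Ce := Hx0 e ltac:(lra)). rewrite W0, H0 by exact Ce. apply Hphi; [exact Ce |].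
  assert (e * m <> 0) by (apply Rmult_integral_contrapositive_currified; lra). lra. }
apply (pde_represented a F f G D C gam ret ha HN HR); auto.
- intros y z Hyz. assert (L := reg_future _ _ _ _ _ HR y z Hyz).
  rewrite Hg, P_diag. apply Hphi'. apply diag with (1 := Hyz). lra.
- intros y z Hyz. assert (L := reg_future _ _ _ _ _ HR y z Hyz). rewrite Hg, (H1 y z Hyz).
  destruct (CK_pderiv basis2 1 D e_x v inner Hv in_x) as [Hx Dx].
  destruct (CK_pderiv basis2 1 D e_t v inner Hv in_t) as [Ht Dt].
  assert (Cx := CK_cont _ _ _ _ Hx). assert (Ct := CK_cont _ _ _ _ Ht). assert (Cv0 := CK_cont _ _ _ _ Hv).
  assert (Cx' := cont_pullback a D C gam ret ha HR _ Cx).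
  assert (Ct' := cont_pullback a D C gam ret ha HR _ Ct).
  set (wx := fun q => pderiv D e_x v (of_char a (ret q))) in Cx'.
  set (wt := fun q => pderiv D e_t v (of_char a (ret q))) in Ct'.
  assert (Css : forall s, y <= s <= z -> C (s, s)) by (intros; now apply (diag y z)).
  assert (Ix : RInt (fun s => wx (s, s)) y z = phij z - phij y).
  { assert (X : forall s, (fst (0, y) + s * 0, snd (0, y) + s * 1) = (0, y + s)) by (intros; simpl; f_equal; ring).
    assert (E := increment_flat D v (pderiv D e_x v) 0 1 (z - y) (0, y) inner Cv0 Cx Dx).
    rewrite X in E. replace (y + (z - y)) with z in E by ring.
    rewrite <- (H0 z), <- (H0 y), <- (Hphi' z), <- (Hphi' y) by (apply Css; lra). rewrite <- E.
    - assert (Cw : cont (fun s => wx (s, s))) by cont_tac.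
      assert (T := RInt_translate (fun s => wx (s, s)) y (z - y) Cw). replace (y + (z - y)) with z in T by ring.
      rewrite <- T. apply RInt_ext. rewrite Rmin_left, Rmax_right by lra. intros s Hs. rewrite X. unfold wx.
      rewrite W0 by (apply Css; lra). reflexivity.
    - rewrite Rmin_left, Rmax_right by lra. intros s Hs. rewrite X, <- (P_diag a).
      apply (region_P a D C gam ret ha HR), Css. lra. }
  assert (It : RInt (fun s => wt (s, s)) y z = RInt psij y z).
  { apply RInt_ext. rewrite Rmin_left, Rmax_right by exact L. intros s Hs. unfold wt.
    assert (Cs : C (s, s)) by (apply Css; lra). rewrite W0 by exact Cs.
    assert (Ns : s <> x0) by (intros ->; now apply (Hcorner y z)).
    destruct (Hpsi s Cs Ns) as [d [Hd [HD Hl]]]. now apply initial_velocity with d. }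
  transitivity (RInt (fun s => / 2 * wx (s, s) + / (2 * a) * wt (s, s)) y z).
  + apply RInt_ext. intros s _. rewrite (deriv_z_eq a D ha), Hg. reflexivity.
  + assert (A1 : cont (fun s => / 2 * wx (s, s))) by cont_tac. assert (A2 : cont (fun s => / (2 * a) * wt (s, s))) by cont_tac.
    assert (B1 : cont (fun s => wx (s, s))) by cont_tac. assert (B2 : cont (fun s => wt (s, s))) by cont_tac.
    assert (E1 := RInt_mult_const _ (/ 2) y z B1). assert (E2 := RInt_mult_const _ (/ (2 * a)) y z B2).
    assert (E3 := RInt_add _ _ y z A1 A2). cbv beta in E1, E2, E3.
    refine (eq_trans E3 _). refine (eq_trans (f_equal2 Rplus E1 E2) _).
    refine (eq_trans (f_equal2 (fun u w : R => / 2 * u + / (2 * a) * w) Ix It) _). toR; field; lra.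
Qed.
End CauchyPiece.

Lemma Qstar_initial (a x0 : R) (j : idx) (s : R) : 0 < a -> j <> j3 -> side x0 j s -> s <> x0 ->
  exists d, 0 < d /\ forall h, 0 <= h <= d -> Qstar a x0 j (h, s).
Proof.
intros ha Hj Hs Ns. exists (Rabs (s - x0) / (2 * a)).
assert (Pd : 0 < Rabs (s - x0) / (2 * a)) by (apply Rdiv_lt_0_compat; [apply Rabs_pos_lt |]; lra).
split; [exact Pd |]. intros h Hh. apply (Qstar_iff a x0 ha).
assert (A : a * h <= a * (Rabs (s - x0) / (2 * a))) by (apply Rmult_le_compat_l; lra).
replace (a * (Rabs (s - x0) / (2 * a))) with (Rabs (s - x0) / 2) in A by (field; lra).
destruct j; unfold side in Hs; simpl; [| | easy].
- rewrite Rabs_left1 in A by lra. lra.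
- rewrite Rabs_pos_eq in A by lra. lra.
Qed.

(** The sectors j1 and j2 at once.  Every description of a piece amounts to
    [represented], and a represented function is unique; the solution is given by a
    function [W] on the plane because its trace on the characteristic through (0, x0)
    is needed next. *)
Lemma outer_piece (a x0 : R) (F : R * R -> R) (f G : (R * R) * (R * R * R) -> R) (j : idx) (phij psij : R -> R) :
  0 < a -> nonlinearity a F f G -> j <> j3 ->
  CK basis1 2 (side x0 j) phij -> CK basis1 1 (side x0 j) psij ->
  exists W Wy Wz, let v := fun p => W (to_char a p) in
    C2_partials W Wy Wz /\ CK basis2 2 (Qsbar a x0 j) v /\
    cauchy_equation a F f phij psij (Qsbar a x0 j) v /\
    (forall p, Qsbar a x0 j p -> pde a F f (Qsbar a x0 j) v p) /\
    (forall x, side x0 j x -> W (x, x) = phij x /\ a * (Wz (x, x) - Wy (x, x)) = psij x) /\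
    forall w, CK basis2 2 (Qsbar a x0 j) w ->
      (cauchy_equation a F f phij psij (Qsbar a x0 j) w -> forall p, Qsbar a x0 j p -> w p = v p) /\
      ((forall q, interior_of (Qsbar a x0 j) q -> pde a F f (Qsbar a x0 j) w q) ->
       (forall s, side x0 j s -> s <> x0 -> w (0, s) = phij s /\
          filterlim (fun h => (w (h, s) - w (0, s)) / h) (at_right 0) (locally (psij s))) ->
       forall p, Qsbar a x0 j p -> w p = v p).
Proof.
intros ha HN Hj Hphi Hpsi.
assert (HR := sector_region a x0 ha j).
assert (Eg : data_curve x0 j = fun s => s) by (destruct j; easy). rewrite Eg in HR.
destruct (side_data x0 a j phij psij ha Hphi Hpsi) as [al [be [U0 [HD [EU [Ev Ei]]]]]].
destruct (rep_exists a F f G _ _ _ _ al be U0 ha HN HR HD) as [v [Kv [Rv [[W [Wy [Wz [HW [Ew [By [Bz B]]]]]]] Pv]]]].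
subst v. exists W, Wy, Wz. cbv zeta.
assert (Cs : forall y z, sector x0 j (y, z) -> side x0 j y /\ side x0 j z).
{ intros y z. destruct j; unfold sector, side; simpl; [lra | lra | easy]. }
assert (Cauchy := fun w Kw => cauchy_represented a F f G _ _ _ _ ha HN HR be U0 (dat_be _ _ _ _ HD) phij psij w Kw
  (fun _ => eq_refl) (fun y z H => EU y (proj1 (Cs y z H))) (fun y z H => Ei y z (proj1 (Cs y z H)) (proj2 (Cs y z H)))).
assert (Un := rep_unique a F f G _ _ _ _ al be U0 ha HN HR HD).
split; [exact HW |]. split; [exact Kv |]. split; [now apply Cauchy |]. split; [exact Pv |]. split.
- intros x Hx. rewrite (B x), (By x), (Bz x). split; [now apply EU | now apply Ev].
- intros w Kw. split.
  + intros Hw. apply Un; auto. now apply Cauchy.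
  + intros Hp Hi. apply Un; auto.
    set (m := match j with j1 => -1 | _ => 1 end).
    apply (cauchy_piece a F f G _ _ _ _ ha HN HR phij psij be U0 x0 m); auto.
    * apply HD.
    * apply HD.
    * intros s Hs. now apply EU, (Cs s s).
    * intros y z H. apply Ei; now apply (Cs y z).
    * unfold m; destruct j; lra.
    * intros e He. unfold m. destruct j; unfold sector; simpl; [lra | lra | easy].
    * intros y z. destruct j; unfold sector; simpl; [lra | lra | easy].
    * intros s Hs Ns. apply Hi; [now apply (Cs s s) | exact Ns].
    * intros s Hs Ns. destruct (Qstar_initial a x0 j s ha Hj (proj1 (Cs s s Hs)) Ns) as [d [Hd HQ]].
      exists d. split; [exact Hd |]. split; [intros h Hh; now apply (Qstar_Qsbar a x0), HQ |].
      apply Hi; [now apply (Cs s s) | exact Ns].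
Qed.

(** * The middle piece: a Goursat problem *)

Lemma trace_slope_y (W Wy Wz : R * R -> R) (c : R) : C1_partials W Wy Wz -> C1_slope (fun y => W (y, c)).
Proof.
intros [_ [C1 [_ [H _]]]]. exists (fun w => RInt (fun s => Wy (fst w + s * (snd w - fst w), c)) 0 1).
split; [cont_tac |]. intros y y'.
apply (mean_slope (fun y => W (y, c)) (fun y => Wy (y, c))); [intros; apply H | cont_tac].
Qed.

Lemma trace_slope_z (W Wy Wz : R * R -> R) (c : R) : C1_partials W Wy Wz -> C1_slope (fun z => W (c, z)).
Proof.
intros [_ [_ [C1 [_ H]]]]. exists (fun w => RInt (fun s => Wz (c, fst w + s * (snd w - fst w))) 0 1).
split; [cont_tac |]. intros z z'.
apply (mean_slope (fun z => W (c, z)) (fun z => Wz (c, z))); [intros; apply H | cont_tac].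
Qed.

(** The traces of the outer pieces are of class C^2, since these are defined and of class C^2
    beyond their sectors. *)
Lemma goursat_data (x0 c : R) (W1 W1y W1z W2 W2y W2z : R * R -> R) :
  C2_partials W1 W1y W1z -> C2_partials W2 W2y W2z ->
  curve_data (fun y => W1y (y, x0)) (fun z => W2z (x0, z)) (fun y => W1 (y, x0) + c) (fun _ => x0).
Proof.
intros [H1 [[W1yy [W1yz H1y]] _]] [H2 [_ [W2zy [W2zz H2z]]]].
assert (A1 := proj1 H1). assert (A2 := proj1 H1y). assert (A3 := proj1 H2z).
split; [cont_tac | cont_tac | cont_tac | | |].
- now apply trace_slope_y with (1 := H1y).
- now apply trace_slope_z with (1 := H2z).
- exists 0. split; [intros; ring |]. split; [now left |].
  intros y. rewrite Rmult_0_l. apply der_plus; [apply H1 | apply der_const].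
Qed.

(** On j3 the matching conditions prescribe the values on both characteristics through
    (0, x0) in terms of the outer pieces, which are known by then. *)
Lemma goursat_piece (a x0 A : R) (F : R * R -> R) (f G : (R * R) * (R * R * R) -> R)
    (phi1 phi2 : R -> R) (W1 W1y W1z W2 W2y W2z : R * R -> R) :
  0 < a -> nonlinearity a F f G -> C2_partials W1 W1y W1z -> C2_partials W2 W2y W2z ->
  W1 (x0, x0) = phi1 x0 -> W2 (x0, x0) = phi2 x0 ->
  let traces w := (forall y, y <= x0 -> w (P a y x0) = W1 (y, x0) + A - phi1 x0) /\
                  (forall z, x0 <= z -> w (P a x0 z) = W2 (x0, z) + A - phi2 x0) in
  exists v, CK basis2 2 (Qsbar a x0 j3) v /\ traces v /\
    (forall p, Qsbar a x0 j3 p -> pde a F f (Qsbar a x0 j3) v p) /\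
    (forall w, CK basis2 2 (Qsbar a x0 j3) w ->
       (forall q, interior_of (Qsbar a x0 j3) q -> pde a F f (Qsbar a x0 j3) w q) -> traces w ->
       forall p, Qsbar a x0 j3 p -> w p = v p) /\
    forall uj : idx -> R * R -> R, CK basis2 2 (Qsbar a x0 j3) (uj j3) ->
       (forall y, y <= x0 -> uj j1 (P a y x0) = W1 (y, x0)) ->
       (forall z, x0 <= z -> uj j2 (P a x0 z) = W2 (x0, z)) ->
       (uj j3 = v -> goursat_equation a x0 A F f phi1 phi2 uj) /\
       (goursat_equation a x0 A F f phi1 phi2 uj -> forall p, Qsbar a x0 j3 p -> uj j3 p = v p).
Proof.
intros ha HN H1 H2 D1 D2 traces.
assert (HR := sector_region a x0 ha j3).
assert (HD := goursat_data x0 (A - phi1 x0) _ _ _ _ _ _ H1 H2).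
set (al := fun y => W1y (y, x0)) in HD. set (be := fun z => W2z (x0, z)) in HD.
set (U0 := fun y => W1 (y, x0) + (A - phi1 x0)) in HD.
destruct (rep_exists a F f G _ _ _ _ al be U0 ha HN HR HD) as [v [Kv [Rv [[W [Wy [Wz [HW [Ew [_ [_ B]]]]]]] Pv]]]].
assert (Ib : forall z, RInt be x0 z = W2 (x0, z) - phi2 x0).
{ intros z. rewrite <- D2. apply (RInt_of_derivative (fun z => W2 (x0, z)) be); [intros; apply (proj1 H2) |].
  assert (X := proj1 (proj2 (proj2 (proj1 H2)))). unfold be; cont_tac. }
assert (Un := rep_unique a F f G _ _ _ _ al be U0 ha HN HR HD).
exists v. split; [exact Kv |]. split; [| split; [exact Pv | split]].
- split; intros s Hs; unfold sector.
  + rewrite Ew, to_char_P by exact ha. change x0 with (data_curve x0 j3 s) at 1. rewrite B. unfold U0; ring.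
  + rewrite Rv by (unfold sector; simpl; lra). unfold Uop, Qop; simpl.
    rewrite (RInt_ext _ be) by (intros; rewrite RInt_same; toR; ring). rewrite Ib. unfold U0. rewrite D1. ring.
- intros w Kw Pw [T1 T2]. apply Un; auto.
  apply (pde_represented a F f G _ _ _ _ ha HN HR); auto.
  + apply HD.
  + intros y z Hyz. unfold sector in Hyz; simpl in Hyz. change (data_curve x0 j3 y) with x0.
    rewrite T1 by lra. unfold U0; ring.
  + intros y z Hyz. unfold sector in Hyz; simpl in Hyz. unfold data_curve.
    rewrite <- (increment_z_of_v a _ _ _ _ ha HR w x0 x0 z Kw) by (unfold sector; simpl; lra).
    rewrite !T2, Ib, D2 by lra. toR; ring.
- intros uj Ku E1 E2.
  assert (GE : goursat_equation a x0 A F f phi1 phi2 uj <->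
     represented a F f (Qsbar a x0 j3) (sector x0 j3) (retract x0 j3) be U0 (data_curve x0 j3) (uj j3)).
  { apply (goursat_represented a F f G _ _ _ _ ha HN HR); auto.
    - apply HD.
    - intros p. rewrite (Qsbar_iff a x0 ha), (sector_edges a x0 ha). apply (Qstar_iff a x0 ha j3).
    - intros y z Hyz. unfold sector in Hyz; simpl in Hyz. rewrite E1 by lra. unfold U0; ring.
    - intros y z Hyz. unfold sector in Hyz; simpl in Hyz. rewrite E2 by lra. apply Ib. }
  split.
  + intros Eu. apply GE. rewrite Eu. exact Rv.
  + intros Hu. apply Un; auto. now apply GE.
Qed.

(** * The theorem *)

Theorem theorem1 (a x0 A L : R)
    (F : R * R -> R) (f : (R * R) * (R * R * R) -> R)
    (phi1 phi2 psi1 psi2 : R -> R)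
    (ha : 0 < a)
    (hF : CK basis2 1 Qbar F)
    (hf : CK basis5 1 (fun q : (R * R) * (R * R * R) => Qbar (fst q)) f)
    (hphi1 : CK basis1 2 (fun x : R => x <= x0) phi1)
    (hphi2 : CK basis1 2 (fun x : R => x0 <= x) phi2)
    (hpsi1 : CK basis1 1 (fun x : R => x <= x0) psi1)
    (hpsi2 : CK basis1 1 (fun x : R => x0 <= x) psi2)
    (hLip : forall p : R * R, Qbar p -> forall z1 z2 z3 w1 w2 w3 : R,
       Rabs (f (p, (z1, z2, z3)) - f (p, (w1, w2, w3)))
         <= L * (Rabs (z1 - w1) + Rabs (z2 - w2) + Rabs (z3 - w3))) :
  exists (u : R * R -> R) (uj : idx -> R * R -> R),
    classical_solution_with a x0 A F f phi1 phi2 psi1 psi2 u uj /\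
    (forall v : R * R -> R,
       classical_solution a x0 A F f phi1 phi2 psi1 psi2 v ->
       forall p, Qbar p -> v p = u p) /\
    integral_equations a x0 A F f phi1 phi2 psi1 psi2 uj /\
    (forall vj : idx -> R * R -> R,
       (forall j, CK basis2 2 (Qsbar a x0 j) (vj j)) ->
       integral_equations a x0 A F f phi1 phi2 psi1 psi2 vj ->
       forall j p, Qsbar a x0 j p -> vj j p = uj j p).
Proof.
destruct (nonlinearity_exists a L F f ha hF hf hLip) as [G HN].
destruct (outer_piece a x0 F f G j1 phi1 psi1 ha HN ltac:(easy) hphi1 hpsi1)
  as [W1 [W1y [W1z [H1 [K1 [I1 [P1 [B1 Un1]]]]]]]].
destruct (outer_piece a x0 F f G j2 phi2 psi2 ha HN ltac:(easy) hphi2 hpsi2)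
  as [W2 [W2y [W2z [H2 [K2 [I2 [P2 [B2 Un2]]]]]]]].
set (v1 := fun p => W1 (to_char a p)) in *. set (v2 := fun p => W2 (to_char a p)) in *.
destruct (goursat_piece a x0 A F f G phi1 phi2 W1 W1y W1z W2 W2y W2z ha HN H1 H2
  (proj1 (B1 x0 (Rle_refl x0))) (proj1 (B2 x0 (Rle_refl x0)))) as [v3 [K3 [[T1 T2] [P3 [Un3 G3]]]]].
assert (V1 : forall y z, v1 (P a y z) = W1 (y, z)) by (intros; unfold v1; now rewrite to_char_P).
assert (V2 : forall y z, v2 (P a y z) = W2 (y, z)) by (intros; unfold v2; now rewrite to_char_P).
set (uj := fun j => match j with j1 => v1 | j2 => v2 | j3 => v3 end).
set (u := fun p : R * R => if Rlt_dec 0 (edge2 a x0 j1 p) then v1 p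
   else if Rlt_dec 0 (edge2 a x0 j2 p) then v2 p else v3 p).
assert (Kuj : forall j, CK basis2 2 (Qsbar a x0 j) (uj j)) by (intros []; assumption).
assert (Puj : forall j p, Qsbar a x0 j p -> pde a F f (Qsbar a x0 j) (uj j) p) by (intros []; assumption).
assert (Euj : forall j p, Qstar a x0 j p -> u p = uj j p).
{ intros j p Hp. apply (Qstar_iff a x0 ha) in Hp. unfold u, uj.
  destruct j; destruct (Rlt_dec 0 (edge2 a x0 j1 p)), (Rlt_dec 0 (edge2 a x0 j2 p)); try reflexivity; simpl in *; nra. }
assert (M1 : forall y, y <= x0 -> Qsbar a x0 j1 (P a y x0)).
{ intros y Hy. apply (Qsbar_iff a x0 ha). rewrite to_char_P by exact ha. unfold sector; simpl; lra. }
assert (M2 : forall z, x0 <= z -> Qsbar a x0 j2 (P a x0 z)).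
{ intros z Hz. apply (Qsbar_iff a x0 ha). rewrite to_char_P by exact ha. unfold sector; simpl; lra. }
exists u, uj. split; [| split; [| split]].
- split; [exact Euj |]. split; [exact Kuj |]. split; [| split; [| split]].
  + intros j p Hp. apply (Puj j p). now apply (Qstar_Qsbar a x0).
  + intros x. unfold phi. rewrite <- (P_diag a x).
    destruct (Rlt_dec x x0) as [Lx | Lx]; [| destruct (Rlt_dec x0 x) as [Lx' | Lx']].
    * rewrite (Euj j1); [unfold uj; rewrite V1; apply B1; simpl; lra |].
      rewrite P_diag. apply (Qstar_iff a x0 ha j1); simpl; lra.
    * rewrite (Euj j2); [unfold uj; rewrite V2; apply B2; simpl; lra |].
      rewrite P_diag. apply (Qstar_iff a x0 ha j2); simpl; lra.
    * assert (x = x0) by lra. subst x. rewrite (Euj j3).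
      -- unfold uj. rewrite T1 by lra. rewrite (proj1 (B1 x0 (Rle_refl x0))). ring.
      -- rewrite P_diag. apply (Qstar_iff a x0 ha j3); simpl; lra.
  + intros x Hx.
    assert (Vel : forall W Wy Wz, C2_partials W Wy Wz -> is_derive (fun h => W (to_char a (h, x))) 0 (a * (Wz (x, x) - Wy (x, x)))).
    { intros W Wy Wz HW. assert (E := partial_t _ _ _ _ (C1_along_t a W Wy Wz (0, x) (proj1 HW))).
      assert (X : to_char a (0, x) = (x, x)) by (unfold to_char; simpl; f_equal; ring).
      cbv beta in E. rewrite X in E.
      replace (a * (Wz (x, x) - Wy (x, x))) with (- a * Wy (x, x) + a * Wz (x, x)) by ring. exact E. }
    unfold psi. destruct (Rlt_dec x x0) as [Lx | Lx].
    * destruct (Qstar_initial a x0 j1 x ha ltac:(easy) (Rlt_le _ _ Lx) Hx) as [d [Hd HQ]].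
      apply (quotient_lim_ext (fun h => v1 (h, x)) (fun h => u (h, x)) d); [exact Hd | intros; symmetry; now apply (Euj j1), HQ |].
      apply (quotient_lim (fun h => v1 (h, x))). rewrite <- (proj2 (B1 x (Rlt_le _ _ Lx))). now apply Vel.
    * assert (Lx' : x0 <= x) by lra.
      destruct (Qstar_initial a x0 j2 x ha ltac:(easy) Lx' Hx) as [d [Hd HQ]].
      apply (quotient_lim_ext (fun h => v2 (h, x)) (fun h => u (h, x)) d); [exact Hd | intros; symmetry; now apply (Euj j2), HQ |].
      apply (quotient_lim (fun h => v2 (h, x))). rewrite <- (proj2 (B2 x Lx')). now apply Vel.
  + intros t Ht. unfold uj. assert (0 <= a * t) by (apply Rmult_le_pos; lra). split.
    * rewrite <- (P_to_char a t (x0 - a * t) ha). replace (x0 - a * t + a * t) with x0 by ring.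
      rewrite V1. apply T1. lra.
    * rewrite <- (P_to_char a t (x0 + a * t) ha). replace (x0 + a * t - a * t) with x0 by ring.
      rewrite V2. apply T2. lra.
- intros v [vj [Ev [Kv [Pv [Iv [Dv Gv]]]]]].
  assert (Pv' : forall j q, interior_of (Qsbar a x0 j) q -> pde a F f (Qsbar a x0 j) (vj j) q).
  { intros j q Hq. apply (Pv j q). now apply (interior_Qstar a x0 ha). }
  assert (Init : forall j s, j <> j3 -> side x0 j s -> s <> x0 -> vj j (0, s) = phi x0 A phi1 phi2 s /\
     filterlim (fun h => (vj j (h, s) - vj j (0, s)) / h) (at_right 0) (locally (psi x0 psi1 psi2 s))).
  { intros j s Hj Hs Ns. destruct (Qstar_initial a x0 j s ha Hj Hs Ns) as [d [Hd HQ]]. split.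
    - rewrite <- (Ev j) by (apply HQ; lra). apply Iv.
    - apply (quotient_lim_ext (fun h => v (h, s)) (fun h => vj j (h, s)) d); [exact Hd | intros; now apply Ev, HQ |].
      now apply Dv. }
  assert (A1 : forall p, Qsbar a x0 j1 p -> vj j1 p = v1 p).
  { apply (proj2 (Un1 (vj j1) (Kv j1))); [apply Pv' |]. intros s Hs Ns. simpl in Hs.
    assert (X := Init j1 s ltac:(easy) Hs Ns). unfold phi, psi in X.
    destruct (Rlt_dec s x0); [exact X | lra]. }
  assert (A2 : forall p, Qsbar a x0 j2 p -> vj j2 p = v2 p).
  { apply (proj2 (Un2 (vj j2) (Kv j2))); [apply Pv' |]. intros s Hs Ns. simpl in Hs.
    assert (X := Init j2 s ltac:(easy) Hs Ns). unfold phi, psi in X.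
    destruct (Rlt_dec s x0); [lra |]. destruct (Rlt_dec x0 s); [exact X | lra]. }
  assert (A3 : forall p, Qsbar a x0 j3 p -> vj j3 p = v3 p).
  { apply Un3; [apply Kv | apply Pv' |]. split; intros s Hs.
    - assert (Ht : 0 <= (x0 - s) / (2 * a)) by (apply Rdiv_le_0_compat; lra).
      assert (E := proj1 (Gv _ Ht)).
      replace ((x0 - s) / (2 * a), x0 - a * ((x0 - s) / (2 * a))) with (P a s x0) in E by (unfold P; f_equal; field; lra).
      rewrite E, A1, V1 by (now apply M1). reflexivity.
    - assert (Ht : 0 <= (s - x0) / (2 * a)) by (apply Rdiv_le_0_compat; lra).
      assert (E := proj2 (Gv _ Ht)).
      replace ((s - x0) / (2 * a), x0 + a * ((s - x0) / (2 * a))) with (P a x0 s) in E by (unfold P; f_equal; field; lra).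
      rewrite E, A2, V2 by (now apply M2). reflexivity. }
  intros p Hp. apply Qbar_iff in Hp. destruct (Qstar_cover a x0 ha p Hp) as [j Hj].
  rewrite (Ev j p Hj), (Euj j p Hj).
  apply (Qstar_Qsbar a x0) in Hj. destruct j; [now apply A1 | now apply A2 | now apply A3].
- split; [exact I1 |]. split; [exact I2 |].
  apply (G3 uj (Kuj j3)); [intros; apply V1 | intros; apply V2 | reflexivity].
- intros vj Kv [E1 [E2 E3]].
  assert (A1 := proj1 (Un1 (vj j1) (Kv j1)) E1). assert (A2 := proj1 (Un2 (vj j2) (Kv j2)) E2).
  assert (A3 : forall p, Qsbar a x0 j3 p -> vj j3 p = v3 p).
  { apply (G3 vj (Kv j3)); [| | exact E3].
    - intros y Hy. rewrite A1 by (now apply M1). apply V1.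
    - intros z Hz. rewrite A2 by (now apply M2). apply V2. }
  intros []; assumption.
Qed.
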